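(* Let $X$ be a complex manifold of dimension $n\ge2$ and let $\nabla$ be a torsion-free $C^\infty$ connection in $T_X$. Then $\nabla$ satisfies Wronskian curvature positivity if and only if its projective class is holomorphic.
   Context: Write $T_X := T^{1,0}X$ for the holomorphic tangent bundle and $K_X^* := \bigwedge^n T_X$. A $C^\infty$ connection in $T_X$ is a map $(U,V)\mapsto \nabla_U V$, for smooth sections $U,V\in\Gamma^\infty(T_X)$, with values in $\Gamma^\infty(T_X)$, complex linear in both variables, $C^\infty$-linear in $U$, and satisfying $\nabla_U(aV)=U(a)V+a\nabla_U V$ for every smooth complex-valued function $a$ (only $(1,0)$ directions $U$ are involved). In local holomorphic coordinates write $\nabla_{\partial_i}\partial_j=\Gamma^k_{ij}\partial_k$ (Einstein summation), with smooth $\Gamma^k_{ij}$. Torsion: $T^\nabla(U,V):=\nabla_UV-\nabla_VU-[U,V]$; $\nabla$ is torsion-free if $T^\nabla=0$. Wronskian: for a holomorphic curve $f$ from an open subset of $\mathbb C$ (coordinate $t$) to $X$, set $F_1:=f'$, $F_{r+1}:=\nabla_{f'}F_r$ ($r\ge1$), smooth sections of $f^*T_X$, where in coordinates $(\nabla_{f'}G)^k=\partial_t G^k+\Gamma^k_{ij}(f)\,(f^i)'G^j$ for a smooth section $G$ of $f^*T_X$, with $\partial_t$ the Wirtinger derivative. Put $W(\nabla,f):=F_1\wedge\cdots\wedge F_n$, a smooth section of $f^*K_X^*$. Wronskian curvature positivity of $\nabla$: for every holomorphic disk $f:\Delta\to X$, every sufficiently small subdisk $\Delta_0\subset\Delta$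 whose image lies in an open set trivializing $K_X^*$ holomorphically, and every holomorphic frame $\varepsilon$ of $K_X^*$ there, write $W(\nabla,f)|_{\Delta_0}=w_f\,\varepsilon$; the condition is that whenever $W(\nabla,f)\not\equiv0$, the function $\log|w_f|$ (value $-\infty$ allowed at zeros of $w_f$) is subharmonic on $\Delta_0$. (This is independent of the frame $\varepsilon$.) Projective equivalence: torsion-free connections $D,\widehat D$ are projectively equivalent if locally there is a smooth $1$-form $\alpha$ (section of $T_X^*$) with $\widehat D_UV=D_UV+\alpha(U)V+\alpha(V)U$. The projective class of a torsion-free connection is its equivalence class. The projective Christoffel symbols of a torsion-free connection with coefficients $S^k_{ij}$ are $\Pi^k_{ij}:=S^k_{ij}-\frac1{n+1}(\delta^k_iS^a_{aj}+\delta^k_jS^a_{ai})$; they depend only on the projective class. The projective class is holomorphic if $\bar\partial\,\Pi^k_{ij}=0$ in every holomorphic coordinate chart. *)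

(* Defs.v *)
From HB Require Import structures.
From mathcomp Require Import all_boot all_order all_algebra.
From mathcomp Require Import all_classical all_reals all_analysis.
From mathcomp Require Import complex.

Set Implicit Arguments.
Unset Strict Implicit.
Unset Printing Implicit Defensive.

Import Order.TTheory GRing.Theory Num.Theory.
Import numFieldNormedType.Exports.

Local Open Scope classical_set_scope.
Local Open Scope ring_scope.

(* The alias ^o is what carries the usual topology of the complex numbers. *)
Notation Cplx R := ((complex R)^o).
Notation CVec R n := ('rV[Cplx R]_n).

(** * Smooth and holomorphic functions on open sets of C or C^n *)

Section Calculus.
Variables (R : realType) (V : normedModType R[i]).
Implicit Types (O : set V) (g : V -> Cplx R) (v p : V) (k : nat).

(* Derivative of g at p along the real line s |-> p + s v. *)
Definition rderivable g v p : Prop :=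
  derivable (fun s : R => complex.Re (g (p + (s%:C)%C *: v))) 0 1 /\
  derivable (fun s : R => complex.Im (g (p + (s%:C)%C *: v))) 0 1.

Definition rderive g v p : Cplx R :=
  (derive1 (fun s : R => complex.Re (g (p + (s%:C)%C *: v))) 0 +i*
   derive1 (fun s : R => complex.Im (g (p + (s%:C)%C *: v))) 0)%C.

Fixpoint Ck k O g : Prop :=
  (forall p, O p -> {for p, continuous g}) /\
  match k with
  | 0 => True
  | k'.+1 => forall v,
      (forall p, O p -> rderivable g v p) /\ Ck k' O (rderive g v)
  end.

Definition smooth O g : Prop := forall k, Ck k O g.

(* Wirtinger derivatives: for v the a-th basis vector these are
   d/dz_a and d/d(conj z_a). *)
Definition dz v g p : Cplx R :=
  2^-1 * (rderive g v p - 'i%C * rderive g ('i%C *: v) p).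

Definition dzbar v g p : Cplx R :=
  2^-1 * (rderive g v p + 'i%C * rderive g ('i%C *: v) p).

(* Holomorphic in the sense of Griffiths and Harris: smooth and annihilated
   by the Cauchy-Riemann operator. *)
Definition holomorphic O g : Prop :=
  smooth O g /\ forall v p, O p -> dzbar v g p = 0.

End Calculus.

Notation basis_vec a := (delta_mx 0 a).

(** * Complex manifolds *)

(* The values of cmap outside cdom, and of cinv outside cmap @` cdom, are
   irrelevant. *)
Record chart (R : realType) (n : nat) (X : topologicalType) := Chart {
  cdom : set X;
  cmap : X -> CVec R n;
  cinv : CVec R n -> X;
  cdom_open : open cdom;
  cimg_open : open (cmap @` cdom);
  cmapK : forall p, cdom p -> cinv (cmap p) = p;
  cmap_continuous : forall p, cdom p -> {for p, continuous cmap};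
  cinv_continuous : forall z, (cmap @` cdom) z -> {for z, continuous cinv}
}.

Definition cimg (R : realType) (n : nat) (X : topologicalType)
  (c : chart R n X) : set (CVec R n) := cmap c @` cdom c.

Definition holo_transition (R : realType) (n : nat) (X : topologicalType)
    (c c' : chart R n X) : Prop :=
  forall k, holomorphic (cmap c @` (cdom c `&` cdom c'))
                        (fun z => cmap c' (cinv c z) 0 k).

(* The atlas is maximal, so its members are all the holomorphic coordinate
   charts of the manifold. *)
Record complex_manifold (R : realType) (n : nat) (X : topologicalType) :=
  ComplexManifold {
  atlas : set (chart R n X);
  cm_hausdorff : hausdorff_space X;
  cm_second_countable : @second_countable X;
  atlas_cover : forall p, exists2 c, atlas c & cdom c p;
  atlas_holo : forall c c', atlas c -> atlas c' -> holo_transition c c';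
  atlas_maximal : forall c,
    (forall c', atlas c' -> holo_transition c c' /\ holo_transition c' c) ->
    atlas c
}.

Section Manifold.
Variables (R : realType) (n : nat) (X : topologicalType).
Variable M : complex_manifold R n X.
Local Notation C := (Cplx R).
Local Notation Cn := (CVec R n).
Local Notation chart := (chart R n X).
Implicit Types (c : chart) (p q : X) (a : X -> C) (O : set X).

(* [chart_at c p]: c is a holomorphic chart around p. *)
Definition chart_at c p : Prop := atlas M c /\ cdom c p.

(* (d z'^b / d z^a) at p, for z, z' the coordinates of c, c'. *)
Definition jacobian c c' p : 'M[C]_n :=
  \matrix_(i, j) dz (basis_vec i) (fun z => cmap c' (cinv c z) 0 j) (cmap c p).

Definition smooth_function a : Prop :=
  forall c, atlas M c -> smooth (cimg c) (a \o cinv c).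

(** ** Sections of T_X = T^{1,0} X *)

(* A section V is given by its components in all charts:
   V = \sum_k (V c p)_k d/dz^k at p, z being the coordinates of c. *)
Definition field := chart -> X -> Cn.
Implicit Types U V : field.

(* Components are 0 where they have no meaning, so that distinct families
   are distinct sections. *)
Definition smooth_field V : Prop :=
  [/\ forall c p, ~ chart_at c p -> V c p = 0,
      forall c c' p, chart_at c p -> chart_at c' p ->
        V c' p = V c p *m jacobian c c' p
    & forall c k, atlas M c -> smooth (cimg c) (fun z => V c (cinv c z) 0 k)].

Definition addf U V : field := fun c p => U c p + V c p.
Definition scalef a V : field := fun c p => a p *: V c p.

(* U(a) at p, computed in the chart c. *)
Definition lie_derive c U a p : C :=
  \sum_k U c p 0 k * dz (basis_vec k) (a \o cinv c) (cmap c p).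

Definition bracket U V : field := fun c p =>
  \row_k (lie_derive c U (fun q => V c q 0 k) p
          - lie_derive c V (fun q => U c q 0 k) p).

(** ** Connections *)

Record connection := Connection {
  cov :> field -> field -> field;
  cov_smooth : forall U V,
    smooth_field U -> smooth_field V -> smooth_field (cov U V);
  cov_addl : forall U U' V,
    smooth_field U -> smooth_field U' -> smooth_field V ->
    cov (addf U U') V = addf (cov U V) (cov U' V);
  cov_addr : forall U V V',
    smooth_field U -> smooth_field V -> smooth_field V' ->
    cov U (addf V V') = addf (cov U V) (cov U V');
  cov_constr : forall (k : C) U V, smooth_field U -> smooth_field V ->
    cov U (scalef (fun=> k) V) = scalef (fun=> k) (cov U V);
  cov_scalel : forall a U V,
    smooth_function a -> smooth_field U -> smooth_field V ->
    cov (scalef a U) V = scalef a (cov U V);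
  cov_leibniz : forall a U V,
    smooth_function a -> smooth_field U -> smooth_field V ->
    forall c p, chart_at c p ->
    cov U (scalef a V) c p
      = lie_derive c U a p *: V c p + a p *: cov U V c p
}.
Implicit Types D : connection.

Definition torsion D U V : field := fun c p =>
  D U V c p - D V U c p - bracket U V c p.

Definition torsion_free D : Prop :=
  forall U V, smooth_field U -> smooth_field V ->
  forall c p, chart_at c p -> torsion D U V c p = 0.

(* Connections act on global sections, so the local section d/dz^i of the
   chart c is replaced by a global smooth section equal to it near p; by
   locality of connections the choice does not affect [christoffel]. *)
Definition coord_field c (i : 'I_n) p : field :=
  xget (fun _ _ => 0)
    [set U | smooth_field U /\ \forall q \near p, U c q = basis_vec i].

(* Gamma^k_{ij}: the k-th component of D_{d_i} d_j. *)
Definition christoffel D c (i j k : 'I_n) p : C :=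
  D (coord_field c i p) (coord_field c j p) c p 0 k.

(** ** Wronskians *)

Definition holo_curve (T : set C) (f : C -> X) : Prop :=
  (forall t, T t -> {for t, continuous f}) /\
  forall c k, atlas M c ->
    holomorphic (T `&` f @^-1` cdom c) (fun t => cmap c (f t) 0 k).

(* d/dt, for the coordinate t of C. *)
Definition dt (g : C -> C) (t : C) : C := dz (1 : C) g t.

(* [wronskian_field D f c r] is F_{r+1} in the chart c. *)
Fixpoint wronskian_field D (f : C -> X) c (r : nat) : C -> Cn :=
  match r with
  | 0 => fun t => \row_k dt (fun s => cmap c (f s) 0 k) t
  | r'.+1 => let F := wronskian_field D f c r' in
      fun t => \row_k (dt (fun s => F s 0 k) t
        + \sum_i \sum_j christoffel D c i j k (f t)
                        * dt (fun s => cmap c (f s) 0 i) t * F t 0 j)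
  end.

(* Coefficient of F_1 /\ ... /\ F_n on d_1 /\ ... /\ d_n in the chart c. *)
Definition wronskian D (f : C -> X) c (t : C) : C :=
  \det (\matrix_(r < n, k < n) wronskian_field D f c r t 0 k).

(* A holomorphic frame of the line bundle /\^n T_X over the open set O, by its
   coefficient on d_1 /\ ... /\ d_n in all charts; in another chart this
   coefficient is multiplied by the Jacobian determinant. *)
Definition holo_frame O (e : chart -> X -> C) : Prop :=
  [/\ forall c p, O p -> chart_at c p -> e c p != 0,
      forall c c' p, O p -> chart_at c p -> chart_at c' p ->
        e c' p = \det (jacobian c c' p) * e c p
    & forall c, atlas M c ->
        holomorphic (cmap c @` (O `&` cdom c)) (e c \o cinv c)].

(** ** Projective equivalence *)

(* A smooth section of the dual of T_X over the open set O. *)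
Definition smooth_oneform O (al : chart -> X -> Cn) : Prop :=
  (forall c c' p, O p -> chart_at c p -> chart_at c' p ->
     al c p = al c' p *m (jacobian c c' p)^T) /\
  (forall c k, atlas M c ->
     smooth (cmap c @` (O `&` cdom c)) (fun z => al c (cinv c z) 0 k)).

Definition pairing (al u : Cn) : C := \sum_k al 0 k * u 0 k.

Definition proj_equiv D D' : Prop :=
  forall p, exists O : set X, exists al : chart -> X -> Cn,
    [/\ open O, O p, smooth_oneform O al
      & forall U V, smooth_field U -> smooth_field V ->
        forall c q, O q -> chart_at c q ->
        D' U V c q = D U V c q + pairing (al c q) (U c q) *: V c q
                               + pairing (al c q) (V c q) *: U c q].

Definition projective_class D : set connection :=
  [set D' | torsion_free D' /\ proj_equiv D D'].

Definition proj_christoffel D c (i j k : 'I_n) p : C :=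
  christoffel D c i j k p
  - (n.+1%:R)^-1 * ((k == i)%:R * (\sum_l christoffel D c l j l p)
                    + (k == j)%:R * (\sum_l christoffel D c l i l p)).

(* P is meant to be a projective class; the projective Christoffel symbols are
   the same for all its members. *)
Definition holomorphic_class (P : set connection) : Prop :=
  forall D, P D -> forall c (i j k l : 'I_n), atlas M c ->
  forall z, cimg c z ->
  dzbar (basis_vec l) (proj_christoffel D c i j k \o cinv c) z = 0.

End Manifold.

(** * Subharmonic functions and Wronskian curvature positivity *)

(* The value -oo is allowed; the function constantly -oo is subharmonic. *)
Definition subharmonic (R : realType) (O : set (Cplx R))
    (u : Cplx R -> \bar R) : Prop :=
  [/\ forall z, O z -> (u z < +oo)%E,
      forall z (m : R), O z -> (u z < m%:E)%E ->
        \forall y \near z, (u y < m%:E)%E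
    & forall (z : Cplx R) (r : R), 0 < r ->
        [set y | `|y - z| <= (r%:C)%C] `<=` O ->
        (u z <= ((2 * pi)^-1)%:E *
           \int[@lebesgue_measure R]_(th in `[0%R, (2 * pi)%R])
              u (z + (r%:C)%C * (cos th +i* sin th)%C)%R)%E].

Definition log_abs (R : realType) (z : Cplx R) : \bar R :=
  lne (complex.Re `|z|)%:E.

(* ball a r is an open disk of C; w is the function w_f. *)
Definition wronskian_positive (R : realType) (n : nat) (X : topologicalType)
    (M : complex_manifold R n X) (D : connection M) : Prop :=
  forall (f : Cplx R -> X) (a : Cplx R) (r : R), 0 < r ->
  holo_curve M (ball a (r%:C)%C) f ->
  (exists t c, [/\ ball a (r%:C)%C t, chart_at M c (f t)
                 & wronskian D f c t != 0]) ->
  forall (b : Cplx R) (s : R), 0 < s ->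
  ball b (s%:C)%C `<=` ball a (r%:C)%C ->
  forall (O : set X) (e : chart R n X -> X -> Cplx R),
  open O -> holo_frame M O e -> f @` ball b (s%:C)%C `<=` O ->
  forall w : Cplx R -> Cplx R,
  (forall t c, ball b (s%:C)%C t -> chart_at M c (f t) ->
     wronskian D f c t = w t * e c (f t)) ->
  subharmonic (ball b (s%:C)%C) (fun t => log_abs (w t)).

(* Main.v *)
(**
Write the Christoffel symbols of a torsion-free connection as
Gamma^k_ij = Pi^k_ij + delta^k_i A_j + delta^k_j A_i.

If Pi is holomorphic, let E_1 = f' and E_{r+1} = dE_r/dt + Pi(f', E_r); these fields are
holomorphic and F_r = E_r modulo E_1, ..., E_{r-1}. Hence the Wronskian is the determinant of
the E_r, it is holomorphic, and log |w| is subharmonic.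

Conversely, where w <> 0, subharmonicity of log |w| says that
d dbar w / w - d w dbar w / w^2 >= 0. The curve is free to have any (F_1, ..., F_n) at one
point. Adding y t^(n+1)/(n+1)! to it changes F_n at first order in t only, and changes this
expression by a complex linear form in y, which must therefore vanish; so dbar of each cofactor
of the last row is proportional to the cofactor. As dbar F_2 is
a |-> sum_l conj(v_l) (dbar_l Gamma)(v, v), v = F_1, this forces dbar F_2 to be parallel
to v: otherwise take F_n = dbar F_2. Polarising in conj(v), each (dbar_l Gamma)(v, v) is
parallel to v for all v, so that its trace-free part dbar_l Pi vanishes.
*)

From HB Require Import structures.
From mathcomp Require Import all_boot all_order all_algebra.
From mathcomp Require Import all_classical all_reals all_analysis.
From mathcomp Require Import perm measurable_realfun.
From mathcomp Require Import complex ring lra.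
Require Import Defs.

Set Implicit Arguments.
Unset Strict Implicit.
Unset Printing Implicit Defensive.

Import Order.TTheory GRing.Theory Num.Theory.
Import numFieldNormedType.Exports.

Local Open Scope classical_set_scope.
Local Open Scope ring_scope.

(** * Derivatives along real lines *)

(** Subharmonicity is given by circle means, so it has to be linked to the Laplacian. Instead of
    Green's formula, a function of positive Laplacian is averaged over the rotations by the roots of
    unity; the maximum principle bounds its value at the centre by a Riemann sum over the circle,
    and these sums tend to the mean. Adding or removing a small multiple of |t - z|^2 gives the case
    of a nonnegative Laplacian and the converse. Zeros of w are reached through log(|w|^2 + eps).

    In the perturbation by t^(n+1), an error O(|t|^2) in the Wronskian would not be good enough: a
    term in t conj(t) would change d dbar w. The errors that occur are smooth multiples of
    holomorphic monomials, so their part of order two is a multiple of t^2, which d dbar does not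
    see at 0. Jets are therefore recorded by two conditions, one on g and one on dbar g.

    Connections act on global sections only, so computing in a chart requires bump functions and the
    locality of the connection. *)

Section ComplexParts.
Variable R : realType.
Implicit Types x y : Cplx R.

Lemma ReD x y : complex.Re (x + y) = complex.Re x + complex.Re y.
Proof. by case: x; case: y. Qed.

Lemma ImD x y : complex.Im (x + y) = complex.Im x + complex.Im y.
Proof. by case: x; case: y. Qed.

Lemma ReN x : complex.Re (- x) = - complex.Re x.
Proof. by case: x. Qed.

Lemma ImN x : complex.Im (- x) = - complex.Im x.
Proof. by case: x. Qed.

Lemma ReM x y : complex.Re (x * y) =
  complex.Re x * complex.Re y - complex.Im x * complex.Im y.
Proof. by case: x; case: y. Qed.

Lemma ImM x y : complex.Im (x * y) =
  complex.Re x * complex.Im y + complex.Im x * complex.Re y.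
Proof. by case: x => a b; case: y => c d /=. Qed.

Lemma Cplx_eq x y : complex.Re x = complex.Re y -> complex.Im x = complex.Im y ->
  x = y.
Proof. by case: x; case: y => a b c d /= -> ->. Qed.

Lemma ReJ x : complex.Re (conjc x) = complex.Re x.
Proof. by case: x. Qed.

Lemma ImJ x : complex.Im (conjc x) = - complex.Im x.
Proof. by case: x. Qed.

Lemma gt0_Cplx (e : R[i]) : 0 < e -> exists2 d : R, 0 < d & e = (d%:C)%C.
Proof.
case: e => a b; rewrite ltcE /= => /andP[/eqP -> a0].
by exists a.
Qed.

Lemma normR (s : R) : `|(s%:C)%C : R[i]| = (`|s|%:C)%C.
Proof. by rewrite normc_def /= expr0n addr0 sqrtr_sqr. Qed.

Lemma continuous_real_complex : continuous (fun s : R => (s%:C)%C : Cplx R).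
Proof.
move=> s; apply/cvgrPdist_lt => e /gt0_Cplx[d d0 ->]; near=> t.
rewrite -rmorphB /= normR ltcR; near: t; exact: cvgr_dist_lt.
Unshelve. all: by end_near. Qed.

Lemma Re_le_norm x : (`|complex.Re x|%:C)%C <= `|x|.
Proof. exact: normc_ge_Re. Qed.

Lemma Im_le_norm x : (`|complex.Im x|%:C)%C <= `|x|.
Proof.
rewrite normc_def lecR -sqrtr_sqr ler_wsqrtr //.
by rewrite lerDr sqr_ge0.
Qed.

Lemma continuous_Re : continuous (@complex.Re R : Cplx R -> R).
Proof.
move=> s; apply/(@cvgrPdist_lt R R^o _ (nbhs s)) => e e0; near=> t.
have : `|s - t| < (e%:C)%C :> R[i].
  by near: t; apply: (nbhsx_ballx s); rewrite ltcR.
by rewrite -ReN -ReD -ltcR; apply: le_lt_trans; exact: Re_le_norm.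
Unshelve. all: by end_near. Qed.

Lemma continuous_Im : continuous (@complex.Im R : Cplx R -> R).
Proof.
move=> s; apply/(@cvgrPdist_lt R R^o _ (nbhs s)) => e e0; near=> t.
have : `|s - t| < (e%:C)%C :> R[i].
  by near: t; apply: (nbhsx_ballx s); rewrite ltcR.
by rewrite -ImN -ImD -ltcR; apply: le_lt_trans; exact: Im_le_norm.
Unshelve. all: by end_near. Qed.

Lemma cvg_Cplx (T : Type) (F : set_system T) {FF : Filter F} (h : T -> Cplx R) x :
  (complex.Re (h t) @[t --> F] --> complex.Re x) ->
  (complex.Im (h t) @[t --> F] --> complex.Im x) ->
  h t @[t --> F] --> x.
Proof.
move=> hr hi.
have -> : h = fun t => (complex.Re (h t))%:C%C + 'i%C * ((complex.Im (h t))%:C%C : Cplx R).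
  by apply/funext => t; rewrite -complexE.
rewrite [x]complexE; apply: cvgD.
  exact: (continuous_cvg _ (@continuous_real_complex _) hr).
apply: cvgM; first exact: cvg_cst.
exact: (continuous_cvg _ (@continuous_real_complex _) hi).
Qed.

End ComplexParts.

Section LineDerivative.
Variables (R : realType) (V : normedModType R[i]).
Implicit Types (g h : V -> Cplx R) (v p : V) (d : Cplx R).

(** Existence and value of [rderive] in one relation, so that the [is_derive] rules for real
    functions carry over directly. *)
Definition rdiff g v p d : Prop :=
  is_derive (0 : R) 1 (fun s : R => complex.Re (g (p + (s%:C)%C *: v))) (complex.Re d) /\
  is_derive (0 : R) 1 (fun s : R => complex.Im (g (p + (s%:C)%C *: v))) (complex.Im d).

Lemma line0 p v : p + ((0 : R)%:C)%C *: v = p.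
Proof. by rewrite scale0r addr0. Qed.

Lemma rdiffP g v p d : rdiff g v p d <-> rderivable g v p /\ rderive g v p = d.
Proof.
rewrite /rdiff /rderive !derive1E; split=> [[[dr er] [di ei]]|[[dr di] <-]].
  split; first by split; [exact: dr|exact: di].
  by rewrite er ei; case: d {er ei}.
by split; [exact: (derivableP dr)|exact: (derivableP di)].
Qed.

Lemma rdiff_rderive g v p d : rdiff g v p d -> rderive g v p = d.
Proof. by move=> /rdiffP[]. Qed.

Lemma rderivable_rdiff g v p : rderivable g v p -> rdiff g v p (rderive g v p).
Proof. by move=> dg; apply/rdiffP. Qed.

Lemma rdiff_rderivable g v p d : rdiff g v p d -> rderivable g v p.
Proof. by move=> /rdiffP[]. Qed.

Lemma continuous_line p v : continuous (fun s : R => p + (s%:C)%C *: v).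
Proof.
move=> s; apply: cvgD; first exact: cvg_cst.
apply: (@cvgZr_tmp _ _ _ _ _ (fun s : R => (s%:C)%C : R[i])).
exact: continuous_real_complex.
Qed.

Lemma near_line (P : V -> Prop) p v : (\forall q \near p, P q) ->
  \forall s \near (0 : R), P (p + (s%:C)%C *: v).
Proof. by rewrite -{1}(line0 p v); apply: continuous_line. Qed.

Lemma near_eq_rdiff g h v p d : (\forall q \near p, g q = h q) ->
  rdiff g v p d -> rdiff h v p d.
Proof.
move=> /(near_line v) gh [d1 d2].
split; [apply: near_eq_is_derive d1|apply: near_eq_is_derive d2];
  by apply: filterS gh => s ->.
Qed.

Lemma rdiff_cst (k : Cplx R) v p : rdiff (fun=> k) v p 0.
Proof. by split; exact: is_derive_cst. Qed.

Lemma rdiffD g h v p d e : rdiff g v p d -> rdiff h v p e ->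
  rdiff (fun q => g q + h q) v p (d + e).
Proof.
move=> [dr di] [er ei]; split.
  rewrite ReD; under eq_fun do rewrite ReD; exact: is_deriveD.
rewrite ImD; under eq_fun do rewrite ImD; exact: is_deriveD.
Qed.

Lemma rdiffM g h v p d e : rdiff g v p d -> rdiff h v p e ->
  rdiff (fun q => g q * h q) v p (d * h p + g p * e).
Proof.
move=> [dr di] [er ei]; split.
  under eq_fun do rewrite ReM.
  apply: (is_derive_eq (is_deriveB (is_deriveM dr er) (is_deriveM di ei))).
  rewrite !line0 ReD !ReM /GRing.scale /=; ring.
under eq_fun do rewrite ImM.
apply: (is_derive_eq (is_deriveD (is_deriveM dr ei) (is_deriveM di er))).
rewrite !line0 ImD !ImM /GRing.scale /=; ring.
Qed.

Lemma rdiff_conj g v p d : rdiff g v p d ->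
  rdiff (fun q => conjc (g q) : Cplx R) v p (conjc d).
Proof.
move=> [dr di]; split.
  rewrite ReJ; by under eq_fun do rewrite ReJ.
by rewrite ImJ; under eq_fun do rewrite ImJ; exact: is_deriveN.
Qed.

Lemma rdiff_real (phi : R -> R) (phi' : R) g v p d :
  is_derive (complex.Re (g p)) 1 phi phi' -> rdiff g v p d ->
  rdiff (fun q => ((phi (complex.Re (g q)))%:C)%C : Cplx R) v p
    ((phi' * complex.Re d)%:C)%C.
Proof.
move=> dphi [dr _]; split; last exact: (is_derive_cst (0 : R) (0 : R) (1 : R)).
have dp : is_derive (complex.Re (g (p + ((0 : R)%:C)%C *: v))) 1 phi phi'.
  by rewrite line0.
exact: is_derive1_comp dp dr.
Qed.

Lemma rdiff_Re g v p d : rdiff g v p d ->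
  is_derive (0 : R) 1 (fun s : R => complex.Re (g (p + (s%:C)%C *: v))) (complex.Re d).
Proof. by case. Qed.

Lemma rdiff_Im g v p d : rdiff g v p d ->
  is_derive (0 : R) 1 (fun s : R => complex.Im (g (p + (s%:C)%C *: v))) (complex.Im d).
Proof. by case. Qed.

Lemma is_derive_shift0 (f : R -> R) (a l : R) :
  is_derive (0 : R) 1 (fun s => f (a + s)) l -> is_derive a 1 f l.
Proof.
move=> df.
have -> : f = (fun s => f (a + s)) \o (fun s => s - a).
  by apply/funext => s /=; congr f; ring.
have d0 : is_derive a 1 (fun s : R => s - a) 1.
  apply: (is_derive_eq (is_deriveB (is_derive_id a 1) (is_derive_cst a a 1))).
  by rewrite subr0.
have df' : is_derive (a - a) 1 (fun s => f (a + s)) l by rewrite subrr.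
have := @is_derive1_comp _ (fun s => f (a + s)) (fun s => s - a) a _ _ df' d0.
by rewrite mulr1.
Qed.

Lemma line_shift p v (a s : R) :
  p + ((a + s)%:C)%C *: v = p + (a%:C)%C *: v + (s%:C)%C *: v.
Proof. by rewrite rmorphD scalerDl addrA. Qed.

Lemma rdiff_at g v p (a : R) d : rdiff g v (p + (a%:C)%C *: v) d ->
  is_derive a 1 (fun s : R => complex.Re (g (p + (s%:C)%C *: v))) (complex.Re d) /\
  is_derive a 1 (fun s : R => complex.Im (g (p + (s%:C)%C *: v))) (complex.Im d).
Proof.
move=> [dr di]; split; apply: is_derive_shift0.
  by move: dr; under eq_fun do rewrite -line_shift.
by move: di; under eq_fun do rewrite -line_shift.
Qed.

End LineDerivative.

(** * Chain rule from continuous directional derivatives *)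

Section ChainRule.
Variables (R : realType) (V : normedModType R[i]).
Implicit Types (g h : V -> Cplx R) (v p q : V) (d : Cplx R).

(** Mean value theorem based at 0 for [b] of either sign; the bound on absolute values replaces the
    interval between 0 and [b]. *)
Lemma mvt0 (f df : R -> R) (b : R) :
  (forall x : R, `|x| <= `|b| -> is_derive x 1 f (df x)) ->
  exists2 c, `|c| <= `|b| & f b - f 0 = df c * b.
Proof.
move=> fd.
have cf (x y : R) : (forall z, x <= z <= y -> `|z| <= `|b|) ->
    {within `[x, y], continuous f}.
  move=> xy; apply: derivable_within_continuous => z; rewrite in_itv /= => zxy.
  by have [] := fd z (xy z zxy).
have [b0|b0] := leP 0 b.
  have P z : 0 <= z <= b -> `|z| <= `|b|.
    by move=> /andP[z0 zb]; rewrite !ger0_norm.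
  have [z|c cb E] := @MVT_segment _ f df 0 b b0 _ (cf _ _ P).
    by rewrite in_itv /= => /andP[z0 zb]; apply/fd/P; rewrite !ltW.
  by exists c; [move: cb; rewrite in_itv; exact: P|rewrite E subr0].
have P z : b <= z <= 0 -> `|z| <= `|b|.
  by move=> /andP[z0 zb]; rewrite !ler0_norm ?lerN2 // ltW.
have [z|c cb E] := @MVT_segment _ f df b 0 (ltW b0) _ (cf _ _ P).
  by rewrite in_itv /= => /andP[z0 zb]; apply/fd/P; rewrite !ltW.
exists c; first by move: cb; rewrite in_itv; exact: P.
by rewrite -[LHS]opprB E; ring.
Qed.

(** Only directional derivatives exist a priori, not a total differential. The increment caused by
    the moving term [c s] along [v] is, by the mean value theorem, [c s] times a value of [dphi]
    near [p], and continuity of [dphi] gives its limit. *)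
Lemma chain_line_step (phi : V -> R) (dphi : V -> R) v (x : R -> V)
    (c : R -> R) (c' l : R) p :
  x 0 = p -> {for 0, continuous x} ->
  (\forall q \near p, is_derive (0 : R) 1 (fun s : R => phi (q + (s%:C)%C *: v)) (dphi q)) ->
  {for p, continuous dphi} ->
  c 0 = 0 -> is_derive (0 : R) 1 c c' ->
  is_derive (0 : R) 1 (fun s => phi (x s)) l ->
  is_derive (0 : R) 1 (fun s => phi (x s + (c s)%:C%C *: v)) (c' * dphi p + l).
Proof.
move=> x0 cx dphiP cdphi c0 dc dl.
have cc : {for 0, continuous c}.
  by apply/differentiable_continuous/derivable1_diffP; case: dc.
pose r s := phi (x s + (c s)%:C%C *: v) - phi (x s).
(* At the zeros of [c] the quotient is replaced by its expected limit, so that [r = D * c] holds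
   everywhere and [D] tends to [dphi p]. *)
pose D s := if c s == 0 then dphi p else r s / c s.
have rE s : r s = D s * c s.
  rewrite /D; case: eqP => [c0s|/eqP cs]; last by rewrite divfK.
  by rewrite /r c0s scale0r addr0 subrr mulr0.
have cD : D s @[s --> (0 : R)] --> dphi p.
  apply/(@cvgrPdist_lt R R^o) => e e0.
  have : \forall q \near p, is_derive (0 : R) 1
      (fun s : R => phi (q + (s%:C)%C *: v)) (dphi q) /\ `|dphi p - dphi q| < e.
    apply: filterS2 dphiP _ => [q h1 h2|]; first by split; [exact: h1|exact: h2].
    by move/(@cvgrPdist_lt R R^o) : cdphi; apply.
  have ct : (fun z : V * R => z.1 + (z.2%:C)%C *: v) z @[z --> (p, 0 : R)]
      --> p.
    have -> : nbhs p = nbhs ((p, 0 : R).1 + ((p, 0 : R).2%:C)%C *: v).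
      by rewrite /= line0.
    apply: cvgD; first exact: cvg_fst.
    apply: (@cvgZr_tmp _ _ _ _ _ (fun z : V * R => (z.2%:C)%C : R[i])).
    apply: (continuous_cvg _ (@continuous_real_complex _ _)); exact: cvg_snd.
  move=> /ct [[A B] /= [nA nB] AB].
  have [d d0 dB] : exists2 d : R, 0 < d & forall s : R, `|s| < d -> B s.
    have [d /= d0 dB] := nB; exists d => // s sd.
    by apply: dB; rewrite /ball_ /= sub0r normrN.
  near=> s.
  rewrite /D; case: eqP => [_|/eqP cs]; first by rewrite subrr normr0.
  have As : A (x s) by near: s; move: nA; rewrite -x0; exact: cx.
  have csd : `|c s| < d.
    near: s.
    have /(@cvgrPdist_lt R R^o) : c z @[z --> (0 : R)] --> 0 by rewrite -{2}c0.
    by move=> /(_ d d0); apply: filterS => t; rewrite sub0r normrN.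
  have P (t : R) : `|t| <= `|c s| ->
      is_derive t 1 (fun s0 : R => phi (x s + (s0%:C)%C *: v))
        (dphi (x s + (t%:C)%C *: v)).
    move=> tc; apply: is_derive_shift0.
    have := AB (x s, t) (conj As (dB _ (le_lt_trans tc csd))).
    by move=> [+ _] /=; under eq_fun do rewrite -line_shift.
  have [t tc] := mvt0 P.
  rewrite line0 -/(r s) => ->; rewrite mulfK //.
  by have := AB (x s, t) (conj As (dB _ (le_lt_trans tc csd))) => -[_].
have dr : is_derive (0 : R) 1 r (c' * dphi p).
  have r0 : r 0 = 0 by rewrite rE c0 mulr0.
  suff H : t^-1 *: (r (t *: (1 : R) + 0) - r 0) @[t --> (0 : R)^'] --> c' * dphi p.
    by apply: DeriveDef; [apply/cvg_ex; eexists; exact: H|exact: cvg_lim H].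
  have E : (fun h : R => h^-1 *: (r (h *: (1 : R) + 0) - r 0)) =
           (fun h : R => h^-1 *: (c (h *: (1 : R) + 0) - c 0) * D h).
    apply/funext => h; rewrite r0 c0 !subr0 addr0 rE /GRing.scale /= mulr1; ring.
  rewrite E; apply: cvgM; last exact: cvg_within_filter cD.
  by case: dc => dc <-; exact: dc.
have -> : (fun s => phi (x s + ((c s)%:C)%C *: v)) = r + (fun s => phi (x s)).
  by apply/funext => s; rewrite /r /= fctE subrK.
exact: is_deriveD.
Unshelve. all: by end_near. Qed.

(** One direction is added at a time, the remaining sum serving as the base path of
    [chain_line_step]. *)
Lemma chain_line (I : Type) (r : seq I) (phi : V -> R) (dphi : I -> V -> R)
    (v : I -> V) (c : I -> R -> R) (c' : I -> R) p :
  (forall i, \forall q \near p,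
     is_derive (0 : R) 1 (fun s : R => phi (q + (s%:C)%C *: v i)) (dphi i q)) ->
  (forall i, {for p, continuous (dphi i)}) ->
  (forall i, c i 0 = 0) -> (forall i, is_derive (0 : R) 1 (c i) (c' i)) ->
  is_derive (0 : R) 1 (fun s => phi (p + \sum_(i <- r) (c i s)%:C%C *: v i))
    (\sum_(i <- r) c' i * dphi i p).
Proof.
move=> dphiP cdphi c0 dc.
pose x r s := p + \sum_(i <- r) (c i s)%:C%C *: v i.
have x0 r' : x r' 0 = p.
  by rewrite /x big1 ?addr0 // => i _; rewrite c0 scale0r.
have cx r' : {for 0, continuous (x r')}.
  apply: cvgD; first exact: cvg_cst.
  elim: r' => [|i r' IH].
    by under eq_fun do rewrite big_nil; rewrite big_nil; exact: cvg_cst.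
  under eq_fun do rewrite big_cons; rewrite big_cons; apply: cvgD IH.
  apply: (@cvgZr_tmp _ _ _ _ _ (fun s : R => ((c i s)%:C)%C : R[i])).
  apply: (continuous_cvg _ (@continuous_real_complex _ _)).
  by apply/differentiable_continuous/derivable1_diffP; case: (dc i).
elim: r => [|i r IH].
  under eq_fun do rewrite big_nil; rewrite big_nil; exact: is_derive_cst.
rewrite big_cons.
have -> : (fun s => phi (p + \sum_(j <- i :: r) (c j s)%:C%C *: v j)) =
          (fun s => phi (x r s + (c i s)%:C%C *: v i)).
  by apply/funext => s; rewrite big_cons /x -addrA [X in p + X]addrC.
exact: chain_line_step (x0 r) (cx r) (dphiP i) (cdphi i) (c0 i) (dc i) IH.
Qed.

End ChainRule.

(** * Smooth functions *)

Section SmoothCalculus.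
Variables (R : realType) (V : normedModType R[i]).
Implicit Types (g h : V -> Cplx R) (v p q : V) (d : Cplx R) (O : set V) (k : nat).

Lemma Ck_continuous k O g p : Ck k O g -> O p -> {for p, continuous g}.
Proof. by case: k => [|k] [+ _] => /(_ p). Qed.

Lemma Ck_sub k O O' g : O' `<=` O -> Ck k O g -> Ck k O' g.
Proof.
move=> OO; elim: k g => [|k IH] g [cg dg]; split=> //.
- by move=> p /OO; exact: cg.
- by move=> p /OO; exact: cg.
- by move=> v; have [dgv kg] := dg v; split; [move=> p /OO; exact: dgv|exact: IH].
Qed.

Lemma CkS k O g : Ck k.+1 O g -> Ck k O g.
Proof.
elim: k g => [|k IH] g; first by move=> [].
by move=> [cg dg]; split=> // v; have [dgv kg] := dg v; split; [|exact: IH].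
Qed.

Lemma Ck_rdiff k O g v p : Ck k.+1 O g -> O p -> rdiff g v p (rderive g v p).
Proof. by move=> [_ /(_ v)[dg _]] /dg /rderivable_rdiff. Qed.

Lemma Ck_rderive k O g v : Ck k.+1 O g -> Ck k O (rderive g v).
Proof. by move=> [_ /(_ v)[]]. Qed.

Lemma near_open O p (P : V -> Prop) : open O -> O p -> (forall q, O q -> P q) ->
  \forall q \near p, P q.
Proof. by move=> oO Op OP; apply: filterS (open_nbhs_nbhs (conj oO Op)). Qed.

Lemma eq_rderive O g h v p : open O -> O p -> (forall q, O q -> g q = h q) ->
  rderivable g v p -> rderive g v p = rderive h v p.
Proof.
move=> oO Op gh /rderivable_rdiff dg; apply/esym/rdiff_rderive.
exact: near_eq_rdiff (near_open oO Op gh) dg.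
Qed.

Lemma near_eq_continuous g h p : (\forall q \near p, g q = h q) ->
  {for p, continuous g} -> {for p, continuous h}.
Proof.
move=> gh; rewrite /prop_for /continuous_at (nbhs_singleton gh).
by move=> cg; apply: cvg_trans cg; exact: near_eq_cvg.
Qed.

Lemma eq_Ck k O g h : open O -> (forall p, O p -> g p = h p) ->
  Ck k O g -> Ck k O h.
Proof.
move=> oO; elim: k g h => [|k IH] g h gh [cg dg]; split.
- by move=> p Op; apply: near_eq_continuous (cg p Op); exact: near_open gh.
- by [].
- by move=> p Op; apply: near_eq_continuous (cg p Op); exact: near_open gh.
- move=> v; have [dgv kg] := dg v; split.
    move=> p Op; apply/rdiff_rderivable/(near_eq_rdiff (near_open oO Op gh)).
    exact/rderivable_rdiff/dgv.
  apply: IH kg => p Op; apply: (eq_rderive oO Op gh); exact: dgv.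
Qed.

(** The closure properties below all exhibit the derivative in closed form; its regularity then
    comes from the induction on [k]. *)
Lemma Ck_intro k O h (dh : V -> V -> Cplx R) : open O ->
  (forall p, O p -> {for p, continuous h}) ->
  (forall v p, O p -> rdiff h v p (dh v p)) ->
  (forall v, Ck k O (dh v)) -> Ck k.+1 O h.
Proof.
move=> oO ch dhP kdh; split=> // v; split.
  by move=> p Op; exact: rdiff_rderivable (dhP v p Op).
by apply: eq_Ck (kdh v) => // p Op; rewrite (rdiff_rderive (dhP v p Op)).
Qed.

Lemma Ck_cst k O (a : Cplx R) : open O -> Ck k O (fun=> a).
Proof.
move=> oO; elim: k a => [|k IH] a; first by split=> // p _; exact: cvg_cst.
apply: (@Ck_intro k O _ (fun _ _ => 0)) => // [p _|v p _].
  exact: cvg_cst.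
exact: rdiff_cst.
Qed.

Lemma CkD k O g h : open O -> Ck k O g -> Ck k O h -> Ck k O (fun q => g q + h q).
Proof.
move=> oO; elim: k g h => [|k IH] g h kg kh.
  by split; [move=> p Op; apply: cvgD; [exact: Ck_continuous kg Op|exact: Ck_continuous kh Op]|].
apply: (@Ck_intro k O _ (fun v q => rderive g v q + rderive h v q)) => //.
- by move=> p Op; apply: cvgD; [exact: Ck_continuous kg Op|exact: Ck_continuous kh Op].
- by move=> v p Op; apply: rdiffD; [exact: Ck_rdiff kg Op|exact: Ck_rdiff kh Op].
- by move=> v; apply: IH; exact: Ck_rderive.
Qed.

Lemma CkM k O g h : open O -> Ck k O g -> Ck k O h -> Ck k O (fun q => g q * h q).
Proof.
move=> oO; elim: k g h => [|k IH] g h kg kh.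
  by split; [move=> p Op; apply: cvgM; [exact: Ck_continuous kg Op|exact: Ck_continuous kh Op]|].
apply: (@Ck_intro k O _ (fun v q => rderive g v q * h q + g q * rderive h v q)) => //.
- by move=> p Op; apply: cvgM; [exact: Ck_continuous kg Op|exact: Ck_continuous kh Op].
- by move=> v p Op; apply: rdiffM; [exact: Ck_rdiff kg Op|exact: Ck_rdiff kh Op].
- move=> v; apply: CkD => //; apply: IH; by [exact: Ck_rderive|exact: CkS].
Qed.

Lemma continuous_conjc : continuous (fun x : Cplx R => conjc x : Cplx R).
Proof.
move=> x; apply: (@cvg_Cplx R (Cplx R) (nbhs x) _ (fun y => conjc y) (conjc x)).
  by rewrite ReJ; under eq_fun do rewrite ReJ; exact: continuous_Re.
rewrite ImJ; under eq_fun do rewrite ImJ.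
apply: (@cvgN _ R^o _ (nbhs x)); exact: continuous_Im.
Qed.

Lemma Ck_conj k O g : open O -> Ck k O g -> Ck k O (fun q => conjc (g q) : Cplx R).
Proof.
move=> oO; elim: k g => [|k IH] g kg.
  split=> // p Op; apply: (continuous_cvg _ (@continuous_conjc _)).
  exact: Ck_continuous kg Op.
apply: (@Ck_intro k O _ (fun v q => conjc (rderive g v q))) => //.
- move=> p Op; apply: (continuous_cvg _ (@continuous_conjc _)).
  exact: Ck_continuous kg Op.
- by move=> v p Op; apply: rdiff_conj; exact: Ck_rdiff kg Op.
- by move=> v; apply: IH; exact: Ck_rderive.
Qed.

Lemma Re_conjc (x : Cplx R) : ((complex.Re x)%:C)%C = 2^-1 * (x + conjc x) :> Cplx R.
Proof. by rewrite ReJ_add mulrC. Qed.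

Lemma Im_conjc (x : Cplx R) :
  ((complex.Im x)%:C)%C = 2^-1 * ('i%C * (conjc x - x)) :> Cplx R.
Proof. by rewrite ImJ_sub; ring. Qed.

Lemma CkZ k O (a : Cplx R) g : open O -> Ck k O g -> Ck k O (fun q => a * g q).
Proof. by move=> oO kg; apply: CkM => //; exact: Ck_cst. Qed.

Lemma CkN k O g : open O -> Ck k O g -> Ck k O (fun q => - g q).
Proof.
move=> oO kg; apply: (@eq_Ck _ _ (fun q => -1 * g q)) => // [p _|].
  by rewrite mulN1r.
exact: CkZ.
Qed.

Lemma CkB k O g h : open O -> Ck k O g -> Ck k O h -> Ck k O (fun q => g q - h q).
Proof. by move=> oO kg kh; apply: CkD => //; exact: CkN. Qed.

Lemma Ck_Re k O g : open O -> Ck k O g -> Ck k O (fun q => ((complex.Re (g q))%:C)%C : Cplx R).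
Proof.
move=> oO kg.
apply: (@eq_Ck _ _ (fun q => 2^-1 * (g q + conjc (g q)))) => // [p _|].
  by rewrite -Re_conjc.
by apply: CkZ => //; apply: CkD => //; exact: Ck_conj.
Qed.

(** The induction on [k] replaces [phi] by its derivative, so it runs over a whole family [Phi]
    stable under differentiation on [Q]. *)
Lemma Ck_real (Phi : set (R -> R)) (Q : set R) k O g phi : open O ->
  (forall phi, Phi phi -> exists2 phi', Phi phi' &
     forall x : R, Q x -> is_derive x 1 phi (phi' x)) ->
  (forall p, O p -> Q (complex.Re (g p))) ->
  Phi phi -> Ck k O g ->
  Ck k O (fun q => ((phi (complex.Re (g q)))%:C)%C : Cplx R).
Proof.
move=> oO PhiP OQ Pphi kg.
have cphi (f : R -> R) p : Phi f -> O p -> {for p, continuous g} ->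
    {for p, continuous (fun q => ((f (complex.Re (g q)))%:C)%C : Cplx R)}.
  move=> /PhiP[f' _ fP] /OQ Qp cg.
  apply: (continuous_cvg _ (@continuous_real_complex _ _)).
  apply: (@continuous_cvg _ _ _ _ _ _ f).
    apply/differentiable_continuous/derivable1_diffP.
    by case: (fP _ Qp).
  by apply: (continuous_cvg _ (@continuous_Re _ _)).
elim: k phi Pphi kg => [|k IH] phi Pphi kg.
  by split=> // p Op; apply: cphi => //; exact: Ck_continuous kg Op.
have [phi' Pphi' dphi] := PhiP _ Pphi.
apply: (@Ck_intro k O _ (fun v q => ((phi' (complex.Re (g q)))%:C)%C *
   ((complex.Re (rderive g v q))%:C)%C)) => //.
- by move=> p Op; apply: cphi => //; exact: Ck_continuous kg Op.
- move=> v p Op; rewrite -rmorphM; apply: rdiff_real; first exact/dphi/OQ.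
  exact: Ck_rdiff kg Op.
- move=> v; apply: CkM => //; first exact/IH/CkS.
  by apply: Ck_Re => //; exact: Ck_rderive.
Qed.

Lemma Ck_sum (I : Type) (r : seq I) k O (g : I -> V -> Cplx R) : open O ->
  (forall i, Ck k O (g i)) -> Ck k O (fun q => \sum_(i <- r) g i q).
Proof.
move=> oO kg; elim: r => [|i r IH].
  by under eq_fun do rewrite big_nil; exact: Ck_cst.
by under eq_fun do rewrite big_cons; exact: CkD.
Qed.

Lemma Ck_prod (I : Type) (r : seq I) k O (g : I -> V -> Cplx R) : open O ->
  (forall i, Ck k O (g i)) -> Ck k O (fun q => \prod_(i <- r) g i q).
Proof.
move=> oO kg; elim: r => [|i r IH].
  by under eq_fun do rewrite big_nil; exact: Ck_cst.
by under eq_fun do rewrite big_cons; exact: CkM.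
Qed.

Lemma Re_sum (I : Type) (r : seq I) (F : I -> Cplx R) :
  complex.Re (\sum_(i <- r) F i) = \sum_(i <- r) complex.Re (F i).
Proof. by elim: r => [|i r IH]; rewrite ?big_nil // !big_cons ReD IH. Qed.

Lemma Im_sum (I : Type) (r : seq I) (F : I -> Cplx R) :
  complex.Im (\sum_(i <- r) F i) = \sum_(i <- r) complex.Im (F i).
Proof. by elim: r => [|i r IH]; rewrite ?big_nil // !big_cons ImD IH. Qed.

Lemma ReZ (a : R) (x : Cplx R) : complex.Re ((a%:C)%C * x) = a * complex.Re x.
Proof. by rewrite ReM /= mul0r subr0. Qed.

Lemma ImZ (a : R) (x : Cplx R) : complex.Im ((a%:C)%C * x) = a * complex.Im x.
Proof. by rewrite ImM /= mul0r addr0. Qed.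

Lemma rdiff_path (I : Type) (r : seq I) O g (v : I -> V) (c : I -> R -> R)
    (c' : I -> R) p : open O -> O p -> Ck 1 O g ->
  (forall i, c i 0 = 0) -> (forall i, is_derive (0 : R) 1 (c i) (c' i)) ->
  let l := \sum_(i <- r) (c' i)%:C%C * rderive g (v i) p in
  let x s := p + \sum_(i <- r) (c i s)%:C%C *: v i in
  is_derive (0 : R) 1 (fun s => complex.Re (g (x s))) (complex.Re l) /\
  is_derive (0 : R) 1 (fun s => complex.Im (g (x s))) (complex.Im l).
Proof.
move=> oO Op kg c0 dc l x; split.
  rewrite Re_sum; under eq_bigr do rewrite ReZ.
  apply: (@chain_line _ _ _ _ (@complex.Re R \o g) (fun i q => complex.Re (rderive g (v i) q))) => //.
    move=> i; apply: (near_open oO Op) => q Oq.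
    exact/rdiff_Re/(Ck_rdiff _ kg Oq).
  move=> i; apply: (continuous_cvg _ (@continuous_Re _ _)).
  exact: Ck_continuous (Ck_rderive (v i) kg) Op.
rewrite Im_sum; under eq_bigr do rewrite ImZ.
apply: (@chain_line _ _ _ _ (@complex.Im R \o g) (fun i q => complex.Im (rderive g (v i) q))) => //.
  move=> i; apply: (near_open oO Op) => q Oq.
  exact/rdiff_Im/(Ck_rdiff _ kg Oq).
move=> i; apply: (continuous_cvg _ (@continuous_Im _ _)).
exact: Ck_continuous (Ck_rderive (v i) kg) Op.
Qed.

(** Real linearity in the direction is the chain rule along the straight path with coefficients
    [s * a i]. *)
Lemma rderive_lin (I : Type) (r : seq I) O g (v : I -> V) (a : I -> R) p :
  open O -> O p -> Ck 1 O g ->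
  rderive g (\sum_(i <- r) (a i)%:C%C *: v i) p =
    \sum_(i <- r) (a i)%:C%C * rderive g (v i) p.
Proof.
move=> oO Op kg; apply: rdiff_rderive.
have da i : is_derive (0 : R) 1 (fun s : R => s * a i) (a i).
  apply: (is_derive_eq (is_deriveM (is_derive_id (0 : R) 1) (is_derive_cst (a i) (0 : R) 1))).
  by rewrite scaler0 add0r /GRing.scale /= mulr1.
have [d1 d2] := @rdiff_path I r O g v (fun i s => s * a i) a p oO Op kg
  (fun i => mul0r _) da.
have E s : (s%:C)%C *: \sum_(i <- r) (a i)%:C%C *: v i =
    \sum_(i <- r) (s * a i)%:C%C *: v i.
  by rewrite scaler_sumr; apply: eq_bigr => i _; rewrite scalerA -rmorphM.
by split; under eq_fun do rewrite E.
Qed.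

Lemma rderiveD O g v w p : open O -> O p -> Ck 1 O g ->
  rderive g (v + w) p = rderive g v p + rderive g w p.
Proof.
move=> oO Op kg.
have := @rderive_lin V [:: v; w] O g id (fun=> 1) p oO Op kg.
by rewrite !big_cons !big_nil !scale1r !mul1r !addr0.
Qed.

Lemma rderiveZ O g (a : R) v p : open O -> O p -> Ck 1 O g ->
  rderive g ((a%:C)%C *: v) p = (a%:C)%C * rderive g v p.
Proof.
move=> oO Op kg.
have := @rderive_lin V [:: v] O g id (fun=> a) p oO Op kg.
by rewrite !big_cons !big_nil !addr0.
Qed.

End SmoothCalculus.

(** Each clause of [Ck] concerns one point at a time, and [rderive g v] is the same function for
    every set, so the clauses can be collected point by point. *)
Lemma smooth_local (R : realType) (V : normedModType R[i]) (O : set V) g :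
  (forall p, O p -> exists2 N : set V, N p & smooth N g) -> smooth O g.
Proof.
move=> H k; have {}H p : O p -> exists2 N : set V, N p & Ck k N g.
  by move=> /H[N Np sg]; exists N.
elim: k g H => [|k IH] g H; split=> //.
- by move=> p /H[N Np kg]; exact: Ck_continuous kg Np.
- by move=> p /H[N Np kg]; exact: Ck_continuous kg Np.
move=> v; split; last first.
  by apply: IH => p /H[N Np kg]; exists N => //; exact: Ck_rderive.
by move=> p /H[N Np [_ /(_ v)[dg _]]]; exact: dg.
Qed.

Opaque Ck rderive rderivable.

(** Used with [h] for 1/2 and [e] the conjugate of [d]: the right side is then Re d times [a] plus
    Im d times [b], the real differential. *)
Lemma wirtinger_split (K : comPzRingType) (h i a b d e : K) :
  h * (a - i * b) * d + h * (a + i * b) * e = h * (d + e) * a + h * (i * (e - d)) * b.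
Proof. by ring. Qed.

Section Vectors.
Variables (R : realType) (V : normedModType R[i]).

Lemma continuous_row (T : topologicalType) n (f : T -> CVec R n) (p : T) :
  (forall k, {for p, continuous (fun q => f q 0 k)}) -> {for p, continuous f}.
Proof.
move=> cf A [P fP PA]; rewrite /nbhs /=.
have : \forall q \near p, forall k, P 0 k (f q 0 k).
  apply: filter_forall => k; exact: (cf k _ (fP 0 k)).
apply: filterS => q Pq; apply: PA => i j; rewrite (ord1 i); exact: Pq.
Qed.

Lemma continuous_coord n (k : 'I_n) : continuous (fun z : CVec R n => z 0 k).
Proof. exact: coord_continuous. Qed.

Lemma sum_pair_bool (W : nmodType) n (F : 'I_n * bool -> W) :
  \sum_i F i = \sum_k (F (k, true) + F (k, false)).
Proof.
transitivity (\sum_k \sum_b F (k, b)).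
  by rewrite pair_bigA; apply: eq_bigr => -[k b].
by apply: eq_bigr => k _; rewrite big_bool.
Qed.

(** The pairs in ['I_n * bool] index the real basis of C^n: [true] is a coordinate direction,
    [false] its multiple by the imaginary unit. *)
Lemma row_split n (u : CVec R n) : u = \sum_(i : 'I_n * bool)
  ((if i.2 then complex.Re (u 0 i.1) else complex.Im (u 0 i.1))%:C)%C *:
  (if i.2 then basis_vec i.1 else 'i%C *: basis_vec i.1).
Proof.
rewrite sum_pair_bool [LHS]row_sum_delta; apply: eq_bigr => k _ /=.
by rewrite scalerA -scalerDl [in LHS](complexE (u 0 k)) [in RHS]mulrC.
Qed.

(** The increment of [f] is written in the 2n real directions, where [rdiff_path] applies; grouping
    them in pairs produces the Wirtinger form. *)
Lemma rdiff_comp n (O : set (CVec R n)) (g : CVec R n -> Cplx R) (f : V -> CVec R n)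
    (d : 'I_n -> Cplx R) (v p : V) : open O -> O (f p) -> Ck 1 O g ->
  (forall k, rdiff (fun q => f q 0 k) v p (d k)) ->
  rdiff (fun q => g (f q)) v p
    (\sum_k (dz (basis_vec k) g (f p) * d k + dzbar (basis_vec k) g (f p) * conjc (d k))).
Proof.
move=> oO Op kg df.
pose w (i : 'I_n * bool) : CVec R n :=
  if i.2 then basis_vec i.1 else 'i%C *: basis_vec i.1.
pose c (i : 'I_n * bool) (s : R) : R := if i.2
  then complex.Re (f (p + (s%:C)%C *: v) 0 i.1) - complex.Re (f p 0 i.1)
  else complex.Im (f (p + (s%:C)%C *: v) 0 i.1) - complex.Im (f p 0 i.1).
pose c' (i : 'I_n * bool) : R :=
  if i.2 then complex.Re (d i.1) else complex.Im (d i.1).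
have c0 i : c i 0 = 0 by rewrite /c line0; case: i.2; rewrite subrr.
have dc i : is_derive (0 : R) 1 (c i) (c' i).
  have [d1 d2] := df i.1; rewrite /c /c'; case: i.2.
    apply: (is_derive_eq (is_deriveB d1 (is_derive_cst (complex.Re (f p 0 i.1)) (0 : R) 1))).
    by rewrite subr0.
  apply: (is_derive_eq (is_deriveB d2 (is_derive_cst (complex.Im (f p 0 i.1)) (0 : R) 1))).
  by rewrite subr0.
have [d1 d2] := @rdiff_path _ _ _ (index_enum _) O g w c c' (f p) oO Op kg c0 dc.
have E s : f (p + (s%:C)%C *: v) = f p + \sum_i ((c i s)%:C)%C *: w i.
  apply/eqP; rewrite [f p + _]addrC -subr_eq; apply/eqP.
  rewrite [LHS]row_split; apply: eq_bigr => -[k b] _; rewrite /c /w /= !mxE.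
  by case: b; rewrite ?ReD ?ImD ?ReN ?ImN.
have -> : \sum_k (dz (basis_vec k) g (f p) * d k +
    dzbar (basis_vec k) g (f p) * conjc (d k)) =
    \sum_i ((c' i)%:C)%C * rderive g (w i) (f p).
  rewrite sum_pair_bool; apply: eq_bigr => k _; rewrite /c' /w /= /dz /dzbar.
  rewrite Re_conjc Im_conjc; exact: wirtinger_split.
by split; under eq_fun do rewrite E.
Qed.

Lemma Ck_comp n k (O' : set (CVec R n)) (O : set V) (g : CVec R n -> Cplx R)
    (f : V -> CVec R n) : open O' -> open O -> (forall p, O p -> O' (f p)) ->
  Ck k O' g -> (forall j, Ck k O (fun p => f p 0 j)) -> Ck k O (fun p => g (f p)).
Proof.
move=> oO' oO OO'; elim: k g => [|k IH] g kg kf.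
  split=> // p Op; apply: (@continuous_comp _ _ _ f g); last exact: Ck_continuous kg (OO' _ Op).
  by apply: continuous_row => j; exact: Ck_continuous (kf j) Op.
have kg1 : Ck 1 O' g by elim: (k) kg => // m IHm /CkS.
apply: (@Ck_intro _ _ k O _ (fun v p => \sum_j (dz (basis_vec j) g (f p) *
  rderive (fun q => f q 0 j) v p + dzbar (basis_vec j) g (f p) *
  conjc (rderive (fun q => f q 0 j) v p)))) => //.
- move=> p Op; apply: (@continuous_comp _ _ _ f g); last exact: Ck_continuous kg (OO' _ Op).
  by apply: continuous_row => j; exact: Ck_continuous (kf j) Op.
- move=> v p Op; apply: (rdiff_comp oO' (OO' _ Op) kg1) => j.
  exact: Ck_rdiff (kf j) Op.
- move=> v; apply: Ck_sum => // j; apply: CkD => //; apply: CkM => //.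
  + apply: IH; last by move=> j'; exact: CkS.
    apply: CkZ => //; apply: CkB => //; first exact: Ck_rderive.
    by apply: CkZ => //; exact: Ck_rderive.
  + exact: Ck_rderive.
  + apply: IH; last by move=> j'; exact: CkS.
    apply: CkZ => //; apply: CkD => //; first exact: Ck_rderive.
    by apply: CkZ => //; exact: Ck_rderive.
  + by apply: Ck_conj => //; exact: Ck_rderive.
Qed.

End Vectors.

(** * Symmetry of second derivatives *)

Section MixedDerivatives.
Variables (R : realType) (V : normedModType R[i]).
Implicit Types (p q v w : V) (phi : V -> R).

Definition line_derive phi v (dphi : V -> R) q :=
  is_derive (0 : R) 1 (fun s : R => phi (q + (s%:C)%C *: v)) (dphi q).

Lemma line_derive_at phi v dphi p (a : R) :
  line_derive phi v dphi (p + (a%:C)%C *: v) ->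
  is_derive a 1 (fun s : R => phi (p + (s%:C)%C *: v)) (dphi (p + (a%:C)%C *: v)).
Proof.
move=> d; apply: is_derive_shift0.
by move: d; rewrite /line_derive; under eq_fun do rewrite -line_shift.
Qed.

(** Two applications of the mean value theorem: first along [v] to the difference in the [w]
    direction, then along [w] to [phiv]. The left side is symmetric in [v] and [w]. *)
Lemma second_difference phi (phiv phivw : V -> R) (A : set V) p v w (s : R) :
  (forall q, A q -> line_derive phi v phiv q) ->
  (forall q, A q -> line_derive phiv w phivw q) ->
  (forall a b : R, `|a| <= `|s| -> `|b| <= `|s| ->
     A (p + (a%:C)%C *: v + (b%:C)%C *: w)) ->
  exists2 q, A q & phi (p + (s%:C)%C *: v + (s%:C)%C *: w) - phi (p + (s%:C)%C *: v)
    - phi (p + (s%:C)%C *: w) + phi p = phivw q * s * s.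
Proof.
move=> phivP phivwP As.
have As' (a b : R) : `|a| <= `|s| -> `|b| <= `|s| ->
    A (p + (b%:C)%C *: w + (a%:C)%C *: v).
  by move=> sa sb; rewrite addrAC; exact: As.
have A0 (a : R) : `|a| <= `|s| -> A (p + (a%:C)%C *: v).
  by move=> sa; rewrite -(line0 (p + _) w); apply: As; rewrite ?normr0.
have [x xs] := @mvt0 R
  (fun x => phi (p + (s%:C)%C *: w + (x%:C)%C *: v) - phi (p + (x%:C)%C *: v))
  (fun x => phiv (p + (s%:C)%C *: w + (x%:C)%C *: v) - phiv (p + (x%:C)%C *: v)) s
  (fun x xs => is_deriveB (line_derive_at (phivP _ (As' x s xs (lexx _))))
                 (line_derive_at (phivP _ (A0 x xs)))).
have [y ys] := @mvt0 R
  (fun y => phiv (p + (x%:C)%C *: v + (y%:C)%C *: w)) _ s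
  (fun y ys => line_derive_at (phivwP _ (As x y xs ys))).
rewrite !line0 => E1 E2; exists (p + (x%:C)%C *: v + (y%:C)%C *: w); first exact: As.
rewrite -E1 -(addrAC p _ ((x%:C)%C *: v)) -E2 (addrAC p) opprB; ring.
Qed.

(** The same second difference is s^2 times either mixed derivative, at two points close to [p];
    continuity makes the two values at [p] differ by at most any [e]. *)
Lemma mixed_line_derive phi phiv phiw phivw phiwv p v w :
  (\forall q \near p, line_derive phi v phiv q) ->
  (\forall q \near p, line_derive phi w phiw q) ->
  (\forall q \near p, line_derive phiv w phivw q) ->
  (\forall q \near p, line_derive phiw v phiwv q) ->
  {for p, continuous phivw} -> {for p, continuous phiwv} ->
  phivw p = phiwv p.
Proof.
move=> phivP phiwP phivwP phiwvP c1 c2.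
suff close (e : R) : 0 < e -> `|phivw p - phiwv p| <= e.
  apply/eqP; rewrite -subr_eq0 -normr_le0; apply/ler_addgt0Pl => e e0.
  by rewrite addr0; exact: close.
move=> e0; have e20 : 0 < e / 2 by rewrite divr_gt0.
pose A q := [/\ line_derive phi v phiv q, line_derive phi w phiw q,
  line_derive phiv w phivw q, line_derive phiw v phiwv q &
  `|phivw p - phivw q| < e / 2 /\ `|phiwv p - phiwv q| < e / 2].
have nA : \forall q \near p, A q.
  have n1 : \forall q \near p, `|phivw p - phivw q| < e / 2.
    by move/(@cvgrPdist_lt R R^o) : c1; apply.
  have n2 : \forall q \near p, `|phiwv p - phiwv q| < e / 2.
    by move/(@cvgrPdist_lt R R^o) : c2; apply.
  by near=> q; split; [near: q; exact: phivP|near: q; exact: phiwP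
    |near: q; exact: phivwP|near: q; exact: phiwvP|split; near: q].
have ct : (fun z : R * R => p + (z.1%:C)%C *: v + (z.2%:C)%C *: w) z
    @[z --> (0 : R, 0 : R)] --> p.
  have -> : nbhs p = nbhs (p + (((0 : R, 0 : R).1)%:C)%C *: v +
      (((0 : R, 0 : R).2)%:C)%C *: w) by rewrite /= !line0.
  apply: cvgD; [apply: cvgD; first exact: cvg_cst|].
    apply: (@cvgZr_tmp _ _ _ _ _ (fun z : R * R => (z.1%:C)%C : R[i])).
    apply: (continuous_cvg _ (@continuous_real_complex _ _)); exact: cvg_fst.
  apply: (@cvgZr_tmp _ _ _ _ _ (fun z : R * R => (z.2%:C)%C : R[i])).
  apply: (continuous_cvg _ (@continuous_real_complex _ _)); exact: cvg_snd.
have [[B1 B2] /= [nB1 nB2] AB] := ct _ nA.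
have [d1 /= d10 dB1] := nB1; have [d2 /= d20 dB2] := nB2.
(* Halving makes [s] strictly smaller than both radii, so the whole closed square of side parameters
   up to [s] lies in [A]. *)
pose s := Num.min d1 d2 / 2.
have s0 : 0 < s by rewrite divr_gt0 // lt_min d10.
have s1 : s < d1.
  by rewrite ltr_pdivrMr // (le_lt_trans (_ : _ <= d1)) ?ge_min ?lexx // ltr_pMr ?ltr1n.
have s2 : s < d2.
  by rewrite ltr_pdivrMr // (le_lt_trans (_ : _ <= d2)) ?ge_min ?lexx ?orbT // ltr_pMr ?ltr1n.
have As (a b : R) : `|a| <= `|s| -> `|b| <= `|s| ->
    A (p + (a%:C)%C *: v + (b%:C)%C *: w).
  rewrite (gtr0_norm s0) => sa sb; apply: (AB (a, b)); split => /=.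
    by apply: dB1; rewrite /= sub0r normrN (le_lt_trans sa).
  by apply: dB2; rewrite /= sub0r normrN (le_lt_trans sb).
have [q1 Aq1 E1] := @second_difference phi phiv phivw A p v w s
  (fun q Aq => let: And5 a _ _ _ _ := Aq in a)
  (fun q Aq => let: And5 _ _ a _ _ := Aq in a) As.
have [q2 Aq2 E2] := @second_difference phi phiw phiwv A p w v s
  (fun q Aq => let: And5 _ a _ _ _ := Aq in a)
  (fun q Aq => let: And5 _ _ _ a _ := Aq in a)
  (fun a b sa sb => eq_ind _ A (As b a sb sa) _ (addrAC _ _ _)).
have E : phivw q1 = phiwv q2.
  apply: (@mulIf _ (s * s)); first by rewrite mulf_neq0 // gt_eqF.
  transitivity (phivw q1 * s * s); first exact: mulrA.
  transitivity (phiwv q2 * s * s); last exact/esym/mulrA.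
  by rewrite -E1 -E2 (addrAC p); ring.
have [_ _ _ _ [h1 _]] := Aq1; have [_ _ _ _ [_ h2]] := Aq2.
rewrite (le_trans (ler_distD (phivw q1) _ _)) // {2}E (distrC (phiwv q2)).
by rewrite [leRHS]splitr lerD // ltW.
Unshelve. all: by end_near. Qed.

Lemma rderiveC (O : set V) (g : V -> Cplx R) v w p : open O -> O p -> Ck 2 O g ->
  rderive (rderive g v) w p = rderive (rderive g w) v p.
Proof.
move=> oO Op kg; apply: Cplx_eq.
  apply: (@mixed_line_derive (@complex.Re R \o g) (@complex.Re R \o rderive g v)
    (@complex.Re R \o rderive g w) (@complex.Re R \o rderive (rderive g v) w)
    (@complex.Re R \o rderive (rderive g w) v) p v w).
  - apply: (near_open oO Op) => q Oq; exact/rdiff_Re/(Ck_rdiff _ kg Oq).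
  - apply: (near_open oO Op) => q Oq; exact/rdiff_Re/(Ck_rdiff _ kg Oq).
  - apply: (near_open oO Op) => q Oq; exact/rdiff_Re/(Ck_rdiff _ (Ck_rderive _ kg) Oq).
  - apply: (near_open oO Op) => q Oq; exact/rdiff_Re/(Ck_rdiff _ (Ck_rderive _ kg) Oq).
  - apply: (continuous_cvg _ (@continuous_Re _ _)).
    exact: Ck_continuous (Ck_rderive _ (Ck_rderive _ kg)) Op.
  - apply: (continuous_cvg _ (@continuous_Re _ _)).
    exact: Ck_continuous (Ck_rderive _ (Ck_rderive _ kg)) Op.
apply: (@mixed_line_derive (@complex.Im R \o g) (@complex.Im R \o rderive g v)
  (@complex.Im R \o rderive g w) (@complex.Im R \o rderive (rderive g v) w)
  (@complex.Im R \o rderive (rderive g w) v) p v w).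
- apply: (near_open oO Op) => q Oq; exact/rdiff_Im/(Ck_rdiff _ kg Oq).
- apply: (near_open oO Op) => q Oq; exact/rdiff_Im/(Ck_rdiff _ kg Oq).
- apply: (near_open oO Op) => q Oq; exact/rdiff_Im/(Ck_rdiff _ (Ck_rderive _ kg) Oq).
- apply: (near_open oO Op) => q Oq; exact/rdiff_Im/(Ck_rdiff _ (Ck_rderive _ kg) Oq).
- apply: (continuous_cvg _ (@continuous_Im _ _)).
  exact: Ck_continuous (Ck_rderive _ (Ck_rderive _ kg)) Op.
- apply: (continuous_cvg _ (@continuous_Im _ _)).
  exact: Ck_continuous (Ck_rderive _ (Ck_rderive _ kg)) Op.
Qed.

End MixedDerivatives.

(** * Wirtinger calculus *)

Lemma wirtinger_commute (K : comPzRingType) (h i a b c d : K) :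
  h * (h * (a + i * b) - i * (h * (c + i * d))) =
  h * (h * (a + - i * c) + i * (h * (b + - i * d))).
Proof. by ring. Qed.

Lemma wirtinger_scale_bar (K : comPzRingType) (h i x y a b : K) : i * i = -1 ->
  h * (x * a + y * b + i * (x * b + y * - a)) = (x + - i * y) * (h * (a + i * b)).
Proof.
move=> ii; transitivity (h * (x * a - i * i * y * b + i * (x * b + y * - a))).
  by rewrite ii; ring.
ring.
Qed.

Lemma wirtinger_scale (K : comPzRingType) (h i x y a b : K) : i * i = -1 ->
  h * (x * a + y * b - i * (x * b + y * - a)) = (x + i * y) * (h * (a - i * b)).
Proof.
move=> ii; transitivity (h * (x * a - i * i * y * b - i * (x * b + y * - a))).
  by rewrite ii; ring.
ring.
Qed.

Lemma wirtinger_comp (K : comPzRingType) (h i a b d d' e e' : K) :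
  h * ((a * d + b * d') - i * (a * e + b * e')) =
  a * (h * (d - i * e)) + b * (h * (d' + - i * e')).
Proof. by ring. Qed.

Lemma wirtinger_comp_bar (K : comPzRingType) (h i a b d d' e e' : K) :
  h * ((a * d + b * d') + i * (a * e + b * e')) =
  a * (h * (d + i * e)) + b * (h * (d' - - i * e')).
Proof. by ring. Qed.

Section Wirtinger.
Variables (R : realType) (V : normedModType R[i]) (O : set V).
Hypothesis oO : open O.
Implicit Types (g h : V -> Cplx R) (v w p : V).

Lemma rderive_cst (a : Cplx R) v p : rderive (fun _ : V => a) v p = 0.
Proof. exact/rdiff_rderive/rdiff_cst. Qed.

Lemma rderive_add g h v p : Ck 1 O g -> Ck 1 O h -> O p ->
  rderive (fun q => g q + h q) v p = rderive g v p + rderive h v p.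
Proof.
by move=> kg kh Op; apply/rdiff_rderive/rdiffD; [exact: Ck_rdiff kg Op|exact: Ck_rdiff kh Op].
Qed.

Lemma rderive_mul g h v p : Ck 1 O g -> Ck 1 O h -> O p ->
  rderive (fun q => g q * h q) v p = rderive g v p * h p + g p * rderive h v p.
Proof.
by move=> kg kh Op; apply/rdiff_rderive/rdiffM; [exact: Ck_rdiff kg Op|exact: Ck_rdiff kh Op].
Qed.

Lemma rderive_conj g v p : Ck 1 O g -> O p ->
  rderive (fun q => conjc (g q) : Cplx R) v p = conjc (rderive g v p).
Proof. by move=> kg Op; apply/rdiff_rderive/rdiff_conj/(Ck_rdiff _ kg Op). Qed.

Lemma rderiveN g v p : Ck 1 O g -> O p -> rderive g (- v) p = - rderive g v p.
Proof.
move=> kg Op; have := rderiveZ (-1) v oO Op kg.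
by rewrite rmorphN1 scaleN1r mulN1r.
Qed.

Lemma scaleii v : 'i%C *: ('i%C *: v) = - v.
Proof. by rewrite scalerA -expr2 sqr_i scaleN1r. Qed.

Lemma eq_dz g h v p : O p -> Ck 1 O g -> (forall q, O q -> g q = h q) ->
  dz v g p = dz v h p.
Proof.
move=> Op kg gh; rewrite /dz.
by congr (_ * (_ - _ * _)); apply: (eq_rderive oO Op gh);
  apply: rdiff_rderivable; exact: Ck_rdiff kg Op.
Qed.

Lemma eq_dzbar g h v p : O p -> Ck 1 O g -> (forall q, O q -> g q = h q) ->
  dzbar v g p = dzbar v h p.
Proof.
move=> Op kg gh; rewrite /dzbar.
by congr (_ * (_ + _ * _)); apply: (eq_rderive oO Op gh);
  apply: rdiff_rderivable; exact: Ck_rdiff kg Op.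
Qed.

Lemma dz_cst (a : Cplx R) v p : dz v (fun _ : V => a) p = 0.
Proof. by rewrite /dz !rderive_cst mulr0 subr0 mulr0. Qed.

Lemma dzbar_cst (a : Cplx R) v p : dzbar v (fun _ : V => a) p = 0.
Proof. by rewrite /dzbar !rderive_cst mulr0 addr0 mulr0. Qed.

Lemma dzD g h v p : O p -> Ck 1 O g -> Ck 1 O h ->
  dz v (fun q => g q + h q) p = dz v g p + dz v h p.
Proof. by move=> Op kg kh; rewrite /dz !rderive_add //; ring. Qed.

Lemma dzbarD g h v p : O p -> Ck 1 O g -> Ck 1 O h ->
  dzbar v (fun q => g q + h q) p = dzbar v g p + dzbar v h p.
Proof. by move=> Op kg kh; rewrite /dzbar !rderive_add //; ring. Qed.

Lemma dzM g h v p : O p -> Ck 1 O g -> Ck 1 O h ->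
  dz v (fun q => g q * h q) p = dz v g p * h p + g p * dz v h p.
Proof. by move=> Op kg kh; rewrite /dz !rderive_mul //; ring. Qed.

Lemma dzbarM g h v p : O p -> Ck 1 O g -> Ck 1 O h ->
  dzbar v (fun q => g q * h q) p = dzbar v g p * h p + g p * dzbar v h p.
Proof. by move=> Op kg kh; rewrite /dzbar !rderive_mul //; ring. Qed.

Lemma dzZ (a : Cplx R) g v p : O p -> Ck 1 O g ->
  dz v (fun q => a * g q) p = a * dz v g p.
Proof. by move=> Op kg; rewrite (dzM _ Op (Ck_cst 1 a oO) kg) dz_cst mul0r add0r. Qed.

Lemma dzbarZ (a : Cplx R) g v p : O p -> Ck 1 O g ->
  dzbar v (fun q => a * g q) p = a * dzbar v g p.
Proof. by move=> Op kg; rewrite (dzbarM _ Op (Ck_cst 1 a oO) kg) dzbar_cst mul0r add0r. Qed.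

Lemma dzB g h v p : O p -> Ck 1 O g -> Ck 1 O h ->
  dz v (fun q => g q - h q) p = dz v g p - dz v h p.
Proof.
move=> Op kg kh; have -> : (fun q => g q - h q) = (fun q => g q + -1 * h q).
  by apply/funext => q; rewrite mulN1r.
by rewrite (dzD _ Op kg (CkZ (-1) oO kh)) (dzZ _ _ Op kh) mulN1r.
Qed.

Lemma dzbarB g h v p : O p -> Ck 1 O g -> Ck 1 O h ->
  dzbar v (fun q => g q - h q) p = dzbar v g p - dzbar v h p.
Proof.
move=> Op kg kh; have -> : (fun q => g q - h q) = (fun q => g q + -1 * h q).
  by apply/funext => q; rewrite mulN1r.
by rewrite (dzbarD _ Op kg (CkZ (-1) oO kh)) (dzbarZ _ _ Op kh) mulN1r.
Qed.

Lemma conjD (x y : Cplx R) : conjc (x + y) = conjc x + conjc y :> Cplx R.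
Proof. exact: rmorphD. Qed.

Lemma conjB (x y : Cplx R) : conjc (x - y) = conjc x - conjc y :> Cplx R.
Proof. exact: rmorphB. Qed.

Lemma conjM (x y : Cplx R) : conjc (x * y) = conjc x * conjc y :> Cplx R.
Proof. exact: rmorphM. Qed.

Lemma conj_half : conjc (2^-1 : Cplx R) = 2^-1.
Proof. by rewrite conjc_inv; congr (_^-1); exact: (conjc_nat R 2). Qed.

Lemma conj_i : conjc ('i%C : Cplx R) = - 'i%C.
Proof. by apply: Cplx_eq => /=; rewrite ?oppr0. Qed.

Lemma dz_conj g v p : O p -> Ck 1 O g ->
  dz v (fun q => conjc (g q) : Cplx R) p = conjc (dzbar v g p).
Proof.
move=> Op kg; rewrite /dz /dzbar !rderive_conj // conjM conjD conjM.
by rewrite conj_half conj_i mulNr.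
Qed.

Lemma dzbar_conj g v p : O p -> Ck 1 O g ->
  dzbar v (fun q => conjc (g q) : Cplx R) p = conjc (dz v g p).
Proof.
move=> Op kg; rewrite /dz /dzbar !rderive_conj // conjM conjB conjM.
by rewrite conj_half conj_i mulNr opprK.
Qed.

Lemma dz_sum (I : Type) (r : seq I) (g : I -> V -> Cplx R) v p : O p ->
  (forall i, Ck 1 O (g i)) ->
  dz v (fun q => \sum_(i <- r) g i q) p = \sum_(i <- r) dz v (g i) p.
Proof.
move=> Op kg; elim: r => [|i r IH].
  by under eq_fun do rewrite big_nil; rewrite big_nil dz_cst.
by under eq_fun do rewrite big_cons; rewrite big_cons (dzD _ Op (kg i) (Ck_sum r oO kg)) IH.
Qed.

Lemma dzbar_sum (I : Type) (r : seq I) (g : I -> V -> Cplx R) v p : O p ->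
  (forall i, Ck 1 O (g i)) ->
  dzbar v (fun q => \sum_(i <- r) g i q) p = \sum_(i <- r) dzbar v (g i) p.
Proof.
move=> Op kg; elim: r => [|i r IH].
  by under eq_fun do rewrite big_nil; rewrite big_nil dzbar_cst.
by under eq_fun do rewrite big_cons; rewrite big_cons (dzbarD _ Op (kg i) (Ck_sum r oO kg)) IH.
Qed.

Lemma Ck_dz k g v : Ck k.+1 O g -> Ck k O (dz v g).
Proof.
by move=> kg; apply: CkZ => //; apply: CkB; [| |apply: CkZ] => //; exact: Ck_rderive.
Qed.

Lemma Ck_dzbar k g v : Ck k.+1 O g -> Ck k O (dzbar v g).
Proof.
by move=> kg; apply: CkZ => //; apply: CkD; [| |apply: CkZ] => //; exact: Ck_rderive.
Qed.

Lemma rderive_comb g v w u (a b : Cplx R) p : O p -> Ck 2 O g ->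
  rderive (fun q => a * (rderive g v q + b * rderive g w q)) u p =
  a * (rderive (rderive g v) u p + b * rderive (rderive g w) u p).
Proof.
move=> Op kg.
have [kv kw] := (Ck_rderive v kg, Ck_rderive w kg).
have kbw := CkZ b oO kw.
rewrite (rderive_mul _ (Ck_cst 1 a oO) (CkD oO kv kbw) Op) rderive_cst mul0r add0r.
by rewrite (rderive_add _ kv kbw Op) (rderive_mul _ (Ck_cst 1 b oO) kw Op)
  rderive_cst mul0r add0r.
Qed.

Lemma dz_fun g v : dz v g = (fun q => 2^-1 * (rderive g v q + - 'i%C * rderive g ('i%C *: v) q)).
Proof. by apply/funext => q; rewrite /dz mulNr. Qed.

Lemma dzbar_fun g v : dzbar v g = (fun q => 2^-1 * (rderive g v q + 'i%C * rderive g ('i%C *: v) q)).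
Proof. by []. Qed.

Lemma dz_dzbar g v w p : O p -> Ck 2 O g ->
  dz v (dzbar w g) p = dzbar w (dz v g) p.
Proof.
move=> Op kg; have -> : dz v (dzbar w g) p = 2^-1 * (rderive (dzbar w g) v p
  - 'i%C * rderive (dzbar w g) ('i%C *: v) p) by [].
have -> : dzbar w (dz v g) p = 2^-1 * (rderive (dz v g) w p
  + 'i%C * rderive (dz v g) ('i%C *: w) p) by [].
rewrite dz_fun dzbar_fun !(rderive_comb _ _ _ _ _ Op kg).
rewrite (rderiveC v w oO Op kg) (rderiveC v ('i%C *: w) oO Op kg).
rewrite (rderiveC ('i%C *: v) w oO Op kg) (rderiveC ('i%C *: v) ('i%C *: w) oO Op kg).
exact: wirtinger_commute.
Qed.

Lemma rderive_Z g (a : Cplx R) v p : O p -> Ck 1 O g ->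
  rderive g (a *: v) p = ((complex.Re a)%:C)%C * rderive g v p
                      + ((complex.Im a)%:C)%C * rderive g ('i%C *: v) p.
Proof.
move=> Op kg.
have E : a *: v = ((complex.Re a)%:C)%C *: v + ((complex.Im a)%:C)%C *: ('i%C *: v).
  transitivity ((((complex.Re a)%:C)%C + 'i%C * ((complex.Im a)%:C)%C : R[i]) *: v).
    by rewrite -complexE.
  by rewrite scalerDl ['i%C * _]mulrC -scalerA.
by rewrite E (rderiveD _ _ oO Op kg) !(rderiveZ _ _ oO Op kg).
Qed.

Lemma dzbar_Z g (a : Cplx R) v p : O p -> Ck 1 O g ->
  dzbar (a *: v) g p = conjc a * dzbar v g p.
Proof.
move=> Op kg; rewrite /dzbar scalerA ['i%C * a]mulrC -scalerA.
rewrite (rderive_Z a v Op kg) (rderive_Z a ('i%C *: v) Op kg) scaleii rderiveN //.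
rewrite {5}[a]complexE conjD conjM conj_i !conjc_real.
by apply: wirtinger_scale_bar; rewrite -expr2 sqr_i.
Qed.

Lemma dz_Z g (a : Cplx R) v p : O p -> Ck 1 O g -> dz (a *: v) g p = a * dz v g p.
Proof.
move=> Op kg; rewrite /dz scalerA ['i%C * a]mulrC -scalerA.
rewrite (rderive_Z a v Op kg) (rderive_Z a ('i%C *: v) Op kg) scaleii rderiveN //.
rewrite {5}[a]complexE.
by apply: wirtinger_scale; rewrite -expr2 sqr_i.
Qed.

Lemma dzbar_addv g v w p : O p -> Ck 1 O g ->
  dzbar (v + w) g p = dzbar v g p + dzbar w g p.
Proof. by move=> Op kg; rewrite /dzbar scalerDr !(rderiveD _ _ oO Op kg); ring. Qed.

Lemma dz_comp n (O' : set (CVec R n)) (g : CVec R n -> Cplx R) (f : V -> CVec R n) v p :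
  open O' -> O' (f p) -> Ck 1 O' g -> O p -> (forall k, Ck 1 O (fun q => f q 0 k)) ->
  dz v (fun q => g (f q)) p = \sum_k (dz (basis_vec k) g (f p) * dz v (fun q => f q 0 k) p
    + dzbar (basis_vec k) g (f p) * conjc (dzbar v (fun q => f q 0 k) p)).
Proof.
move=> oO' Ofp kg Op kf; have dzE h : dz v h p = 2^-1 * (rderive h v p - 'i%C * rderive h ('i%C *: v) p) by [].
rewrite {1}dzE.
rewrite !(rdiff_rderive (rdiff_comp oO' Ofp kg (fun k => Ck_rdiff _ (kf k) Op))).
rewrite mulr_sumr -sumrB mulr_sumr; apply: eq_bigr => k _.
rewrite [X in _ = _ * X + _]dzE /(dzbar v) conjM conjD conjM conj_half conj_i.
exact: wirtinger_comp.
Qed.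

Lemma dzbar_comp n (O' : set (CVec R n)) (g : CVec R n -> Cplx R) (f : V -> CVec R n) v p :
  open O' -> O' (f p) -> Ck 1 O' g -> O p -> (forall k, Ck 1 O (fun q => f q 0 k)) ->
  dzbar v (fun q => g (f q)) p = \sum_k (dz (basis_vec k) g (f p) * dzbar v (fun q => f q 0 k) p
    + dzbar (basis_vec k) g (f p) * conjc (dz v (fun q => f q 0 k) p)).
Proof.
move=> oO' Ofp kg Op kf; have dzE h : dzbar v h p = 2^-1 * (rderive h v p + 'i%C * rderive h ('i%C *: v) p) by [].
rewrite {1}dzE.
rewrite !(rdiff_rderive (rdiff_comp oO' Ofp kg (fun k => Ck_rdiff _ (kf k) Op))).
rewrite mulr_sumr -big_split mulr_sumr; apply: eq_bigr => k _.
rewrite [X in _ = _ * X + _]dzE /(dz v) conjM conjB conjM conj_half conj_i.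
exact: wirtinger_comp_bar.
Qed.

Lemma dz_real (phi phi' : R -> R) g v p : O p -> Ck 1 O g ->
  (forall q, O q -> g q = ((complex.Re (g q))%:C)%C) ->
  is_derive (complex.Re (g p)) 1 phi (phi' (complex.Re (g p))) ->
  dz v (fun q => ((phi (complex.Re (g q)))%:C)%C : Cplx R) p =
    ((phi' (complex.Re (g p)))%:C)%C * dz v g p /\
  dzbar v (fun q => ((phi (complex.Re (g q)))%:C)%C : Cplx R) p =
    ((phi' (complex.Re (g p)))%:C)%C * dzbar v g p.
Proof.
move=> Op kg gR dphi.
have E w : rderive (fun q => ((phi (complex.Re (g q)))%:C)%C : Cplx R) w p =
    ((phi' (complex.Re (g p)))%:C)%C * rderive g w p.
  rewrite (rdiff_rderive (rdiff_real dphi (Ck_rdiff w kg Op))) rmorphM /=.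
  congr (_ * _); rewrite -(rdiff_rderive (near_eq_rdiff (near_open oO Op gR)
    (Ck_rdiff w kg Op))).
  have d1 : is_derive (complex.Re (g p)) 1 (@id R) 1 by exact: is_derive_id.
  by rewrite (rdiff_rderive (rdiff_real d1 (Ck_rdiff w kg Op))) mul1r.
by rewrite /dz /dzbar !E; split; ring.
Qed.

End Wirtinger.

(** * Holomorphic functions *)

Lemma inv_derivative_identity (F : fieldType) (a x : F) : a != 0 ->
  - (x * a^-1) = a * (- x / a ^+ 2).
Proof. by move=> a0; field. Qed.

Section Holomorphic.
Variables (R : realType) (V : normedModType R[i]) (O : set V).
Hypothesis oO : open O.
Implicit Types (g h : V -> Cplx R) (v w p : V).

Lemma holo_Ck k g : holomorphic O g -> Ck k O g.
Proof. by move=> [sg _]; exact: sg. Qed.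

Lemma holo_dzbar g v p : holomorphic O g -> O p -> dzbar v g p = 0.
Proof. by move=> [_ dg] Op; exact: dg. Qed.

Lemma eq_smooth g h : (forall q, O q -> g q = h q) -> smooth O g -> smooth O h.
Proof. by move=> gh sg k; apply: eq_Ck gh (sg k). Qed.

Lemma eq_holo g h : (forall q, O q -> g q = h q) -> holomorphic O g -> holomorphic O h.
Proof.
move=> gh [sg dg]; split; first exact: eq_smooth sg.
by move=> v p Op; rewrite -(eq_dzbar oO v Op (sg 1%N) gh) dg.
Qed.

Lemma holo_cst (a : Cplx R) : holomorphic O (fun=> a).
Proof. by split=> [k|v p Op]; [exact: Ck_cst|exact: dzbar_cst]. Qed.

Lemma holoD g h : holomorphic O g -> holomorphic O h ->
  holomorphic O (fun q => g q + h q).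
Proof.
move=> hg hh; split=> [k|v p Op]; first by apply: CkD => //; exact: holo_Ck.
by rewrite (dzbarD v Op (holo_Ck 1 hg) (holo_Ck 1 hh)) !holo_dzbar ?addr0.
Qed.

Lemma holoM g h : holomorphic O g -> holomorphic O h ->
  holomorphic O (fun q => g q * h q).
Proof.
move=> hg hh; split=> [k|v p Op]; first by apply: CkM => //; exact: holo_Ck.
rewrite (dzbarM v Op (holo_Ck 1 hg) (holo_Ck 1 hh)) (holo_dzbar v hg Op).
by rewrite (holo_dzbar v hh Op) mul0r mulr0 addr0.
Qed.

Lemma holo_sum (I : Type) (r : seq I) (g : I -> V -> Cplx R) :
  (forall i, holomorphic O (g i)) -> holomorphic O (fun q => \sum_(i <- r) g i q).
Proof.
move=> hg; elim: r => [|i r IH].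
  by under eq_fun do rewrite big_nil; exact: holo_cst.
by under eq_fun do rewrite big_cons; exact: holoD.
Qed.

Lemma holo_prod (I : Type) (r : seq I) (g : I -> V -> Cplx R) :
  (forall i, holomorphic O (g i)) -> holomorphic O (fun q => \prod_(i <- r) g i q).
Proof.
move=> hg; elim: r => [|i r IH].
  by under eq_fun do rewrite big_nil; exact: holo_cst.
by under eq_fun do rewrite big_cons; exact: holoM.
Qed.

Lemma holo_det n (A : V -> 'M[Cplx R]_n) :
  (forall i j, holomorphic O (fun q => A q i j)) -> holomorphic O (fun q => \det (A q)).
Proof.
move=> hA; rewrite /determinant; apply: holo_sum => s.
by apply: holoM; [exact: holo_cst|apply: holo_prod => i; exact: hA].
Qed.

Lemma Ck_det k n (A : V -> 'M[Cplx R]_n) :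
  (forall i j, Ck k O (fun q => A q i j)) -> Ck k O (fun q => \det (A q)).
Proof.
move=> hA; rewrite /determinant; apply: Ck_sum => // s.
by apply: CkM => //; [exact: Ck_cst|apply: Ck_prod => // i; exact: hA].
Qed.

(** [dz] and [dzbar] commute, and [dzbar g] vanishes on the whole open set, hence so does its
    [dz]. *)
Lemma holo_dz g v : holomorphic O g -> holomorphic O (dz v g).
Proof.
move=> hg; split=> [k|w p Op]; first by apply: Ck_dz => //; exact: holo_Ck.
rewrite -(dz_dzbar oO v w Op (holo_Ck 2 hg)).
rewrite (eq_dz oO v Op (Ck_dzbar oO w (holo_Ck 2 hg)) (fun q => holo_dzbar w hg)).
exact: dz_cst.
Qed.

Lemma holo_comp n (O' : set (CVec R n)) (g : CVec R n -> Cplx R) (f : V -> CVec R n) :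
  open O' -> (forall p, O p -> O' (f p)) ->
  holomorphic O' g -> (forall j, holomorphic O (fun p => f p 0 j)) ->
  holomorphic O (fun p => g (f p)).
Proof.
move=> oO' OO' hg hf; split=> [k|v p Op].
  by apply: (Ck_comp oO' oO OO' (proj1 hg k)) => j; exact: holo_Ck.
rewrite (dzbar_comp v oO' (OO' _ Op) (proj1 hg 1%N) Op (fun j => holo_Ck 1 (hf j))).
rewrite big1 // => j _; rewrite (holo_dzbar v (hf j) Op) mulr0 add0r.
by rewrite (proj2 hg) ?mul0r //; exact: OO'.
Qed.

(** Stable under differentiation on the positive reals and containing both ln and 1/x, as [Ck_real]
    requires. *)
Definition inv_family : set (R -> R) :=
  [set f | f = @ln R \/ exists (a : R) m, f = fun x => a * x ^- m].

Lemma inv_family_derive phi : inv_family phi -> exists2 phi', inv_family phi' &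
  forall x : R, 0 < x -> is_derive x 1 phi (phi' x).
Proof.
move=> [->|[a [m ->]]].
  exists (fun x => 1 * x ^- 1); first by right; exists 1, 1%N.
  by move=> x x0; rewrite mul1r expr1; exact: is_derive1_ln.
exists (fun x => (- (m%:R * a)) * x ^- m.+1); first by right; exists (- (m%:R * a)), m.+1.
move=> x x0.
have xm : x ^+ m != 0 by rewrite expf_neq0 // gt_eqF.
have d1 : is_derive x 1 (fun x : R => x ^+ m) (m%:R * x ^+ m.-1).
  apply: DeriveDef; first exact: exprn_derivable.
  by rewrite exp_derive /GRing.scale /= mulr1.
have d2 : is_derive x 1 (fun x : R => x ^- m) (- (x ^+ m) ^- 2 *: (m%:R * x ^+ m.-1)).
  by apply: DeriveDef; [apply: derivableV|rewrite deriveV]; case: d1 => // _ ->.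
apply: (is_derive_eq (is_deriveM (is_derive_cst a x (1 : R)) d2)).
rewrite scaler0 addr0 /GRing.scale /=.
case: m {d1 d2} xm => [|m] xm; first by rewrite !mul0r oppr0 mul0r mulr0 mulr0.
have x1 : x != 0 by rewrite gt_eqF.
have xm1 : x ^+ m != 0 by rewrite expf_neq0.
have -> : x ^+ m.+2 = x ^+ m * x * x by rewrite !exprSr.
have -> : x ^+ m.+1 = x ^+ m * x by rewrite exprSr.
move: (m.+1%:R) (x ^+ m) xm1 => k y y0.
by rewrite /=; field; rewrite x1 y0.
Qed.

Lemma normc2E (x : Cplx R) : x * conjc x =
  ((complex.Re x ^+ 2 + complex.Im x ^+ 2)%:C)%C :> Cplx R.
Proof.
by apply: Cplx_eq; rewrite ?ReM ?ImM ReJ ImJ /=; ring.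
Qed.

Lemma normc2_gt0 (x : Cplx R) : x != 0 -> 0 < complex.Re (x * conjc x).
Proof.
move=> x0; rewrite normc2E /= lt0r addr_ge0 ?sqr_ge0 // andbT.
rewrite paddr_eq0 ?sqr_ge0 // !sqrf_eq0; apply: contraNN x0.
by case: x => a b /= /andP[/eqP -> /eqP ->].
Qed.

Lemma Ck_normc2 k g : Ck k O g -> Ck k O (fun q => g q * conjc (g q)).
Proof. by move=> kg; apply: CkM => //; exact: Ck_conj. Qed.

(** 1/g is conj(g) / |g|^2, which leaves only the inverse of a positive real function, covered by
    [Ck_real]. *)
Lemma Ck_inv k g : (forall p, O p -> g p != 0) -> Ck k O g ->
  Ck k O (fun q => (g q)^-1).
Proof.
move=> g0 kg.
apply: (@eq_Ck _ _ k O (fun q => conjc (g q) *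
   (((complex.Re (g q * conjc (g q)))^-1)%:C)%C)) => //.
  move=> p Op; have gp := g0 p Op.
  have -> : (((complex.Re (g p * conjc (g p)))^-1)%:C)%C =
      (g p * conjc (g p))^-1 :> Cplx R.
    by rewrite fmorphV /= normc2E.
  by rewrite invfM mulrCA mulfV ?mulr1 // conjc_eq0.
apply: CkM => //; first exact: Ck_conj.
apply: (@eq_Ck _ _ k O (fun q => (((fun x => 1 * x ^- 1) (complex.Re (g q * conjc (g q))))%:C)%C)) => //.
  by move=> p Op; rewrite mul1r expr1.
apply: (@Ck_real _ _ inv_family [set x | 0 < x] k O (fun q => g q * conjc (g q))
  (fun x => 1 * x ^- 1)) => //.
- exact: inv_family_derive.
- by move=> p Op; apply: normc2_gt0; exact: g0.
- by right; exists 1, 1%N.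
- exact: Ck_normc2.
Qed.

Lemma dz_inv g v p : (forall p, O p -> g p != 0) -> Ck 1 O g -> O p ->
  dz v (fun q => (g q)^-1) p = - dz v g p / g p ^+ 2 /\
  dzbar v (fun q => (g q)^-1) p = - dzbar v g p / g p ^+ 2.
Proof.
move=> g0 kg Op; have kV := Ck_inv g0 kg; have gp := g0 p Op.
have solve (x y : Cplx R) : x * (g p)^-1 + g p * y = 0 -> y = - x / g p ^+ 2.
  move=> E; apply: (mulfI gp).
  have -> : g p * y = - (x * (g p)^-1) by apply/eqP; rewrite -addr_eq0 addrC E.
  exact: inv_derivative_identity.
split; apply: solve.
  rewrite -(dzM v Op kg kV) -(eq_dz oO v Op (Ck_cst 1 1 oO)) ?dz_cst //.
  by move=> q Oq; rewrite mulfV ?g0.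
rewrite -(dzbarM v Op kg kV) -(eq_dzbar oO v Op (Ck_cst 1 1 oO)) ?dzbar_cst //.
by move=> q Oq; rewrite mulfV ?g0.
Qed.

Lemma holo_inv g : (forall p, O p -> g p != 0) -> holomorphic O g ->
  holomorphic O (fun q => (g q)^-1).
Proof.
move=> g0 hg; split=> [k|v p Op]; first by apply: Ck_inv => //; exact: holo_Ck.
have [_ ->] := dz_inv v g0 (holo_Ck 1 hg) Op.
by rewrite (holo_dzbar v hg Op) oppr0 mul0r.
Qed.

Lemma rdiff_lin (L : V -> Cplx R) v p :
  (forall p v (a : Cplx R), L (p + a *: v) = L p + a * L v) -> rdiff L v p (L v).
Proof.
move=> LP.
have d1 (b c : R) : is_derive (0 : R) 1 (fun s => b + s * c) c.
  apply: (is_derive_eq (is_deriveD (is_derive_cst b (0 : R) (1 : R))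
    (is_deriveM (is_derive_id (0 : R) 1) (is_derive_cst c (0 : R) 1)))).
  by rewrite scaler0 !add0r /GRing.scale /= mulr1.
by split; under eq_fun do rewrite LP ?ReD ?ImD ?ReZ ?ImZ.
Qed.

Lemma holo_lin (L : V -> Cplx R) :
  (forall p v (a : Cplx R), L (p + a *: v) = L p + a * L v) -> continuous L ->
  holomorphic O L /\ forall v p, dz v L p = L v.
Proof.
move=> LP cL.
have L0 : L 0 = 0.
  by have := LP 0 0 (-1); rewrite scaler0 addr0 mulN1r subrr.
have Li v : L ('i%C *: v) = 'i%C * L v by rewrite -[_ *: v]add0r LP L0 add0r.
have ii : 'i%C * 'i%C = -1 :> Cplx R by rewrite -expr2 sqr_i.
have dL v p : rderive L v p = L v by apply/rdiff_rderive/rdiff_lin.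
split; last first.
  move=> v p; rewrite /dz !dL Li mulrA ii mulN1r opprK.
  by rewrite -mulr2n -[L v *+ 2]mulr_natl mulrA mulVf ?mul1r // pnatr_eq0.
split=> [[|k]|v p Op].
- by apply: (@CkS _ _ 0); apply: (@Ck_intro _ _ 0 O L (fun v _ => L v)) => //
    [p _|v p _|v]; [exact: cL|exact: rdiff_lin|exact: Ck_cst].
- by apply: (@Ck_intro _ _ k O L (fun v _ => L v)) => //
    [p _|v p _|v]; [exact: cL|exact: rdiff_lin|exact: Ck_cst].
- by rewrite /dzbar !dL Li mulrA ii mulN1r subrr mulr0.
Qed.

End Holomorphic.

Section Coordinates.
Variable R : realType.

Lemma holo_coord n (O : set (CVec R n)) k : open O ->
  holomorphic O (fun z => z 0 k) /\
  forall v p, dz v (fun z : CVec R n => z 0 k) p = v 0 k.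
Proof.
move=> oO; apply: (@holo_lin _ _ O oO (fun z : CVec R n => z 0 k)).
  by move=> p v a; rewrite !mxE.
exact: continuous_coord.
Qed.

Lemma holo_id (O : set (Cplx R)) : open O -> holomorphic O id /\
  forall v p, dz v (@id (Cplx R)) p = v.
Proof. by move=> oO; apply: holo_lin => // x; exact: cvg_id. Qed.

Lemma dzbar_lin_comb n (O : set (CVec R n)) (g : CVec R n -> Cplx R) (v p : CVec R n) :
  open O -> O p -> Ck 1 O g ->
  dzbar v g p = \sum_k conjc (v 0 k) * dzbar (basis_vec k) g p.
Proof.
move=> oO Op kg; rewrite {1}[v]row_sum_delta.
elim: (index_enum _) => [|i r IH].
  by rewrite !big_nil -(scale0r (0 : CVec R n)) (dzbar_Z oO _ _ Op kg) conjc0 mul0r.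
by rewrite !big_cons (dzbar_addv oO _ _ Op kg) IH (dzbar_Z oO _ _ Op kg).
Qed.

Lemma rdiff_affine (V W : normedModType R[i]) (A : V -> W) (L : V -> W)
  (g : W -> Cplx R) v p d :
  (forall p v (s : R), A (p + (s%:C)%C *: v) = A p + (s%:C)%C *: L v) ->
  rdiff g (L v) (A p) d -> rdiff (fun q => g (A q)) v p d.
Proof. by move=> AP [d1 d2]; split; under eq_fun do rewrite AP. Qed.

(** [Ck_comp] deals with maps into row vectors. For an affine map, the derivative of the composite
    along [v] is that of [g] along [L v], again a composite with [A]; this serves for the rotations
    of a disk. *)
Lemma Ck_affine (V W : normedModType R[i]) (A : V -> W) (L : V -> W)
  (O : set V) (O' : set W) (g : W -> Cplx R) k : open O ->
  (forall p v (s : R), A (p + (s%:C)%C *: v) = A p + (s%:C)%C *: L v) ->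
  continuous A -> (forall p, O p -> O' (A p)) ->
  Ck k O' g -> Ck k O (fun q => g (A q)).
Proof.
move=> oO AP cA OO'.
have c (h : W -> Cplx R) m p : Ck m O' h -> O p -> {for p, continuous (fun q => h (A q))}.
  move=> kh Op; apply: (@continuous_comp _ _ _ A h); first exact: cA.
  by apply: Ck_continuous kh _; exact: OO'.
elim: k g => [|k IH] g kg; first by split=> // p; exact: c kg.
apply: (@Ck_intro _ _ k O _ (fun v q => rderive g (L v) (A q))) => //.
- by move=> p; exact: c kg.
- by move=> v p Op; apply: (rdiff_affine AP); apply: Ck_rdiff kg _; exact: OO'.
- by move=> v; apply: IH; exact: Ck_rderive.
Qed.

End Coordinates.

(** * Submean inequalities *)

Section CircleMeans.
Variable R : realType.
Implicit Types (x y r theta : R).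

Lemma mvt_segment (F f : R -> R) (a b : R) : a <= b ->
  (forall x : R, a <= x <= b -> is_derive x 1 F (f x)) ->
  exists2 c, a <= c <= b & F b - F a = f c * (b - a).
Proof.
move=> ab dF.
have [x||c cab E] := @MVT_segment _ F f a b ab _ _.
- by rewrite in_itv /= => /andP[xa xb]; apply: dF; rewrite !ltW.
- apply: derivable_within_continuous => x; rewrite in_itv /= => xab.
  by have [] := dF x xab.
by exists c => //; move: cab; rewrite in_itv.
Qed.

(** If [l] were positive, [f'] would be positive just after 0, and the mean value theorem would give
    values of [f] above [f 0]. *)
Lemma second_derivative_max (f f' : R -> R) (l : R) :
  (\forall s \near (0 : R), is_derive (s : R) 1 f (f' s)) ->
  is_derive (0 : R) 1 f' l ->
  (\forall s \near (0 : R), f s <= f 0) -> l <= 0.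
Proof.
move=> df dl fmax; rewrite leNgt; apply/negP => l0.
have [d d0 dP] : exists2 d : R, 0 < d & forall s : R, `|s| < d ->
    is_derive (s : R) 1 f (f' s) /\ f s <= f 0.
  have : \forall s \near (0 : R), is_derive (s : R) 1 f (f' s) /\ f s <= f 0.
    by apply: filterS2 df fmax => s h1 h2; split.
  move=> [d /= d0 dP]; exists d => // s sd; apply: dP.
  by rewrite /ball_ /= sub0r normrN.
have f'0 : f' 0 = 0.
  have d1 : is_derive (0 : R) 1 f 0.
    apply: (@derive1_at_max _ f (- d) d 0).
    - by rewrite ge0_cp // ltW.
    - move=> t; rewrite in_itv /= -ltr_norml => /dP[[+ _] _]; exact.
    - by rewrite in_itv /= oppr_lt0 d0.
    - by move=> t; rewrite in_itv /= -ltr_norml => /dP[_ ft]; exact: ft.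
  have n0 : `|0 : R| < d by rewrite normr0.
  have [[_ <-] _] := dP 0 n0.
  by case: d1.
have : \forall h \near (0 : R)^', l / 2 < h^-1 * f' h.
  have [dl1 dl2] := dl.
  have : h^-1 *: (f' (h *: (1 : R) + 0) - f' 0) @[h --> (0 : R)^'] --> l.
    by rewrite -dl2; exact: dl1.
  move=> /(@cvgrPdist_lt R R^o _ _ _) /(_ (l / 2)); rewrite divr_gt0 // => /(_ isT).
  apply: filterS => h; rewrite f'0 subr0 addr0 /GRing.scale /= mulr1.
  rewrite ltr_norml => /andP[_]; lra.
move=> [e /= e0 eP].
pose s := Num.min d e / 2.
have m0 : 0 < Num.min d e by rewrite lt_min d0 e0.
have s0 : 0 < s by rewrite divr_gt0.
have sm : s < Num.min d e by rewrite ltr_pdivrMr // ltr_pMr ?ltr1n.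
have [sd se] : s < d /\ s < e by move: sm; rewrite lt_min => /andP[].
have bnd x : 0 <= x <= s -> `|x| < d.
  by move=> /andP[x0 xs]; rewrite ger0_norm // (le_lt_trans xs).
have [x||c] := @MVT _ f f' 0 s s0 _ _.
- by rewrite in_itv /= => /andP[x0 xs]; apply: (dP x _).1; apply: bnd; rewrite !ltW.
- apply: derivable_within_continuous => x; rewrite in_itv /= => /bnd xd.
  by have [[]] := dP x xd.
rewrite in_itv /= => /andP[c0 cs]; rewrite subr0 => E.
have : f s - f 0 <= 0.
  by rewrite subr_le0; apply: (dP s _).2; apply: bnd; rewrite lexx ltW.
rewrite E pmulr_lle0 // leNgt => /negP; apply.
have : l / 2 < c^-1 * f' c.
  apply: eP; last by rewrite gt_eqF.
  by rewrite /ball_ /= sub0r normrN gtr0_norm // (lt_trans cs).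
move=> /(lt_trans (divr_gt0 l0 (ltr0n _ 2))).
by rewrite pmulr_rgt0 // invr_gt0.
Qed.

(** The hypothesis bounds [c] by Riemann sums whose starting point [theta] depends on [N]. The
    integral over a period, expressed by the primitive [Phi], does not depend on the starting point.
    The shifted period may end as far as 4 pi, whence the domain of [Phi]. *)
Lemma periodic_mean_le (phi Phi : R -> R) (c : R) : continuous phi ->
  (forall x, phi (x + 2 * pi) = phi x) ->
  (forall x : R, 0 <= x <= 4 * pi -> is_derive x 1 Phi (phi x)) ->
  (forall N, exists2 theta, 0 <= theta <= 2 * pi &
    N.+1%:R * c <= \sum_(k < N.+1) phi (theta + 2 * pi * k%:R / N.+1%:R)) ->
  2 * pi * c <= Phi (2 * pi) - Phi 0.
Proof.
move=> cphi phiT dPhi sumP; have pi0 := pi_gt0 R.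
have TPhi theta : 0 <= theta <= 2 * pi ->
    Phi (theta + 2 * pi) - Phi theta = Phi (2 * pi) - Phi 0.
  move=> /andP[t0 t2].
  have [x|x _] := @mvt_segment (fun x => Phi (x + 2 * pi) - Phi x)
      (fun x => phi (x + 2 * pi) - phi x) 0 theta t0 _.
    move=> /andP[x0 xt]; apply: is_deriveB; last by apply: dPhi; rewrite x0 /=; lra.
    have d1 : is_derive x 1 (fun y : R => y + 2 * pi) 1.
      apply: (is_derive_eq (is_deriveD (is_derive_id x (1 : R)) (is_derive_cst (2 * pi) x (1 : R)))).
      by rewrite addr0.
    have d2 : is_derive (x + 2 * pi) 1 Phi (phi (x + 2 * pi)).
      by apply: dPhi; apply/andP; split; lra.
    by have := @is_derive1_comp _ Phi (fun y => y + 2 * pi) x _ _ d2 d1; rewrite mulr1.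
  by rewrite phiT subrr mul0r add0r => /eqP; rewrite subr_eq0 => /eqP ->.
apply/ler_addgt0Pl => e e0.
(* An error [e'] at each point integrates to [e] over one period. *)
pose e' := e / (2 * pi); have e'0 : 0 < e' by rewrite divr_gt0 // mulr_gt0.
(* Uniform continuity of [phi] on the segment, by compactness. *)
have : \forall t \near (0 : R), `[0, 4 * pi] `<=` [set x | `|phi (x + t) - phi x| < e'].
  have := @segment_compact R 0 (4 * pi).
  move/compact_near_coveringP => H.
  apply: (H R (nbhs (0 : R)) (fun t x => `|phi (x + t) - phi x| < e')) => x _.
  have c2 : (fun z : R * R => phi (z.1 + z.2) - phi z.1) z
      @[z --> (x, 0 : R)] --> phi (x + 0) - phi x.
    apply: cvgB; last by apply: (continuous_cvg _ (cphi _)); exact: cvg_fst.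
    apply: (continuous_cvg _ (cphi _)); apply: cvgD; [exact: cvg_fst|exact: cvg_snd].
  move: c2; rewrite addr0 subrr => /(@cvgrPdist_lt R R^o _ _ _) /(_ e' e'0).
  by apply: filterS => z /=; rewrite sub0r normrN.
move=> [d /= d0 dP].
have [N Nd] : exists N : nat, 2 * pi / d < N.+1%:R.
  exists (Num.truncn (2 * pi / d)).
  by apply: truncnS_gt.
pose h : R := 2 * pi / N.+1%:R.
have N0 : (0 : R) < N.+1%:R by rewrite ltr0n.
have h0 : 0 < h by rewrite divr_gt0 // mulr_gt0.
have hd : h < d by rewrite ltr_pdivrMr // [d * _]mulrC -ltr_pdivrMr.
have hN : h * N.+1%:R = 2 * pi by rewrite /h mulfVK // gt_eqF.
have [theta theta02 sumc] := sumP N.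
(* On each subinterval the increment of [Phi] is [h] times a value of [phi] at a point within
   [h < d] of the left node; the sum of the increments telescopes. *)
have step k : (k < N.+1)%N ->
    h * (phi (theta + h * k%:R) - e') <= Phi (theta + h * k.+1%:R) - Phi (theta + h * k%:R).
  move=> kN; have /andP[t0 t2] := theta02.
  have kN' : k.+1%:R <= N.+1%:R :> R by rewrite ler_nat.
  have k0 : 0 <= k%:R :> R by rewrite ler0n.
  have hk0 : 0 <= h * k%:R by rewrite mulr_ge0 // ltW.
  have hkN : h * k.+1%:R <= 2 * pi by rewrite -hN ler_pM2l.
  have hkS : h * k.+1%:R = h * k%:R + h by rewrite -addn1 natrD mulrDr mulr1.
  have leb : theta + h * k%:R <= theta + h * k.+1%:R by rewrite hkS; lra.
  have [x /andP[xa xb]|x /andP[xa xb] ->] := @mvt_segment Phi phi _ _ leb _.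
    by apply: dPhi; apply/andP; split; lra.
  have -> : theta + h * k.+1%:R - (theta + h * k%:R) = h by rewrite hkS; ring.
  rewrite mulrC ler_pM2r //.
  have H1 : ball_ [eta Num.Def.normr] 0 d (x - (theta + h * k%:R)).
    by rewrite /ball_ /= sub0r normrN ger0_norm; lra.
  have H2 : `[0, 4 * pi]%classic (theta + h * k%:R).
    by rewrite /= in_itv /=; apply/andP; split; lra.
  have := dP _ H1 _ H2; rewrite /=.
  have -> : theta + h * k%:R + (x - (theta + h * k%:R)) = x by ring.
  rewrite ltr_norml => /andP[+ _]; lra.
have : \sum_(k < N.+1) h * (phi (theta + h * k%:R) - e') <=
    \sum_(k < N.+1) (Phi (theta + h * k.+1%:R) - Phi (theta + h * k%:R)).
  by apply: ler_sum => k _; exact: step.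
rewrite -(big_mkord xpredT (fun k => Phi (theta + h * k.+1%:R) - Phi (theta + h * k%:R))).
rewrite telescope_sumr // mulr0 addr0 hN TPhi // -mulr_sumr sumrB sumr_const card_ord.
rewrite -[e' *+ _]mulr_natl.
have -> : \sum_(k < N.+1) phi (theta + h * k%:R) =
    \sum_(k < N.+1) phi (theta + 2 * pi * k%:R / N.+1%:R).
  by apply: eq_bigr => k _; rewrite /h [in RHS]mulrAC.
move: sumc; rewrite -(ler_pM2l h0) mulrA hN mulrBr [h * (_ * e')]mulrA hN.
have -> : 2 * pi * e' = e by rewrite /e' mulrC divfK // gt_eqF // mulr_gt0.
lra.
Qed.

End CircleMeans.

Lemma laplace_identity (K : comPzRingType) (h i a b c : K) : i * i = -1 ->
  h * (h * (a + i * b) - i * (h * (b + i * c))) = h * h * (a + c).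
Proof.
move=> ii; transitivity (h * h * (a - i * i * c)); first by ring.
by rewrite ii; ring.
Qed.

(** * Maximum principle on disks *)

Section MaximumPrinciple.
Variable R : realType.
Local Notation C := (Cplx R).

Definition expi (theta : R) : C := (cos theta +i* sin theta)%C.

Lemma expiD (a b : R) : expi (a + b) = expi a * expi b.
Proof. by apply: Cplx_eq; rewrite ?ReM ?ImM /= ?cosD ?sinD //; ring. Qed.

Lemma expi_conj (a : R) : expi a * conjc (expi a) = 1.
Proof. by rewrite normc2E /= cos2Dsin2. Qed.

Lemma norm_expi (a : R) : `|expi a| = 1 :> R[i].
Proof. by rewrite normc_def /= cos2Dsin2 sqrtr1. Qed.

Lemma expi2pi (a : R) : expi (a + 2 * pi) = expi a.
Proof.
by rewrite /expi mulr_natl cosD2pi sinD2pi.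
Qed.

Lemma continuous_expi : continuous expi.
Proof.
move=> x; apply: (@cvg_Cplx R R (nbhs x) _ expi (expi x)).
  exact: continuous_cos.
exact: continuous_sin.
Qed.

Lemma polar_form (w : C) : exists rho theta : R,
  [/\ 0 <= rho, 0 <= theta <= 2 * pi, `|w| = (rho%:C)%C & w = (rho%:C)%C * expi theta].
Proof.
have pi0 := pi_gt0 R.
case: w => a b; pose rho := Num.sqrt (a ^+ 2 + b ^+ 2).
have rho2 : rho ^+ 2 = a ^+ 2 + b ^+ 2 by rewrite sqr_sqrtr // addr_ge0 ?sqr_ge0.
have [rho0|rho0] := eqVneq rho 0.
  exists 0, 0; split => //; first by rewrite lexx mulr_ge0 // ltW.
    by rewrite normc_def /= -/rho rho0.
  have : a ^+ 2 + b ^+ 2 = 0 by rewrite -rho2 rho0 expr0n.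
  move/eqP; rewrite paddr_eq0 ?sqr_ge0 // !sqrf_eq0 => /andP[/eqP -> /eqP ->].
  by rewrite mul0r.
have rhop : 0 < rho by rewrite lt_neqAle eq_sym rho0 sqrtr_ge0.
have ab1 : (a / rho) ^+ 2 + (b / rho) ^+ 2 = 1.
  by rewrite !expr_div_n -mulrDl -rho2 mulfV // expf_neq0.
have a1 : -1 <= a / rho <= 1.
  rewrite -ler_norml -(@ler_pXn2r _ 2) ?nnegrE // expr1n real_normK ?num_real //.
  by rewrite -ab1 lerDl sqr_ge0.
have a1' : a / rho \in `[(-1), 1] by rewrite in_itv.
have cE : cos (acos (a / rho)) = a / rho by rewrite acosK.
have sE : sin (acos (a / rho)) = `|b| / rho.
  rewrite sin_acos //.
  have -> : 1 - (a / rho) ^+ 2 = (b / rho) ^+ 2 by rewrite -ab1; ring.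
  by rewrite sqrtr_sqr normrM normfV (gtr0_norm rhop).
have [g0 gpi] := (acos_ge0 a1, acos_lepi a1).
have [b0|b0] := leP 0 b.
  exists rho, (acos (a / rho)); split; [exact: ltW| | |].
  - by rewrite g0 /=; lra.
  - by rewrite normc_def.
  apply: Cplx_eq; rewrite ?ReZ ?ImZ /= ?cE ?sE ?(ger0_norm b0).
    by rewrite mulrC divfK.
  by rewrite mulrC divfK.
(* acos only reaches the upper half plane; the lower one is its image under conjugation. *)
exists rho, (2 * pi - acos (a / rho)); split; [exact: ltW| | |].
- by apply/andP; split; lra.
- by rewrite normc_def.
have e1 : expi (2 * pi - acos (a / rho)) = conjc (expi (acos (a / rho))).
  by rewrite addrC expi2pi /expi cosN sinN.
rewrite e1; apply: Cplx_eq; rewrite ?ReZ ?ImZ ?ReJ ?ImJ /= ?cE ?sE.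
  by rewrite mulrC divfK.
by rewrite (ltr0_norm b0) mulNr opprK mulrC divfK.
Qed.

Lemma laplaceE (V : normedModType R[i]) (O : set V) (u : V -> C) e p :
  open O -> O p -> Ck 2 O u ->
  dz e (dzbar e u) p = 2^-1 * 2^-1 *
   (rderive (rderive u e) e p + rderive (rderive u ('i%C *: e)) ('i%C *: e) p).
Proof.
move=> oO Op ku.
have -> : dz e (dzbar e u) p = 2^-1 * (rderive (dzbar e u) e p
  - 'i%C * rderive (dzbar e u) ('i%C *: e) p) by [].
rewrite dzbar_fun !(rderive_comb oO _ _ _ _ _ Op ku).
rewrite (rderiveC ('i%C *: e) e oO Op ku).
by apply: laplace_identity; rewrite -expr2 sqr_i.
Qed.

Lemma local_max_second (V : normedModType R[i]) (O : set V) (u : V -> C) v p :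
  open O -> O p -> Ck 2 O u ->
  (\forall q \near p, complex.Re (u q) <= complex.Re (u p)) ->
  complex.Re (rderive (rderive u v) v p) <= 0.
Proof.
move=> oO Op ku umax.
apply: (@second_derivative_max _ (fun s => complex.Re (u (p + (s%:C)%C *: v)))
  (fun s => complex.Re (rderive u v (p + (s%:C)%C *: v)))).
- have : \forall q \near p, O q by apply: (near_open oO Op).
  move=> /(near_line v); apply: filterS => s Os.
  exact: (rdiff_at (Ck_rdiff v ku Os)).1.
- exact: rdiff_Re (Ck_rdiff v (Ck_rderive v ku) Op).
- by have := near_line v umax; rewrite line0.
Qed.

Lemma local_max_laplace (V : normedModType R[i]) (O : set V) (u : V -> C) e p :
  open O -> O p -> Ck 2 O u ->
  (\forall q \near p, complex.Re (u q) <= complex.Re (u p)) ->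
  complex.Re (dz e (dzbar e u) p) <= 0.
Proof.
move=> oO Op ku umax; rewrite (laplaceE e oO Op ku).
have -> : 2^-1 * 2^-1 = (((2^-1 * 2^-1 : R)%:C)%C) :> C.
  by rewrite rmorphM /= fmorphV rmorph_nat.
rewrite ReZ ReD.
have h1 := local_max_second e oO Op ku umax.
have h2 := local_max_second ('i%C *: e) oO Op ku umax.
apply: mulr_ge0_le0; first by rewrite mulr_ge0 // invr_ge0.
rewrite -[leRHS]addr0; exact: (lerD h1 h2).
Qed.

(** The maximum is sought on the compact rectangle of polar coordinates. If its radius were less
    than [r], the point would be a local maximum in the plane, where the Laplacian is at most 0. *)
Lemma maximum_principle (O : set C) (e : C) (u : C -> C) (r : R) : open O -> 0 < r ->
  (forall x : C, `|x| <= (r%:C)%C -> O x) -> Ck 2 O u ->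
  (forall p, O p -> 0 < complex.Re (dz e (dzbar e u) p)) ->
  exists2 theta : R, 0 <= theta <= 2 * pi &
    complex.Re (u 0) <= complex.Re (u ((r%:C)%C * expi theta)).
Proof.
move=> oO r0 Or ku lap; have pi0 := pi_gt0 R.
pose f (z : R * R) := complex.Re (u ((z.1%:C)%C * expi z.2)).
pose A : set (R * R) := `[0, r]%classic `*` `[0, 2 * pi]%classic.
have A0 : A !=set0.
  by exists (0, 0); split; rewrite /= in_itv /= lexx ?ltW // mulr_gt0.
have cA : compact A by apply: compact_setX; exact: segment_compact.
have normA (a b : R) : 0 <= a -> `|(a%:C)%C * expi b| = (a%:C)%C :> R[i].
  by move=> a0; rewrite normrM norm_expi mulr1 normR ger0_norm.
have OA (a b : R) : 0 <= a <= r -> O ((a%:C)%C * expi b).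
  by move=> /andP[a0 ar]; apply: Or; rewrite normA // lecR.
have cf : {within A, continuous f}.
  apply: continuous_in_subspaceT => z; rewrite inE => -[/= z1 z2].
  move: z1; rewrite in_itv /= => z1.
  apply: (continuous_cvg _ (@continuous_Re _ _)).
  apply: (@continuous_cvg _ _ _ _ _ _ u); first exact: Ck_continuous ku (OA _ _ z1).
  apply: cvgM; first by apply: (continuous_cvg _ (@continuous_real_complex _ _)); exact: cvg_fst.
  by apply: (continuous_cvg _ (@continuous_expi _)); exact: cvg_snd.
have [[a b] /=] := compact_EVT_max A0 cA cf; rewrite inE => -[/=].
rewrite !in_itv /= => a_r b_pi fmax.
have a0 : 0 <= a by case/andP: a_r.
have u0 : complex.Re (u 0) <= f (a, b).
  have := fmax (0, 0); rewrite inE /f /= mul0r; apply.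
  by split; rewrite /= in_itv /= lexx ?ltW // mulr_gt0.
have [ar|ar] := eqVneq a r; first by exists b => //; rewrite -ar.
exfalso; have {}ar : a < r by rewrite lt_neqAle ar; case/andP: a_r.
pose p : C := (a%:C)%C * expi b.
have Op : O p by exact: OA.
have : complex.Re (dz e (dzbar e u) p) <= 0.
  apply: (local_max_laplace e oO Op ku).
  have bp : \forall q \near p, `|p - q| < ((r - a)%:C)%C :> R[i].
    by apply: (nbhsx_ballx p); rewrite ltcR subr_gt0.
  apply: filterS bp => q qp.
  have qr : `|q| < (r%:C)%C :> R[i].
    rewrite -[q](subKr p) (le_lt_trans (ler_normB _ _)) //.
    rewrite normA // (_ : r = a + (r - a)); last by ring.
    by rewrite rmorphD /= ltrD2l.
  have [rho [theta [rho0 theta_pi nq qE]]] := polar_form q.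
  have := fmax (rho, theta); rewrite inE /f /= -qE; apply.
  split; rewrite /= in_itv //= rho0 /= ltW //.
  by move: qr; rewrite nq ltcR.
by rewrite leNgt lap.
Qed.

Lemma dz_affine (O' : set C) (u A : C -> C) (e w : C) p : open O' ->
  (forall q v : C, A (q + v) = A q + w * v) -> Ck 1 O' u -> O' (A p) ->
  dz e (fun q => u (A q)) p = w * dz e u (A p) /\
  dzbar e (fun q => u (A q)) p = conjc w * dzbar e u (A p).
Proof.
move=> oO' AP ku OAp.
have E (v : C) : rderive (fun q => u (A q)) v p = rderive u (w *: v) (A p).
  apply: rdiff_rderive; apply: (@rdiff_affine _ C C A (fun v => w *: v)).
    move=> q v' s; rewrite AP; congr (_ + _).
    by rewrite /GRing.scale /= mulrCA.
  exact: Ck_rdiff ku OAp.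
have wi (v : C) : w *: ('i%C *: v) = 'i%C *: (w *: v).
  by rewrite !scalerA mulrC.
rewrite -(dz_Z oO' w e OAp ku) -(dzbar_Z oO' w e OAp ku).
by rewrite /dz /dzbar !E wi.
Qed.

End MaximumPrinciple.

(** * Submean inequality from the sign of the Laplacian *)

Section SubMean.
Variable R : realType.
Local Notation C := (Cplx R).
Implicit Types (O : set C) (u : C -> C) (z : C) (r : R).

Definition on_circle u z r (x : R) : R := complex.Re (u (z + (r%:C)%C * expi x)).

Lemma circle_sub O z r x : 0 <= r -> [set y | `|y - z| <= (r%:C)%C] `<=` O ->
  O (z + (r%:C)%C * expi x).
Proof.
move=> r0; apply; rewrite /= addrAC subrr add0r normrM norm_expi mulr1 normR.
by rewrite ger0_norm.
Qed.

Lemma continuous_on_circle O u z r : 0 <= r ->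
  [set y | `|y - z| <= (r%:C)%C] `<=` O -> Ck 0 O u -> continuous (on_circle u z r).
Proof.
move=> r0 zO ku x.
apply: (continuous_cvg _ (@continuous_Re _ _)).
apply: (@continuous_cvg _ _ _ _ _ _ u).
  exact: Ck_continuous ku (circle_sub x r0 zO).
apply: cvgD; first exact: cvg_cst.
apply: cvgM; first exact: cvg_cst.
exact: continuous_expi.
Qed.

Lemma continuous_affine (z w : C) : continuous (fun x : C => z + w * x).
Proof.
move=> x; apply: (@cvgD _ C C (nbhs x)).
  exact: cvg_cst.
exact: (@cvgM R[i] C (nbhs x) _ (fun=> w) id w x (cvg_cst _) cvg_id).
Qed.

Lemma CkW k m O u : (m <= k)%N -> Ck k O u -> Ck m O u.
Proof.
elim: k => [|k IH]; first by rewrite leqn0 => /eqP ->.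
rewrite leq_eqVlt => /predU1P[->//|]; rewrite ltnS => mk /CkS; exact: IH.
Qed.

(** The sum [U] of the [N.+1] rotates of [u] about [z] by roots of unity still has positive
    Laplacian. The maximum principle for [U] compares [N.+1] times [u z] with a sum of values of [u]
    at equidistant points of the circle, which is the hypothesis of [periodic_mean_le]. *)
Lemma submean_strict O e u z r (Phi : R -> R) : open O -> 0 < r ->
  [set y | `|y - z| <= (r%:C)%C] `<=` O -> Ck 2 O u ->
  (forall p, O p -> 0 < complex.Re (dz e (dzbar e u) p)) ->
  (forall x : R, 0 <= x <= 4 * pi -> is_derive x 1 Phi (on_circle u z r x)) ->
  2 * pi * complex.Re (u z) <= Phi (2 * pi) - Phi 0.
Proof.
move=> oO r0 zO ku lap dPhi.
apply: (@periodic_mean_le _ (on_circle u z r)) => //.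
- exact: continuous_on_circle (ltW r0) zO (CkW _ ku).
- by move=> x; rewrite /on_circle expi2pi.
move=> N.
pose w (k : 'I_N.+1) := expi (2 * pi * k%:R / N.+1%:R : R).
pose A k (x : C) : C := z + w k * x.
have AD k (q v : C) : A k (q + v) = A k q + w k * v by rewrite /A mulrDr addrA.
have cA k : continuous (A k) by exact: continuous_affine.
pose O' : set C := [set x | forall k, O (A k x)].
have oO' : open O'.
  rewrite openE => x O'x.
  apply: (@filter_forall C _ (fun k y => O (A k y)) (nbhs x) _) => k; apply: (cA k x); exact: open_nbhs_nbhs (conj oO (O'x k)).
have kA m (g : C -> C) k : Ck m O g -> Ck m O' (fun x => g (A k x)).
  apply: (@Ck_affine _ C C (A k) (fun v => w k * v) O' O) => // p v s.
  by rewrite AD; congr (_ + _); rewrite /GRing.scale /= mulrCA.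
pose U (x : C) : C := \sum_k u (A k x).
have kU : Ck 2 O' U by exact: (Ck_sum _ oO' (fun k => kA 2%N u k ku)).
have lapU p : O' p -> 0 < complex.Re (dz e (dzbar e U) p).
  move=> O'p.
  have E q : O' q -> \sum_k conjc (w k) * dzbar e u (A k q) = dzbar e U q.
    move=> O'q; rewrite (dzbar_sum oO' _ _ O'q) => [|k]; last exact: (kA 1%N u k (CkS ku)).
    apply: eq_bigr => k _.
    by have [_ ->] := dz_affine e oO (AD k) (CkS ku) (O'q k).
  have kE k : Ck 1 O' (fun q => conjc (w k) * dzbar e u (A k q)).
    exact: (CkZ (conjc (w k)) oO' (kA 1%N (dzbar e u) k (Ck_dzbar oO e ku))).
  rewrite -(eq_dz oO' e O'p (Ck_sum _ oO' kE) E) (dz_sum oO' _ _ O'p kE) Re_sum.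
  (* Rotation invariance of the Laplacian: the factors [w k] and [conjc (w k)] cancel. *)
  have P k : complex.Re (dz e (fun q => conjc (w k) * dzbar e u (A k q)) p)
      = complex.Re (dz e (dzbar e u) (A k p)).
    rewrite (dzZ oO' _ _ O'p (kA 1%N (dzbar e u) k (Ck_dzbar oO e ku))).
    have [-> _] := dz_affine e oO (AD k) (Ck_dzbar oO e ku) (O'p k).
    by rewrite mulrA [_ * w k]mulrC expi_conj mul1r.
  rewrite big_ord_recl ltr_wpDr //; last by rewrite P lap //; exact: O'p.
  by apply: sumr_ge0 => k _; rewrite P ltW // lap //; exact: O'p.
have ballO' (x : C) : `|x| <= (r%:C)%C -> O' x.
  move=> xr k; apply: zO; rewrite /= /A addrAC subrr add0r normrM norm_expi.
  by rewrite mul1r.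
have [theta t02 le] := maximum_principle oO' r0 ballO' kU lapU.
exists theta => //; move: le; rewrite /U !Re_sum.
have -> : \sum_k complex.Re (u (A k 0)) = N.+1%:R * complex.Re (u z).
  under eq_bigr do rewrite /A mulr0 addr0.
  by rewrite sumr_const card_ord mulr_natl.
move=> /le_trans; apply; rewrite le_eqVlt; apply/orP; left; apply/eqP.
by apply: eq_bigr => k _; rewrite /on_circle /A /w mulrCA -expiD [_ + theta]addrC.
Qed.

Lemma laplace_normc2 (e z p : C) : e = 1 ->
  dz e (dzbar e (fun q => (q - z) * conjc (q - z))) p = 1 /\
  forall k, Ck k setT (fun q : C => (q - z) * conjc (q - z)).
Proof.
move=> e1; have oT : open (@setT C) by exact: openT.
have [hid did] := holo_id oT.
have hz : holomorphic setT (fun q : C => q + - z) by apply: holoD => //; exact: holo_cst.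
have dzz q : dz e (fun q : C => q + - z) q = 1.
  by rewrite (dzD _ I (holo_Ck 1 hid) (Ck_cst 1 (- z) oT)) did dz_cst addr0 e1.
split; last by move=> k; apply: Ck_normc2 => //; exact: holo_Ck hz.
have E q : setT q -> q - z = dzbar e (fun q => (q - z) * conjc (q - z)) q.
  move=> _; rewrite (dzbarM _ I (holo_Ck 1 hz) (Ck_conj oT (holo_Ck 1 hz))).
  rewrite (holo_dzbar _ hz I) mul0r add0r (dzbar_conj _ I (holo_Ck 1 hz)) dzz.
  by rewrite conjc1 mulr1.
by rewrite -(eq_dz oT e I (holo_Ck 1 hz) E) dzz.
Qed.

(* The strict case applied to [u + e |. - z|^2], as [e] tends to 0. *)
Lemma submean O (e : C) u z r (Phi : R -> R) : e = 1 -> open O -> 0 < r ->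
  [set y | `|y - z| <= (r%:C)%C] `<=` O -> Ck 2 O u ->
  (forall p, O p -> 0 <= complex.Re (dz e (dzbar e u) p)) ->
  (forall x : R, 0 <= x <= 4 * pi -> is_derive x 1 Phi (on_circle u z r x)) ->
  2 * pi * complex.Re (u z) <= Phi (2 * pi) - Phi 0.
Proof.
move=> e1 oO r0 zO ku lap dPhi; have pi0 := pi_gt0 R.
apply/ler_addgt0Pl => c c0.
(* The added term equals [e' * r ^+ 2] on the circle, so it contributes exactly [c] to the integral
   over a period. *)
pose e' := c / (2 * pi * r ^+ 2).
have d0 : 0 < 2 * pi * r ^+ 2 by rewrite !mulr_gt0 // exprn_gt0.
have e'0 : 0 < e' by rewrite divr_gt0.
pose sq (q : C) := (q - z) * conjc (q - z).
pose v q : C := u q + (e'%:C)%C * sq q.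
have ksq k : Ck k O sq by exact: (Ck_sub (fun _ _ => I) (proj2 (laplace_normc2 z 0 e1) k)).
have kv : Ck 2 O v by exact: (CkD oO ku (CkZ _ oO (ksq 2%N))).
have lapv p : O p -> 0 < complex.Re (dz e (dzbar e v) p).
  move=> Op.
  have E q : O q -> dzbar e u q + (e'%:C)%C * dzbar e sq q = dzbar e v q.
    move=> Oq; rewrite (dzbarD _ Oq (CkS ku) (CkZ _ oO (ksq 1%N))).
    by rewrite (dzbarZ oO _ _ Oq (ksq 1%N)).
  have k1 := Ck_dzbar oO e ku; have k2 := Ck_dzbar oO e (ksq 2%N).
  rewrite -(eq_dz oO e Op (CkD oO k1 (CkZ _ oO k2)) E).
  rewrite (dzD _ Op k1 (CkZ _ oO k2)) (dzZ oO _ _ Op k2) (proj1 (laplace_normc2 z p e1)).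
  by rewrite ReD mulr1 ltr_wpDl // lap.
have dPhiv (x : R) : 0 <= x <= 4 * pi ->
    is_derive x 1 (fun x => Phi x + e' * r ^+ 2 * x) (on_circle v z r x).
  move=> /dPhi dx.
  have d1 : is_derive x 1 (fun x : R => e' * r ^+ 2 * x) (e' * r ^+ 2).
    apply: (is_derive_eq (is_deriveM (is_derive_cst (e' * r ^+ 2) x (1 : R)) (is_derive_id x (1 : R)))).
    by rewrite scaler0 addr0 /GRing.scale /= mulr1.
  apply: (is_derive_eq (is_deriveD dx d1)).
  rewrite /on_circle /v ReD ReZ; congr (_ + _ * _).
  rewrite /sq [z + _]addrC addrK.
  have -> : (r%:C)%C * expi x * conjc ((r%:C)%C * expi x) = ((r ^+ 2)%:C)%C :> C.
    by rewrite conjM conjc_real mulrACA expi_conj mulr1 -rmorphM -expr2.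
  by [].
have := submean_strict oO r0 zO kv lapv dPhiv.
rewrite /v /sq subrr mul0r mulr0 addr0 mulr0 addr0 => /le_trans; apply.
have -> : e' * r ^+ 2 * (2 * pi) = c.
  by rewrite -mulrA [r ^+ 2 * _]mulrC /e' divfK // gt_eqF.
by rewrite addrAC addrC lexx.
Qed.

End SubMean.

(** * Laplacian of log |w| *)

Section LogLaplacian.
Variable R : realType.
Local Notation C := (Cplx R).
Implicit Types (O : set C) (e z p : C).

Lemma log_laplace_identity (F : fieldType) (v x y xy : F) : v != 0 ->
  (- x / v ^+ 2) * y + v^-1 * xy = xy / v - x * y / v ^+ 2.
Proof. by move=> v0; field. Qed.

(** The logarithm of a positive function, kept complex-valued so that the Wirtinger calculus applies
    to it. *)
Definition rlog (g : C -> C) (q : C) : C := ((ln (complex.Re (g q)))%:C)%C.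

Lemma Ck_rlog k O (g : C -> C) : open O -> (forall q, O q -> 0 < complex.Re (g q)) ->
  Ck k O g -> Ck k O (rlog g).
Proof.
move=> oO g0 kg; apply: (@Ck_real _ _ (@inv_family R) [set x | 0 < x] k O g (@ln R)).
- exact: oO.
- exact: inv_family_derive.
- exact: g0.
- by left.
- exact: kg.
Qed.

Lemma laplace_rlog O (g : C -> C) e p : open O -> O p -> Ck 2 O g ->
  (forall q, O q -> g q = ((complex.Re (g q))%:C)%C) ->
  (forall q, O q -> 0 < complex.Re (g q)) ->
  dz e (dzbar e (rlog g)) p =
    dz e (dzbar e g) p / g p - dz e g p * dzbar e g p / g p ^+ 2.
Proof.
move=> oO Op kg gR g0.
have gn0 q : O q -> g q != 0.
  move=> Oq; apply/negP => /eqP gq; have := g0 q Oq.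
  by rewrite gq /= ltxx.
have kV : Ck 2 O (fun q => (g q)^-1) by exact: (Ck_inv oO gn0 kg).
have kb := Ck_dzbar oO e kg.
have E q : O q -> (g q)^-1 * dzbar e g q = dzbar e (rlog g) q.
  move=> Oq.
  have dln : is_derive (complex.Re (g q)) 1 (@ln R) ((complex.Re (g q))^-1).
    exact: (is_derive1_ln (g0 q Oq)).
  have [_ ->] := dz_real oO (phi' := fun x => x^-1) e Oq (CkS kg) gR dln.
  have -> : (((complex.Re (g q))^-1)%:C)%C = (g q)^-1 :> C.
    by rewrite {2}(gR q Oq); exact: (fmorphV (real_complex R)).
  by [].
rewrite -(eq_dz oO e Op (CkM oO (CkS kV) kb) E) (dzM e Op (CkS kV) kb).
have [-> _] := dz_inv oO e gn0 (CkS kg) Op.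
exact: (log_laplace_identity _ _ _ (gn0 p Op)).
Qed.

Lemma dz_normc2 O (w : C -> C) (a e p : C) : open O -> O p -> Ck 1 O w ->
  dz e (fun q => w q * conjc (w q) + a) p =
    dz e w p * conjc (w p) + w p * conjc (dzbar e w p) /\
  dzbar e (fun q => w q * conjc (w q) + a) p =
    dzbar e w p * conjc (w p) + w p * conjc (dz e w p).
Proof.
move=> oO Op kw; have kc := Ck_conj oO kw; have ka := @Ck_cst _ _ 1 O a oO.
rewrite (dzD e Op (CkM oO kw kc) ka) (dzbarD e Op (CkM oO kw kc) ka).
rewrite (dzM e Op kw kc) (dzbarM e Op kw kc) dz_cst dzbar_cst !addr0.
by rewrite (dz_conj e Op kw) (dzbar_conj e Op kw).
Qed.

Lemma laplace_normc2w O (w : C -> C) (a e p : C) : open O -> O p -> Ck 2 O w ->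
  dz e (dzbar e (fun q => w q * conjc (w q) + a)) p =
    dz e (dzbar e w) p * conjc (w p) + dzbar e w p * conjc (dzbar e w p)
    + (dz e w p * conjc (dz e w p) + w p * conjc (dz e (dzbar e w) p)).
Proof.
move=> oO Op kw.
have E q : O q -> dzbar e w q * conjc (w q) + w q * conjc (dz e w q) =
    dzbar e (fun q => w q * conjc (w q) + a) q.
  by move=> Oq; have [_ ->] := dz_normc2 a e oO Oq (CkS kw).
have k1 := CkS kw; have kb := Ck_dzbar oO e kw; have kd := Ck_dz oO e kw.
have c1 := Ck_conj oO k1; have cd := Ck_conj oO kd.
rewrite -(eq_dz oO e Op (CkD oO (CkM oO kb c1) (CkM oO k1 cd)) E).
rewrite (dzD e Op (CkM oO kb c1) (CkM oO k1 cd)) (dzM e Op kb c1) (dzM e Op k1 cd).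
rewrite (dz_conj e Op k1) (dz_conj e Op kd); congr (_ + (_ + _ * conjc _)).
by rewrite (dz_dzbar oO e e Op kw).
Qed.

Lemma normc2_real (x : C) (a : R) : 0 <= a ->
  x * conjc x + (a%:C)%C = ((complex.Re (x * conjc x + (a%:C)%C))%:C)%C :> C /\
  (x != 0 \/ 0 < a -> 0 < complex.Re (x * conjc x + (a%:C)%C)).
Proof.
move=> a0; rewrite normc2E -rmorphD /=; split=> // -[x0|a1].
  by have := normc2_gt0 x0; rewrite normc2E /= => x1; exact: ltr_wpDr.
by apply: ltr_wpDl => //; rewrite addr_ge0 ?sqr_ge0.
Qed.

Lemma holo_log_identity (F : fieldType) (x xb d db a : F) : x * xb + a != 0 ->
  (d * db) / (x * xb + a) - (d * xb) * (x * db) / (x * xb + a) ^+ 2 =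
  a * (d * db) * ((x * xb + a)^-1) ^+ 2.
Proof. by move=> n0; field. Qed.

(** The Laplacian is a |w'|^2 / (|w|^2 + a)^2. The positive constant [a] keeps the logarithm smooth
    across the zeros of [w]. *)
Lemma log_holo_laplace_ge0 O (w : C -> C) (a : R) e p : open O -> O p -> 0 < a ->
  holomorphic O w ->
  0 <= complex.Re (dz e (dzbar e (rlog (fun q => w q * conjc (w q) + (a%:C)%C))) p).
Proof.
move=> oO Op a0 hw; have kw := holo_Ck 2 hw.
have r q : O q -> w q * conjc (w q) + (a%:C)%C =
    ((complex.Re (w q * conjc (w q) + (a%:C)%C))%:C)%C :> C.
  by move=> _; have [] := normc2_real (w q) (ltW a0).
have r0 q : O q -> 0 < complex.Re (w q * conjc (w q) + (a%:C)%C).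
  by move=> _; have [_ ] := normc2_real (w q) (ltW a0); apply; right.
have kn : Ck 2 O (fun q => w q * conjc (w q) + (a%:C)%C).
  exact: (CkD oO (CkM oO kw (Ck_conj oO kw)) (Ck_cst 2 _ oO)).
rewrite (laplace_rlog e oO Op kn r r0) (laplace_normc2w _ e oO Op kw).
have [-> ->] := dz_normc2 ((a%:C)%C) e oO Op (CkS kw).
have d0 : dz e (dzbar e w) p = 0.
  rewrite (eq_dz oO e Op (Ck_dzbar oO e kw) (fun q => holo_dzbar e hw)).
  exact: dz_cst.
rewrite d0 (holo_dzbar e hw Op) !mul0r conjc0 !mulr0 !addr0 !add0r.
have n0 : w p * conjc (w p) + (a%:C)%C != 0 :> C.
  apply/negP => /eqP n0; have := r0 p Op.
  by rewrite n0 /= ltxx.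
rewrite (holo_log_identity _ _ n0) (r p Op) (normc2E (dz e w p)).
set x := complex.Re (w p * _ + _); set y := complex.Re (dz e w p) ^+ 2 + _.
have -> : (a%:C)%C * (y%:C)%C * ((x%:C)%C)^-1 ^+ 2 = ((a * y * x^-1 ^+ 2)%:C)%C :> C.
  by rewrite !expr2 !rmorphM /= fmorphV.
have y0 : 0 <= y by rewrite addr_ge0 ?sqr_ge0.
exact: (mulr_ge0 (mulr_ge0 (ltW a0) y0) (sqr_ge0 _)).
Qed.

Lemma log_identity (F : fieldType) (x xb d db e eb l lb : F) : x != 0 -> xb != 0 ->
  (l * xb + e * eb + (d * db + x * lb)) / (x * xb + 0) -
  (d * xb + x * eb) * (e * xb + x * db) / (x * xb + 0) ^+ 2 =
  (l / x - d * e / x ^+ 2) + (lb / xb - db * eb / xb ^+ 2).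
Proof. by move=> x0 xb0; rewrite !addr0; field; rewrite x0 xb0. Qed.

(** Formally log |w|^2 is log w plus its conjugate, whence twice a real part. The summand 0 makes
    this the case a = 0 of the regularised form. *)
Lemma log_laplace O (w : C -> C) e p : open O -> O p -> Ck 2 O w ->
  (forall q, O q -> w q != 0) ->
  complex.Re (dz e (dzbar e (rlog (fun q => w q * conjc (w q) + (0%:C)%C))) p) =
  2 * complex.Re (dz e (dzbar e w) p / w p - dz e w p * dzbar e w p / w p ^+ 2).
Proof.
move=> oO Op kw w0.
have r q : O q -> w q * conjc (w q) + (0%:C)%C =
    ((complex.Re (w q * conjc (w q) + (0%:C)%C))%:C)%C :> C.
  by move=> _; have [] := normc2_real (w q) (lexx 0).
have r0 q : O q -> 0 < complex.Re (w q * conjc (w q) + (0%:C)%C).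
  by move=> Oq; have [_ ] := normc2_real (w q) (lexx 0); apply; left; exact: w0.
have kn : Ck 2 O (fun q => w q * conjc (w q) + (0%:C)%C).
  exact: (CkD oO (CkM oO kw (Ck_conj oO kw)) (Ck_cst 2 _ oO)).
rewrite (laplace_rlog e oO Op kn r r0) (laplace_normc2w _ e oO Op kw).
have [-> ->] := dz_normc2 ((0%:C)%C) e oO Op (CkS kw).
have wp := w0 p Op.
have wpb : conjc (w p) != 0 by rewrite conjc_eq0.
rewrite (log_identity _ _ _ _ _ _ wp wpb).
have -> : conjc (dz e (dzbar e w) p) / conjc (w p) -
    conjc (dz e w p) * conjc (dzbar e w p) / conjc (w p) ^+ 2 =
    conjc (dz e (dzbar e w) p / w p - dz e w p * dzbar e w p / w p ^+ 2) :> C.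
  by rewrite conjB !conjM !conjc_inv !expr2 conjM.
by rewrite ReD ReJ mulr_natl mulr2n.
Qed.

Lemma Re_norm_sqr (x : C) : complex.Re `|x| ^+ 2 = complex.Re (x * conjc x).
Proof.
rewrite normc2E normc_def /= sqr_sqrtr // addr_ge0 ?sqr_ge0 //.
Qed.

Lemma Re_norm_ge0 (x : C) : 0 <= complex.Re `|x|.
Proof. by rewrite normc_def /= sqrtr_ge0. Qed.

Lemma Re_norm_gt0 (x : C) : x != 0 -> 0 < complex.Re `|x|.
Proof.
move=> /normc2_gt0; rewrite -Re_norm_sqr => x0.
by rewrite lt_neqAle Re_norm_ge0 andbT; apply: contraTN x0 => /eqP <-; rewrite expr0n ltxx.
Qed.

Lemma log_absE (x : C) : x != 0 ->
  log_abs x = (2^-1 * ln (complex.Re (x * conjc x + (0%:C)%C)))%:E.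
Proof.
move=> x0; have n0 := Re_norm_gt0 x0.
rewrite /log_abs lne_EFin // addr0 -Re_norm_sqr lnXn //.
by rewrite -[ln _ *+ 2]mulr_natl mulrA mulVf ?mul1r // pnatr_eq0.
Qed.

End LogLaplacian.

(** * Subharmonicity of log |w| for holomorphic w *)

Section Subharmonic.
Variable R : realType.
Local Notation C := (Cplx R).
Local Notation mu := (@lebesgue_measure R).
Implicit Types (O : set C) (z p : C) (r : R).

Lemma integral_primitive (F f : R -> R) (a b : R) : a < b -> continuous f ->
  (forall x : R, a <= x <= b -> is_derive x 1 F (f x)) ->
  (\int[mu]_(x in `[a, b]) (f x)%:E = (F b - F a)%:E)%E.
Proof.
move=> ab cf dF.
have cF (x : R) : a <= x <= b -> {for x, continuous F}.
  by move=> /dF[dx _]; apply/differentiable_continuous/derivable1_diffP.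
rewrite (@continuous_FTC2 _ f F) //.
- exact: continuous_subspaceT.
- split.
  + by move=> x; rewrite in_itv /= => /andP[xa xb]; have [] := dF x _; rewrite ?ltW.
  + by apply: cvg_at_right_filter; apply: cF; rewrite lexx ltW.
  + by apply: cvg_at_left_filter; apply: cF; rewrite lexx ltW.
- move=> x; rewrite in_itv /= => /andP[xa xb]; rewrite derive1E.
  by have [] := dF x _; rewrite ?ltW.
Qed.

Lemma primitive_exists (f : R -> R) (b : R) : continuous f ->
  exists F, forall x : R, 0 <= x <= b -> is_derive x 1 F (f x).
Proof.
move=> cf.
exists (fun x => \int[mu]_(t in [set` `[(-1)%R, x]]) f t)%R => x /andP[x0 xb].
have xb1 : x < b + 1 by lra.
have intf : mu.-integrable `[(-1)%R, b + 1] (EFin \o f).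
  apply: continuous_compact_integrable; first exact: segment_compact.
  exact: continuous_subspaceT.
have x1 : -1 < x by lra.
have [d1 d2] := @continuous_FTC1_closed R f (-1) x (b + 1) xb1 intf x1 (cf x).
by apply: DeriveDef; [exact: d1|rewrite -derive1E; exact: d2].
Qed.

Lemma rlog_submean O (w : C -> C) z r (a : R) (Phi : R -> R) : open O -> 0 < r -> 0 < a ->
  [set y | `|y - z| <= (r%:C)%C] `<=` O -> holomorphic O w ->
  let n q := w q * conjc (w q) + (a%:C)%C in
  continuous (on_circle (rlog n) z r) /\
  ((forall x : R, 0 <= x <= 4 * pi -> is_derive x 1 Phi (on_circle (rlog n) z r x)) ->
   2 * pi * ln (complex.Re (n z)) <= Phi (2 * pi) - Phi 0).
Proof.
move=> oO r0 a0 zO hw n; have kw := holo_Ck 2 hw.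
have n0 q : O q -> 0 < complex.Re (n q).
  by move=> _; have [_] := normc2_real (w q) (ltW a0); apply; right.
have kn : Ck 2 O n.
  exact: (CkD oO (CkM oO kw (Ck_conj oO kw)) (Ck_cst 2 _ oO)).
have kl := Ck_rlog oO n0 kn.
split; first exact: (continuous_on_circle (ltW r0) zO (CkS (CkS kl))).
apply: (submean (erefl (1 : C)) oO r0 zO kl) => p Op.
exact: (log_holo_laplace_ge0 _ oO Op a0 hw).
Qed.

(** The submean inequality holds for half of log(|w|^2 + eps), which is smooth, and passes to the
    limit by monotone convergence as eps decreases to 0. *)
Lemma subharmonic_log_holo O (w : C -> C) : open O -> holomorphic O w ->
  subharmonic O (fun t => log_abs (w t)).
Proof.
move=> oO hw; have kw := holo_Ck 2 hw; have pi0 := pi_gt0 R.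
have cw z : O z -> {for z, continuous w} by move=> Oz; exact: Ck_continuous kw Oz.
have pi20 : 0 < 2 * pi :> R by rewrite mulr_gt0.
split.
- move=> z _; rewrite /log_abs /=; case: ifP => _; [exact: ltNye|exact: ltry].
- move=> z m Oz.
  have cn : {for z, continuous (fun y => complex.Re (w y * conjc (w y)))}.
    apply: (@continuous_comp _ _ _ (fun y => w y * conjc (w y)) (@complex.Re R)).
      exact: (Ck_continuous (CkM oO kw (Ck_conj oO kw)) Oz).
    exact: continuous_Re.
  have E x : (log_abs x < m%:E)%E = (complex.Re (x * conjc x) < expR m ^+ 2).
    rewrite -Re_norm_sqr ltr_pXn2r ?nnegrE ?expR_ge0 ?Re_norm_ge0 //.
    rewrite /log_abs /=; case: ifPn => [n0|]; first by rewrite ltNye (le_lt_trans n0) // expR_gt0.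
    by rewrite -ltNge => n0; rewrite lte_fin -ltr_expR lnK.
  rewrite E => nz.
  have : \forall y \near z, complex.Re (w y * conjc (w y)) < expR m ^+ 2.
    by apply: (cvgr_lt _ cn).
  by apply: filterS => y; rewrite E.
move=> z r r0 zO.
have [wz|wz] := eqVneq (w z) 0.
  by rewrite {1}/log_abs wz normr0 /= lexx leNye.
pose W x := w (z + (r%:C)%C * expi x).
pose N x := complex.Re (W x * conjc (W x)).
pose eps (k : nat) : R := k.+1%:R^-1.
have eps0 k : 0 < eps k by rewrite invr_gt0 ltr0n.
have eps1 k : eps k <= 1 by rewrite invf_le1 ?ltr0n // ler1n.
have N0 x : 0 <= N x by rewrite /N -Re_norm_sqr sqr_ge0.
pose phi k := on_circle (rlog (fun q => w q * conjc (w q) + ((eps k)%:C)%C)) z r.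
have phiE k x : phi k x = ln (N x + eps k) by rewrite /phi /on_circle /rlog /= ReD.
have cphi k : continuous (phi k).
  by have [] := @rlog_submean O w z r (eps k) id oO r0 (eps0 k) zO hw.
have cN : continuous N.
  move=> x; apply: (continuous_cvg _ (@continuous_Re _ _)).
  have cW : {for x, continuous W}.
    apply: (@continuous_comp _ _ _ (fun x => z + (r%:C)%C * expi x) w).
      apply: cvgD; first exact: cvg_cst.
      by apply: cvgM; [exact: cvg_cst|exact: continuous_expi].
    exact/cw/(circle_sub x (ltW r0) zO).
  apply: cvgM; first exact: cW.
  by apply: (continuous_cvg _ (@continuous_conjc _ _)); exact: cW.
have [c _ Nmax] := @EVT_max R N 0 (2 * pi) (ltW pi20) (continuous_subspaceT cN).
(* Since [eps k <= 1], [M] bounds all the regularised functions on the circle; [M] minus them is a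
   nonnegative nondecreasing sequence. *)
pose M := 2^-1 * ln (N c + 1).
pose g k x := M - 2^-1 * phi k x.
have h2 : 0 < 2^-1 :> R by rewrite invr_gt0.
have g0 k x : x \in `[0, 2 * pi] -> 0 <= g k x.
  move=> /Nmax xc; rewrite subr_ge0 ler_pM2l // phiE ler_ln ?posrE ?ltr_wpDl //.
  exact: lerD.
have cg k : continuous (g k).
  by move=> x; apply: cvgB; [exact: cvg_cst|apply: cvgM; [exact: cvg_cst|exact: cphi]].
pose L := 2^-1 * ln (complex.Re (w z * conjc (w z) + (0%:C)%C)).
have intg k : (\int[mu]_(x in `[0%R, (2 * pi)%R]) (g k x)%:E <= (2 * pi * (M - L))%:E)%E.
  have [Phi dPhi] := @primitive_exists (phi k) (4 * pi) (cphi k).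
  have [_ /(_ dPhi) sm] := @rlog_submean O w z r (eps k) Phi oO r0 (eps0 k) zO hw.
  have dF (x : R) : 0 <= x <= 2 * pi ->
      is_derive x 1 (fun x => M * x - 2^-1 * Phi x) (g k x).
    move=> /andP[x0 xp].
    have dx : is_derive x 1 Phi (phi k x) by apply: dPhi; rewrite x0 (le_trans xp) //; lra.
    have d1 := is_deriveM (is_derive_cst M x (1 : R)) (is_derive_id x (1 : R)).
    have d2 := is_deriveM (is_derive_cst (2^-1 : R) x (1 : R)) dx.
    apply: (is_derive_eq (is_deriveB d1 d2)).
    by rewrite !scaler0 !addr0 /GRing.scale /= mulr1.
  rewrite (integral_primitive pi20 (cg k) dF).
  rewrite lee_fin mulr0 sub0r opprK.
  have : 2 * pi * L <= 2^-1 * (Phi (2 * pi) - Phi 0).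
    rewrite /L mulrCA ler_pM2l //; apply: le_trans sm.
    rewrite ler_pM2l // ReD [in leRHS]ReD /= addr0.
    have wp := normc2_gt0 wz.
    rewrite ler_ln; [by rewrite lerDl ltW|by rewrite posrE|].
    by rewrite posrE addr_gt0.
  have aux (P l m a b : R) : P * l <= 2^-1 * (a - b) ->
    m * P - 2^-1 * a + 2^-1 * b <= P * (m - l) by clear; lra.
  by move=> /aux => /(_ M) /le_trans; apply.
pose G x := (M%:E - log_abs (W x))%E.
have gG x : (g k x)%:E @[k --> \oo] --> G x.
  have [Wx|Wx] := eqVneq (W x) 0.
    rewrite /G /log_abs Wx normr0 /= lexx /= addey //.
    apply/cvgeryP/cvgryPge => A.
    have Nx : N x = 0 by rewrite /N Wx mul0r.
    exists (Num.truncn (expR (2 * (A - M)))) => //= k /= kA.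
    rewrite /g phiE Nx add0r /eps lnV ?posrE ?ltr0n // mulrN opprK.
    have : 2 * (A - M) <= ln k.+1%:R.
      rewrite -ler_expR lnK ?posrE ?ltr0n //.
      rewrite (le_trans (ltW (truncnS_gt _))) // ler_nat ltnS.
      exact: kA.
    lra.
  rewrite /G log_absE // -EFinB; apply: cvg_EFin; first by near=> k.
  apply: cvgB; first exact: cvg_cst.
  apply: cvgM; first exact: cvg_cst.
  have Nx : 0 < N x by exact: normc2_gt0.
  under eq_fun do rewrite phiE.
  rewrite addr0 -/(N x).
  have -> : ln (N x) = ln (N x + 0) by rewrite addr0.
  apply: (continuous_cvg _ (continuous_ln _)); first by rewrite addr0.
  apply: cvgD; first exact: cvg_cst.
  exact: cvg_harmonic.
have mg k : measurable_fun (`[0, 2 * pi]%classic : set R) ((fun x => (g k x)%:E) : R -> \bar R).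
  by apply/measurable_EFinP; apply: measurable_funTS; exact: continuous_measurable_fun.
have mG : measurable_fun (`[0, 2 * pi]%classic : set R) (G : R -> \bar R).
  by apply: (emeasurable_fun_cvg (fun k x => (g k x)%:E)) => // x _; exact: gG.
have mD : measurable (`[0, 2 * pi] : set R) by [].
have gnd x : `[0, 2 * pi]%classic x -> nondecreasing_seq (fun k => (g k x)%:E).
  move=> _ k l kl; rewrite lee_fin lerB // ler_pM2l // !phiE ler_ln ?posrE ?ltr_wpDl //.
  by rewrite lerD2l lef_pV2 ?posrE ?ltr0n // ler_nat.
have G0 x : `[0, 2 * pi]%classic x -> (0 <= G x)%E.
  move=> xD; apply: (cvge_ge _ (gG x)); near=> k.
  by rewrite lee_fin g0.
have intG : (\int[mu]_(x in `[0%R, (2 * pi)%R]) G x <= (2 * pi * (M - L))%:E)%E.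
  have gk0 k x : `[0, 2 * pi]%classic x -> (0 <= (g k x)%:E)%E.
    by move=> xD; rewrite lee_fin g0.
  have := @cvg_monotone_convergence _ _ _ mu _ mD (fun k x => (g k x)%:E) mg gk0 gnd.
  have -> : (\int[mu]_(x in `[0%R, (2 * pi)%R]) limn (fun k => (g k x)%:E) =
      \int[mu]_(x in `[0%R, (2 * pi)%R]) G x)%E.
    by apply: eq_integral => x _; apply/cvg_lim => //; exact: gG.
  by move=> cvgI; apply: (cvge_le _ cvgI); near=> k; exact: intg.
have I0 : (0 <= \int[mu]_(x in `[0%R, (2 * pi)%R]) G x)%E by apply: integral_ge0.
(* The bound on its integral makes [G] integrable, so the integral of [M - G] can be split although
   log |w| may be infinite at zeros on the circle. *)
have iG : mu.-integrable `[0, 2 * pi] G.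
  apply/integrableP; split => //.
  have -> : (\int[mu]_(x in `[0%R, (2 * pi)%R]) `|G x| =
      \int[mu]_(x in `[0%R, (2 * pi)%R]) G x)%E.
    by apply: eq_integral => x /set_mem xD; exact: gee0_abs (G0 x xD).
  exact: le_lt_trans intG (ltry _).
have iM : mu.-integrable `[0, 2 * pi] (fun=> M%:E).
  apply: continuous_compact_integrable; first exact: segment_compact.
  by apply: continuous_subspaceT => x; exact: cvg_cst.
have dM (x : R) : 0 <= x <= 2 * pi -> is_derive x 1 (fun x => M * x) M.
  move=> _; apply: (is_derive_eq (is_deriveM (is_derive_cst M x (1 : R)) (is_derive_id x (1 : R)))).
  by rewrite scaler0 addr0 /GRing.scale /= mulr1.
have cM : continuous (fun _ : R => M) by move=> x; exact: cvg_cst.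
have intM : (\int[mu]_(x in `[0%R, (2 * pi)%R]) M%:E = (M * (2 * pi))%:E)%E.
  by rewrite (integral_primitive pi20 cM dM) mulr0 subr0.
have -> : (\int[mu]_(th in `[0%R, (2 * pi)%R])
    log_abs (w (z + (r%:C)%C * (cos th +i* sin th)%C)%R) =
    \int[mu]_(x in `[0%R, (2 * pi)%R]) ((fun=> M%:E) \- G) x)%E.
  apply: eq_integral => x _; rewrite /G /= -/(expi x) -/(W x).
  by rewrite oppeB ?addeA -?EFinB ?subrr ?add0e //; case: (log_abs _).
rewrite (integralB (mu := mu) mD iM iG) intM.
rewrite log_absE // -/L.
move: I0 intG; case: (\int[mu]_(x in _) _)%E => [I| |] //.
rewrite !lee_fin => I0 IK; rewrite mulrC ler_pdivlMr //.
move: IK; rewrite mulrBr [M * _]mulrC [L * _]mulrC.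
by rewrite !lerBrDr addrC.
Unshelve. all: by end_near. Qed.

End Subharmonic.

(** * From subharmonicity of log |w| back to its Laplacian *)

Section LaplaceTest.
Variable R : realType.
Local Notation C := (Cplx R).
Local Notation mu := (@lebesgue_measure R).

Lemma open_neq0 (V : normedModType R[i]) (O : set V) (w : V -> C) k : open O -> Ck k O w ->
  open (O `&` [set q | w q != 0]).
Proof.
move=> oO kw; rewrite openE => q [Oq wq].
apply: filterI; first exact: open_nbhs_nbhs.
have cw := Ck_continuous kw Oq.
have oN : open [set x : C | x != 0].
  have -> : [set x : C | x != 0] = ~` [set 0].
    by apply/seteqP; split => x /=; [move/eqP|move/eqP].
  apply: closed_openC; apply: accessible_closed_set1.
  exact/hausdorff_accessible/norm_hausdorff.
exact: (cw _ (open_nbhs_nbhs (conj oN wq))).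
Qed.

(** If the Laplacian were negative at [z], it would stay below some [- kappa] nearby, and the mean
    of [u = 2 log |w|] over a small circle would fall below [u z]. *)
Lemma subharmonic_log_laplace (O : set C) (w : C -> C) (e z : C) : e = 1 ->
  open O -> O z -> Ck 2 O w -> w z != 0 ->
  subharmonic O (fun t => log_abs (w t)) ->
  0 <= complex.Re (dz e (dzbar e w) z / w z - dz e w z * dzbar e w z / w z ^+ 2).
Proof.
move=> e1 oO Oz kw wz [_ _ sub]; have pi0 := pi_gt0 R.
have pi20 : 0 < 2 * pi :> R by rewrite mulr_gt0.
rewrite leNgt; apply/negP => lt0.
pose O1 := O `&` [set q | w q != 0].
have oO1 : open O1 by exact: open_neq0 kw.
have kw1 : Ck 2 O1 w by apply: Ck_sub kw => q [].
have O1z : O1 z by split.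
pose n (q : C) : C := w q * conjc (w q) + (0%:C)%C.
have n0 q : O1 q -> 0 < complex.Re (n q).
  by move=> [_ wq]; have [_ ] := normc2_real (w q) (lexx 0); apply; left.
have kn : Ck 2 O1 n.
  exact: (CkD oO1 (CkM oO1 kw1 (Ck_conj oO1 kw1)) (Ck_cst 2 _ oO1)).
pose u := rlog n.
have ku : Ck 2 O1 u by exact: Ck_rlog.
pose lam q := complex.Re (dz e (dzbar e u) q).
have lamz : lam z < 0.
  rewrite /lam (log_laplace e oO1 O1z kw1) ?pmulr_rlt0 //.
  by move=> q [].
have [kappa kap0 kapz] : exists2 k : R, 0 < k & lam z < - k.
  exists (- lam z / 2); first by rewrite divr_gt0 // oppr_gt0.
  by move: lamz; clear; lra.
have clam : {for z, continuous lam}.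
  apply: (@continuous_comp _ _ _ (dz e (dzbar e u)) (@complex.Re R)); last exact: continuous_Re.
  exact: Ck_continuous (Ck_dz oO1 e (Ck_dzbar oO1 e ku)) O1z.
have : \forall q \near z, O1 q /\ lam q < - kappa.
  apply: filterS2 (open_nbhs_nbhs (conj oO1 O1z)) (cvgr_lt _ clam (- kappa) kapz) => //.
move=> [rho /= /gt0_Cplx[d d0 ->] dP].
pose O2 := ball z (d%:C)%C.
have oO2 : open O2 by apply: ball_open; rewrite ltcR.
have O2P q : O2 q -> O1 q /\ lam q < - kappa by exact: dP.
have ku2 : Ck 2 O2 u by apply: Ck_sub ku => q /O2P[].
pose r := d / 2; have r0 : 0 < r by rewrite divr_gt0.
have rd : r < d by rewrite ltr_pdivrMr // ltr_pMr ?ltr1n.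
have zO2 : [set y | `|y - z| <= (r%:C)%C] `<=` O2.
  by move=> q /= qr; rewrite /O2 /ball /= distrC (le_lt_trans qr) // ltcR.
pose sq (q : C) := (q - z) * conjc (q - z).
have ksq k : Ck k O2 sq.
  by exact: (Ck_sub (fun _ _ => I) (proj2 (laplace_normc2 z 0 e1) k)).
(* [v] still has nonnegative Laplacian on the small disk; its submean inequality gives the strict
   gap [kappa * r ^+ 2] between [u z] and the mean of [u]. *)
pose v q : C := (-1) * u q + ((- kappa)%:C)%C * sq q.
have kv : Ck 2 O2 v by exact: (CkD oO2 (CkZ _ oO2 ku2) (CkZ _ oO2 (ksq 2%N))).
have lapv q : O2 q -> 0 <= complex.Re (dz e (dzbar e v) q).
  move=> O2q.
  have k1 := Ck_dzbar oO2 e ku2; have k2 := Ck_dzbar oO2 e (ksq 2%N).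
  have E p : O2 p -> (-1) * dzbar e u p + ((- kappa)%:C)%C * dzbar e sq p = dzbar e v p.
    move=> O2p; rewrite (dzbarD e O2p (CkZ _ oO2 (CkS ku2)) (CkZ _ oO2 (ksq 1%N))).
    by rewrite (dzbarZ oO2 _ e O2p (CkS ku2)) (dzbarZ oO2 _ e O2p (ksq 1%N)).
  rewrite -(eq_dz oO2 e O2q (CkD oO2 (CkZ _ oO2 k1) (CkZ _ oO2 k2)) E).
  rewrite (dzD e O2q (CkZ _ oO2 k1) (CkZ _ oO2 k2)) (dzZ oO2 _ e O2q k1).
  rewrite (dzZ oO2 _ e O2q k2) (proj1 (laplace_normc2 z q e1)) mulN1r mulr1 ReD ReN /=.
  have [_ ] := O2P q O2q; rewrite -/(lam q); move: (lam q) => a; clear -a; lra.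
have cphi : continuous (on_circle u z r).
  exact: (continuous_on_circle (ltW r0) zO2 (CkS (CkS ku2))).
have [Phi dPhi] := @primitive_exists R _ (4 * pi) cphi.
have dPsi (x : R) : 0 <= x <= 4 * pi ->
    is_derive x 1 (fun x => - Phi x - kappa * r ^+ 2 * x) (on_circle v z r x).
  move=> /dPhi dx.
  have d1 := is_deriveM (is_derive_cst (kappa * r ^+ 2) x (1 : R)) (is_derive_id x (1 : R)).
  apply: (is_derive_eq (is_deriveB (is_deriveN dx) d1)).
  rewrite /on_circle /v ReD ReZ mulN1r ReN scaler0 addr0 /GRing.scale /= mulr1 mulNr.
  rewrite /sq [z + _]addrC addrK.
  have -> : (r%:C)%C * expi x * conjc ((r%:C)%C * expi x) = ((r ^+ 2)%:C)%C :> C.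
    by rewrite conjM conjc_real mulrACA expi_conj mulr1 -rmorphM -expr2.
  by [].
have := submean e1 oO2 r0 zO2 kv lapv dPsi.
rewrite {1}/v {1}/sq subrr mul0r mulr0 addr0 mulN1r ReN mulr0 subr0 => ineq1.
have zO : [set y | `|y - z| <= (r%:C)%C] `<=` O by move=> q /zO2 /O2P[[]].
have := sub z r r0 zO.
have -> : (\int[mu]_(th in `[0%R, (2 * pi)%R])
    log_abs (w (z + (r%:C)%C * (cos th +i* sin th)%C)%R) =
    \int[mu]_(x in `[0%R, (2 * pi)%R]) (2^-1 * on_circle u z r x)%:E)%E.
  apply: eq_integral => x _; rewrite -/(expi x) log_absE //.
  by have [[_ +] _] := O2P _ (circle_sub x (ltW r0) zO2).
have c2 : continuous (fun x => 2^-1 * on_circle u z r x).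
  by move=> x; apply: cvgM; [exact: cvg_cst|exact: cphi].
have d2 (x : R) : 0 <= x <= 2 * pi ->
    is_derive x 1 (fun x => 2^-1 * Phi x) (2^-1 * on_circle u z r x).
  move=> /andP[x0 xp].
  have dx : is_derive x 1 Phi (on_circle u z r x).
    by apply: dPhi; rewrite x0 (le_trans xp) //; move: pi0; clear; lra.
  apply: (is_derive_eq (is_deriveM (is_derive_cst (2^-1 : R) x (1 : R)) dx)).
  by rewrite scaler0 addr0.
rewrite (integral_primitive pi20 c2 d2) log_absE // -EFinM lee_fin -/(n z).
have -> : ln (complex.Re (n z)) = complex.Re (u z) by [].
rewrite -mulrBr mulrCA ler_pM2l ?invr_gt0 // mulrC ler_pdivlMr // mulrC => ineq2.
have : 0 < kappa * r ^+ 2 * (2 * pi) by rewrite !mulr_gt0 // exprn_gt0.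
move: ineq1 ineq2; rewrite mulrN; move: (kappa * r ^+ 2 * (2 * pi)) (2 * pi * complex.Re (u z)) => a b.
move: (Phi (2 * pi)) (Phi 0) => c f.
clear; lra.
Qed.

End LaplaceTest.

(** * Jets and Wronskians in coordinates *)

Lemma telescope2 (K : comPzRingType) (a b x y : K) :
  (a - b) * x + (x - y) * b = a * x - b * y.
Proof. by ring. Qed.

Section SmoothClosure.
Variables (R : realType) (V : normedModType R[i]) (O : set V) (e : V).
Hypothesis oO : open O.
Implicit Types g h : V -> Cplx R.

Lemma smooth_dz g : smooth O g -> smooth O (dz e g).
Proof. by move=> sg k; apply: (Ck_dz oO e); exact: sg. Qed.

Lemma smooth_dzbar g : smooth O g -> smooth O (dzbar e g).
Proof. by move=> sg k; apply: (Ck_dzbar oO e); exact: sg. Qed.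

Lemma smoothD g h : smooth O g -> smooth O h -> smooth O (fun q => g q + h q).
Proof. by move=> sg sh k; exact: (CkD oO (sg k) (sh k)). Qed.

Lemma smoothB g h : smooth O g -> smooth O h -> smooth O (fun q => g q - h q).
Proof. by move=> sg sh k; exact: (CkB oO (sg k) (sh k)). Qed.

Lemma smoothM g h : smooth O g -> smooth O h -> smooth O (fun q => g q * h q).
Proof. by move=> sg sh k; exact: (CkM oO (sg k) (sh k)). Qed.

Lemma smooth_cst (a : Cplx R) : smooth O (fun=> a).
Proof. by move=> k; exact: (Ck_cst k a oO). Qed.

Lemma smooth_sum (I : Type) (r : seq I) (g : I -> V -> Cplx R) :
  (forall i, smooth O (g i)) -> smooth O (fun q => \sum_(i <- r) g i q).
Proof. by move=> sg k; exact: (Ck_sum r oO (fun i => sg i k)). Qed.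

Lemma smooth_conj g : smooth O g -> smooth O (fun q => conjc (g q) : Cplx R).
Proof. by move=> sg k; exact: (Ck_conj oO (sg k)). Qed.

Lemma smooth_comp n (O' : set (CVec R n)) (g : CVec R n -> Cplx R) (f : V -> CVec R n) :
  open O' -> (forall t, O t -> O' (f t)) -> smooth O' g ->
  (forall j, smooth O (fun t => f t 0 j)) -> smooth O (fun t => g (f t)).
Proof. by move=> oO' fO sg sf k; exact: (Ck_comp oO' oO fO (sg k) (fun j => sf j k)). Qed.

Lemma dz_comp_holo n (O' : set (CVec R n)) (g : CVec R n -> Cplx R) (f : V -> CVec R n) p :
  open O' -> O' (f p) -> smooth O' g -> O p -> (forall j, holomorphic O (fun q => f q 0 j)) ->
  dz e (fun q => g (f q)) p =
    \sum_j dz (basis_vec j) g (f p) * dz e (fun q => f q 0 j) p.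
Proof.
move=> oO' Ofp sg Op hf.
rewrite (dz_comp e oO' Ofp (sg 1%N) Op (fun j => holo_Ck 1 (hf j))); apply: eq_bigr => j _.
have -> : conjc (dzbar e (fun q => f q 0 j) p) = 0.
  by rewrite (holo_dzbar e (hf j) Op) conjc0.
by rewrite mulr0 addr0.
Qed.

Lemma dzbar_comp_holo n (O' : set (CVec R n)) (g : CVec R n -> Cplx R) (f : V -> CVec R n) p :
  open O' -> O' (f p) -> smooth O' g -> O p -> (forall j, holomorphic O (fun q => f q 0 j)) ->
  dzbar e (fun q => g (f q)) p =
    \sum_j dzbar (basis_vec j) g (f p) * conjc (dz e (fun q => f q 0 j) p).
Proof.
move=> oO' Ofp sg Op hf.
rewrite (dzbar_comp e oO' Ofp (sg 1%N) Op (fun j => holo_Ck 1 (hf j))); apply: eq_bigr => j _.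
by rewrite (holo_dzbar e (hf j) Op) mulr0 add0r.
Qed.

End SmoothClosure.

Section Jets.
Variables (R : realType) (O : set (Cplx R)) (e : Cplx R).
Hypotheses (oO : open O) (O0 : O 0) (e1 : e = 1).
Local Notation C := (Cplx R).
Implicit Types (g h : C -> C) (m k : nat).

(** Vanishing to order [m] at 0, that is g = O(|t|^m), stated through the Wirtinger derivatives of
    order less than [m]; order estimates become algebra. *)
Fixpoint jet_zero m g : Prop :=
  if m is m'.+1 then [/\ g 0 = 0, jet_zero m' (dz e g) & jet_zero m' (dzbar e g)]
  else True.

Let smooth_dz := @smooth_dz R _ O e oO.
Let smooth_dzbar := @smooth_dzbar R _ O e oO.
Let smoothD := @smoothD R _ O oO.
Let smoothB := @smoothB R _ O oO.
Let smoothM := @smoothM R _ O oO.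
Let smooth_cst := @smooth_cst R _ O oO.
Let smooth_sum := @smooth_sum R _ O oO.
Let smooth_conj := @smooth_conj R _ O oO.

Lemma eq_jet_zero m g h : (forall q, O q -> g q = h q) -> smooth O g ->
  jet_zero m g -> jet_zero m h.
Proof.
elim: m g h => [//|m IH] g h gh sg [g0 Jd Jb]; split.
- by rewrite -gh.
- apply: IH Jd; last exact: smooth_dz.
  by move=> q Oq; exact: (eq_dz oO e Oq (sg 1%N) gh).
- apply: IH Jb; last exact: smooth_dzbar.
  by move=> q Oq; exact: (eq_dzbar oO e Oq (sg 1%N) gh).
Qed.

Lemma jet_zero_cst m : jet_zero m (fun=> 0).
Proof.
elim: m => [//|m IH]; split=> //.
  by apply: eq_jet_zero IH; [move=> q _; rewrite dz_cst|exact: smooth_cst].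
by apply: eq_jet_zero IH; [move=> q _; rewrite dzbar_cst|exact: smooth_cst].
Qed.

Lemma jet_zeroS m g : jet_zero m.+1 g -> jet_zero m g.
Proof.
elim: m g => [//|m IH] g [g0 Jd Jb].
by split=> //; exact: IH.
Qed.

Lemma jet_zero_le k m g : (k <= m)%N -> jet_zero m g -> jet_zero k g.
Proof.
elim: m => [|m IH]; first by rewrite leqn0 => /eqP ->.
rewrite leq_eqVlt => /predU1P[->//|]; rewrite ltnS => km /jet_zeroS; exact: IH.
Qed.

Lemma jet_zeroD m g h : smooth O g -> smooth O h -> jet_zero m g -> jet_zero m h ->
  jet_zero m (fun q => g q + h q).
Proof.
elim: m g h => [//|m IH] g h sg sh [g0 gd gb] [h0 hd hb]; split.
- by rewrite g0 h0 addr0.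
- apply: (@eq_jet_zero _ (fun q => dz e g q + dz e h q)).
  + by move=> q Oq; rewrite (dzD e Oq (sg 1%N) (sh 1%N)).
  + by apply: smoothD; exact: smooth_dz.
  + by apply: IH => //; exact: smooth_dz.
- apply: (@eq_jet_zero _ (fun q => dzbar e g q + dzbar e h q)).
  + by move=> q Oq; rewrite (dzbarD e Oq (sg 1%N) (sh 1%N)).
  + by apply: smoothD; exact: smooth_dzbar.
  + by apply: IH => //; exact: smooth_dzbar.
Qed.

Lemma jet_zeroM m g h : smooth O g -> smooth O h -> jet_zero m g ->
  jet_zero m (fun q => g q * h q).
Proof.
elim: m g h => [//|m IH] g h sg sh Jg; have Jg' := jet_zeroS Jg.
have [g0 gd gb] := Jg; split.
- by rewrite g0 mul0r.
- apply: (@eq_jet_zero _ (fun q => dz e g q * h q + g q * dz e h q)).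
  + by move=> q Oq; rewrite (dzM e Oq (sg 1%N) (sh 1%N)).
  + by apply: smoothD; apply: smoothM => //; exact: smooth_dz.
  + apply: jet_zeroD; [| | |].
    * by apply: smoothM => //; exact: smooth_dz.
    * by apply: smoothM => //; exact: smooth_dz.
    * by apply: IH => //; exact: smooth_dz.
    * by apply: IH => //; exact: smooth_dz.
- apply: (@eq_jet_zero _ (fun q => dzbar e g q * h q + g q * dzbar e h q)).
  + by move=> q Oq; rewrite (dzbarM e Oq (sg 1%N) (sh 1%N)).
  + by apply: smoothD; apply: smoothM => //; exact: smooth_dzbar.
  + apply: jet_zeroD; [| | |].
    * by apply: smoothM => //; exact: smooth_dzbar.
    * by apply: smoothM => //; exact: smooth_dzbar.
    * by apply: IH => //; exact: smooth_dzbar.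
    * by apply: IH => //; exact: smooth_dzbar.
Qed.

Lemma jet_zero_sum m (I : Type) (r : seq I) (g : I -> C -> C) :
  (forall i, smooth O (g i)) -> (forall i, jet_zero m (g i)) ->
  jet_zero m (fun q => \sum_(i <- r) g i q).
Proof.
move=> sg Jg; elim: r => [|i r IH].
  by under eq_fun do rewrite big_nil; exact: jet_zero_cst.
under eq_fun do rewrite big_cons.
by apply: jet_zeroD => //; exact: smooth_sum.
Qed.

Lemma jet_zero_conj m g : smooth O g -> jet_zero m g ->
  jet_zero m (fun q => conjc (g q) : C).
Proof.
elim: m g => [//|m IH] g sg [g0 gd gb]; split.
- by rewrite g0 conjc0.
- apply: (@eq_jet_zero _ (fun q => conjc (dzbar e g q) : C)).
  + by move=> q Oq; rewrite (dz_conj e Oq (sg 1%N)).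
  + by apply: smooth_conj; exact: smooth_dzbar.
  + by apply: IH => //; exact: smooth_dzbar.
- apply: (@eq_jet_zero _ (fun q => conjc (dz e g q) : C)).
  + by move=> q Oq; rewrite (dzbar_conj e Oq (sg 1%N)).
  + by apply: smooth_conj; exact: smooth_dz.
  + by apply: IH => //; exact: smooth_dz.
Qed.

(* The Taylor polynomial of [g] of order [m] at [0] is a multiple of [t^m]. *)
Definition jet_top m g : Prop := jet_zero m g /\ jet_zero m (dzbar e g).

Lemma jet_topW m g : jet_zero m.+1 g -> jet_top m g.
Proof. by move=> Jg; split; [exact: jet_zeroS|case: Jg]. Qed.

Lemma eq_jet_top m g h : (forall q, O q -> g q = h q) -> smooth O g ->
  jet_top m g -> jet_top m h.
Proof.
move=> gh sg [Jg Jb]; split; first exact: eq_jet_zero Jg.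
apply: eq_jet_zero Jb; last exact: smooth_dzbar.
by move=> q Oq; exact: (eq_dzbar oO e Oq (sg 1%N) gh).
Qed.

Lemma jet_topD m g h : smooth O g -> smooth O h -> jet_top m g -> jet_top m h ->
  jet_top m (fun q => g q + h q).
Proof.
move=> sg sh [g0 gb] [h0 hb]; split; first exact: jet_zeroD.
apply: (@eq_jet_zero _ (fun q => dzbar e g q + dzbar e h q)).
- by move=> q Oq; rewrite (dzbarD e Oq (sg 1%N) (sh 1%N)).
- by apply: smoothD; exact: smooth_dzbar.
- by apply: jet_zeroD => //; exact: smooth_dzbar.
Qed.

(** If g is a t^m up to order m + 1, then g h is a h(0) t^m up to the same order, whatever the
    smooth factor h. *)
Lemma jet_topM m g h : smooth O g -> smooth O h -> jet_top m g ->
  jet_top m (fun q => g q * h q).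
Proof.
move=> sg sh [g0 gb]; split; first exact: jet_zeroM.
apply: (@eq_jet_zero _ (fun q => dzbar e g q * h q + g q * dzbar e h q)).
- by move=> q Oq; rewrite (dzbarM e Oq (sg 1%N) (sh 1%N)).
- by apply: smoothD; apply: smoothM => //; exact: smooth_dzbar.
- apply: jet_zeroD; [| | |].
  + by apply: smoothM => //; exact: smooth_dzbar.
  + by apply: smoothM => //; exact: smooth_dzbar.
  + by apply: jet_zeroM => //; exact: smooth_dzbar.
  + by apply: jet_zeroM => //; exact: smooth_dzbar.
Qed.

Lemma jet_top_le k m g : (k <= m)%N -> jet_top m g -> jet_top k g.
Proof. by move=> km [Jg Jb]; split; exact: jet_zero_le km _. Qed.

Lemma jet_top_cst m : jet_top m (fun=> 0).
Proof. exact/jet_topW/jet_zero_cst. Qed.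

Lemma jet_top_sum m (I : Type) (r : seq I) (g : I -> C -> C) :
  (forall i, smooth O (g i)) -> (forall i, jet_top m (g i)) ->
  jet_top m (fun q => \sum_(i <- r) g i q).
Proof.
move=> sg Jg; elim: r => [|i r IH].
  by under eq_fun do rewrite big_nil; exact: jet_top_cst.
under eq_fun do rewrite big_cons.
by apply: jet_topD => //; exact: smooth_sum.
Qed.

Lemma jet_top_dz m g : smooth O g -> jet_top m.+1 g -> jet_top m (dz e g).
Proof.
move=> sg [[_ Jd _] [_ Jbd _]]; split=> //.
apply: eq_jet_zero Jbd; last exact/smooth_dz/smooth_dzbar.
by move=> q Oq; rewrite (dz_dzbar oO e e Oq (sg 2%N)).
Qed.

Lemma holo_pow k : holomorphic O (fun t : C => t ^+ k).
Proof.
have [hid _] := holo_id oO.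
elim: k => [|k IH].
  by under eq_fun do rewrite expr0; exact: holo_cst.
by apply: (eq_holo oO _ (holoM oO hid IH)) => q _; rewrite exprS.
Qed.

Lemma dz_pow k p : O p -> dz e (fun t : C => t ^+ k) p = k%:R * p ^+ k.-1.
Proof.
have [hid did] := holo_id oO; move=> Op.
elim: k => [|k IH].
  by under eq_fun do rewrite expr0; rewrite dz_cst mul0r.
under eq_fun do rewrite exprS.
rewrite (dzM e Op (holo_Ck 1 hid) (holo_Ck 1 (holo_pow k))) IH did e1 mul1r /=.
case: k {IH} => [|k]; first by rewrite mul0r mulr0 addr0 mul1r.
rewrite /= mulrCA -exprS -[in RHS]addn1 natrD mulrDl mul1r addrC.
by [].
Qed.

Lemma smooth_pow k : smooth O (fun t : C => t ^+ k).
Proof. by case: (holo_pow k). Qed.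

Lemma jet_zero_pow m k : (m <= k)%N -> jet_zero m (fun t : C => t ^+ k).
Proof.
elim: m k => [//|m IH] [//|k] mk; split.
- by rewrite exprS mul0r.
- apply: (@eq_jet_zero _ (fun t : C => t ^+ k * k.+1%:R)).
  + by move=> q Oq; rewrite dz_pow // mulrC.
  + by apply: smoothM; [exact: smooth_pow|exact: smooth_cst].
  + by apply: jet_zeroM; [exact: smooth_pow|exact: smooth_cst|exact: IH].
- apply: (@eq_jet_zero _ (fun=> 0)).
  + by move=> q Oq; rewrite (holo_dzbar e (holo_pow k.+1) Oq).
  + exact: smooth_cst.
  + exact: jet_zero_cst.
Qed.

Lemma jet_top_pow m k : (m <= k)%N -> jet_top m (fun t : C => t ^+ k).
Proof.
move=> mk; split; first exact: jet_zero_pow.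
apply: (@eq_jet_zero _ (fun=> 0)).
- by move=> q Oq; rewrite (holo_dzbar e (holo_pow k) Oq).
- exact: smooth_cst.
- exact: jet_zero_cst.
Qed.

(** By induction: the derivative of the difference splits into a difference of first derivatives of
    [g] along the two curves, of the same form, and a difference of velocities, small by
    hypothesis. *)
Lemma jet_zero_comp n (O' : set (CVec R n)) (g : CVec R n -> C) (f h : C -> CVec R n) m :
  open O' -> (forall t, O t -> O' (f t)) -> (forall t, O t -> O' (h t)) ->
  smooth O' g -> (forall j, holomorphic O (fun t => f t 0 j)) ->
  (forall j, holomorphic O (fun t => h t 0 j)) ->
  (forall j, jet_zero m (fun t => f t 0 j - h t 0 j)) ->
  jet_zero m (fun t => g (f t) - g (h t)).
Proof.
move=> oO' fO hO + hf hh; elim: m g => [//|m IH] g sg fh.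
have sf (k : 'I_n) := proj1 (hf k); have sh (k : 'I_n) := proj1 (hh k).
have sgf G : smooth O' G -> smooth O (fun t => G (f t)).
  by move=> sG; exact: (smooth_comp oO oO' fO sG sf).
have sgh G : smooth O' G -> smooth O (fun t => G (h t)).
  by move=> sG; exact: (smooth_comp oO oO' hO sG sh).
have sdz (k : 'I_n) : smooth O' (dz (basis_vec k) g) by move=> i; exact: (Ck_dz oO' _ (sg i.+1)).
have sdb (k : 'I_n) : smooth O' (dzbar (basis_vec k) g) by move=> i; exact: (Ck_dzbar oO' _ (sg i.+1)).
have fh' (k : 'I_n) : jet_zero m (fun t => f t 0 k - h t 0 k) by exact: jet_zeroS.
have fhd (k : 'I_n) : jet_zero m (fun t => dz e (fun s => f s 0 k) t - dz e (fun s => h s 0 k) t).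
  have [_ Jd _] := fh k.
  apply: eq_jet_zero Jd; last by apply: smooth_dz; exact: smoothB.
  by move=> q Oq; rewrite (dzB oO e Oq (sf k 1%N) (sh k 1%N)).
split.
- have -> : f 0 = h 0; last by rewrite subrr.
  by apply/rowP => k; have [/eqP] := fh k; rewrite subr_eq0 => /eqP.
- apply: (@eq_jet_zero _ (fun t => \sum_(k < n)
    ((dz (basis_vec k) g (f t) - dz (basis_vec k) g (h t)) * dz e (fun s => f s 0 k) t +
     (dz e (fun s => f s 0 k) t - dz e (fun s => h s 0 k) t) * dz (basis_vec k) g (h t)))).
  + move=> t Ot; rewrite (dzB oO e Ot (sgf g sg 1%N) (sgh g sg 1%N)).
    rewrite (dz_comp_holo e oO' (fO _ Ot) sg Ot hf).
    rewrite (dz_comp_holo e oO' (hO _ Ot) sg Ot hh) -sumrB.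
    by apply: eq_bigr => k _; exact: telescope2.
  + apply: smooth_sum => k; apply: smoothD; apply: smoothM.
    * by apply: smoothB; [exact: sgf|exact: sgh].
    * exact: smooth_dz.
    * by apply: smoothB; exact: smooth_dz.
    * exact: sgh.
  + apply: jet_zero_sum => k.
      apply: smoothD; apply: smoothM.
      * by apply: smoothB; [exact: sgf|exact: sgh].
      * exact: smooth_dz.
      * by apply: smoothB; exact: smooth_dz.
      * exact: sgh.
    apply: jet_zeroD.
    * apply: smoothM; first by apply: smoothB; [exact: sgf|exact: sgh].
      exact: smooth_dz.
    * apply: smoothM; first by apply: smoothB; exact: smooth_dz.
      exact: sgh.
    * apply: jet_zeroM; [|exact: smooth_dz|exact: IH].
      by apply: smoothB; [exact: sgf|exact: sgh].
    * apply: jet_zeroM; [|exact: sgh|exact: fhd].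
      by apply: smoothB; exact: smooth_dz.
- apply: (@eq_jet_zero _ (fun t => \sum_(k < n)
    ((dzbar (basis_vec k) g (f t) - dzbar (basis_vec k) g (h t)) *
      conjc (dz e (fun s => f s 0 k) t) +
     conjc (dz e (fun s => f s 0 k) t - dz e (fun s => h s 0 k) t) *
      dzbar (basis_vec k) g (h t)))).
  + move=> t Ot; rewrite (dzbarB oO e Ot (sgf g sg 1%N) (sgh g sg 1%N)).
    rewrite (dzbar_comp_holo e oO' (fO _ Ot) sg Ot hf).
    rewrite (dzbar_comp_holo e oO' (hO _ Ot) sg Ot hh) -sumrB.
    by apply: eq_bigr => k _; rewrite conjB; exact: telescope2.
  + apply: smooth_sum => k; apply: smoothD; apply: smoothM.
    * by apply: smoothB; [exact: sgf|exact: sgh].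
    * by apply: smooth_conj; exact: smooth_dz.
    * by apply: smooth_conj; apply: smoothB; exact: smooth_dz.
    * exact: sgh.
  + apply: jet_zero_sum => k.
      apply: smoothD; apply: smoothM.
      * by apply: smoothB; [exact: sgf|exact: sgh].
      * by apply: smooth_conj; exact: smooth_dz.
      * by apply: smooth_conj; apply: smoothB; exact: smooth_dz.
      * exact: sgh.
    apply: jet_zeroD.
    * apply: smoothM; first by apply: smoothB; [exact: sgf|exact: sgh].
      by apply: smooth_conj; exact: smooth_dz.
    * apply: smoothM; first by apply: smooth_conj; apply: smoothB; exact: smooth_dz.
      exact: sgh.
    * apply: jet_zeroM; [|by apply: smooth_conj; exact: smooth_dz|exact: IH].
      by apply: smoothB; [exact: sgf|exact: sgh].
    * apply: jet_zeroM; [|exact: sgh|].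
        by apply: smooth_conj; apply: smoothB; exact: smooth_dz.
      by apply: jet_zero_conj; [apply: smoothB; exact: smooth_dz|exact: fhd].
Qed.

End Jets.

(** * Wronskian fields in coordinates and their perturbation *)

Section WronskianFields.
Variables (R : realType) (n : nat) (e : Cplx R).
Hypothesis e1 : e = 1.
Local Notation C := (Cplx R).
Local Notation Cn := (CVec R n).
Variable G : 'I_n -> 'I_n -> 'I_n -> Cn -> C.
Implicit Types (c : C -> Cn) (O : set C).

(** The coefficients [G] are arbitrary, so that the recursion serves for the Christoffel symbols as
    well as for their holomorphic projective part. *)
Fixpoint wfield c (r : nat) : C -> Cn :=
  match r with
  | 0 => fun t => \row_k dz e (fun s => c s 0 k) t
  | r'.+1 => fun t => \row_k (dz e (fun s => wfield c r' s 0 k) t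
      + \sum_i \sum_j G i j k (c t) * dz e (fun s => c s 0 i) t * wfield c r' t 0 j)
  end.

(** Divided powers: differentiation lowers the index without creating a factor. *)
Definition monomial m (t : C) : C := (m`!%:R)^-1 * t ^+ m.

Lemma smooth_monomial O m : open O -> smooth O (monomial m).
Proof. by move=> oO; apply: (smoothM oO (smooth_cst oO _)); exact: smooth_pow. Qed.

Lemma dz_monomial O m t : open O -> O t -> dz e (monomial m.+1) t = monomial m t.
Proof.
move=> oO Ot; rewrite (dzZ oO _ e Ot (smooth_pow oO m.+1 1%N)) (dz_pow oO e1 _ Ot).
rewrite /monomial factS natrM invfM mulrACA mulVf ?mul1r //.
Qed.

Lemma jet_top_monomial O m k : open O -> O 0 -> (m <= k)%N -> jet_top e m (monomial k).
Proof.
move=> oO O0 mk.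
apply: (@eq_jet_top _ O e oO O0 _ (fun t => t ^+ k * (k`!%:R)^-1)).
- by move=> q _; rewrite mulrC.
- by apply: (smoothM oO); [exact: smooth_pow|exact: smooth_cst].
- apply: (@jet_topM _ O e oO O0); [exact: smooth_pow|exact: smooth_cst|].
  exact: (@jet_top_pow _ O e oO O0 e1).
Qed.

Section Perturbation.
Variables (O : set C) (O' : set Cn).
Hypotheses (oO : open O) (O0 : O 0) (oO' : open O').
Hypothesis sG : forall i j k, smooth O' (G i j k).

Definition curve_in c := (forall t, O t -> O' (c t)) /\
  (forall k, holomorphic O (fun t => c t 0 k)).

Lemma smooth_wfield c r k : curve_in c -> smooth O (fun t => wfield c r t 0 k).
Proof.
move=> [cO hc]; elim: r k => [|r IH] k.
  apply: (eq_smooth oO (g := dz e (fun s => c s 0 k))); first by move=> q _; rewrite mxE.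
  by case: (holo_dz oO e (hc k)).
apply: (eq_smooth oO (g := fun t => dz e (fun s => wfield c r s 0 k) t
      + \sum_i \sum_j G i j k (c t) * dz e (fun s => c s 0 i) t * wfield c r t 0 j)).
  by move=> q _; rewrite mxE.
apply: (smoothD oO); first exact: (smooth_dz e oO).
apply: (smooth_sum oO) => i; apply: (smooth_sum oO) => j.
apply: (smoothM oO); last exact: IH.
apply: (smoothM oO); last by case: (holo_dz oO e (hc i)).
exact: (smooth_comp oO oO' cO (sG i j k) (fun l => proj1 (hc l))).
Qed.

Lemma product_difference (K : comPzRingType) (a b x y u v : K) :
  (a - b) * (x * u) + ((x - y) * (b * u) + (u - v) * (b * y)) = a * x * u - b * y * v.
Proof. by ring. Qed.

Variables (c c' : C -> Cn) (y : Cn) (m : nat).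
Hypotheses (inc : curve_in c) (inc' : curve_in c').
Hypothesis cc' : forall t k, O t -> c' t 0 k = c t 0 k + y 0 k * monomial m.+1 t.

(* Perturbing the curve by [t ^ m.+1] changes the [r]-th field by [t ^ (m - r)] at leading order. *)
Lemma wfield_perturbation r d k : m = (r + d)%N ->
  jet_top e d.+1 (fun t => wfield c' r t 0 k - wfield c r t 0 k - y 0 k * monomial d t).
Proof.
have hc j := proj2 inc j; have hc' j := proj2 inc' j.
have dcc' j t : O t -> dz e (fun s => c' s 0 j) t =
    dz e (fun s => c s 0 j) t + y 0 j * monomial m t.
  move=> Ot; rewrite -(eq_dz oO e Ot _ (fun t => fun Ot => esym (@cc' t j Ot))); last first.
    exact: (CkD oO (holo_Ck 1 (hc j)) (CkZ _ oO (smooth_monomial m.+1 oO 1%N))).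
  rewrite (dzD e Ot (holo_Ck 1 (hc j)) (CkZ _ oO (smooth_monomial m.+1 oO 1%N))).
  rewrite (dzZ oO _ e Ot (smooth_monomial m.+1 oO 1%N)).
  by rewrite (dz_monomial m oO Ot).
have sw c0 r0 j : curve_in c0 -> smooth O (fun t => wfield c0 r0 t 0 j).
  by move=> ic0; exact: smooth_wfield.
have sm j d0 : smooth O (fun t => y 0 j * monomial d0 t).
  by apply: (smoothM oO (smooth_cst oO _)); exact: smooth_monomial.
have jm j d0 k0 : (d0 <= k0)%N -> jet_top e d0 (fun t => y 0 j * monomial k0 t).
  move=> dk; apply: (@eq_jet_top _ O e oO O0 _ (fun t => monomial k0 t * y 0 j)).
  - by move=> q _; rewrite mulrC.
  - by apply: (smoothM oO); [exact: smooth_monomial|exact: smooth_cst].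
  - apply: (@jet_topM _ O e oO O0); [exact: smooth_monomial|exact: smooth_cst|].
    exact: (jet_top_monomial oO O0 dk).
have sG' i j k0 c0 : curve_in c0 -> smooth O (fun t => G i j k0 (c0 t)).
  move=> [c0O hc0]; exact: (smooth_comp oO oO' c0O (sG i j k0) (fun l => proj1 (hc0 l))).
have sd c0 i : curve_in c0 -> smooth O (dz e (fun s => c0 s 0 i)).
  by move=> [_ hc0]; case: (holo_dz oO e (hc0 i)).
elim: r d k => [|r IH] d k md.
  apply: (@eq_jet_top _ O e oO O0 _ (fun=> 0)).
  - by move=> t Ot; rewrite /= !mxE dcc' // md add0n [_ + y 0 k * _]addrC addrK subrr.
  - exact: smooth_cst.
  - exact: (jet_top_cst e oO O0 d.+1).
pose D j t := wfield c' r t 0 j - wfield c r t 0 j.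
have sD j : smooth O (D j) by apply: (smoothB oO); exact: sw.
have sDm j : smooth O (fun t => D j t - y 0 j * monomial d.+1 t).
  by apply: (smoothB oO).
have IHd j : jet_top e d.+2 (fun t => D j t - y 0 j * monomial d.+1 t).
  by apply: IH; rewrite md addSnnS.
(* The change of the quadratic term is split according to its source: the coefficients ([A], order m
   + 1), the velocity ([B], order m) and the previous field ([E], order d + 1). All are of order at
   least d + 1, as d + 1 <= m. *)
pose A i j t := (G i j k (c' t) - G i j k (c t)) *
    (dz e (fun s => c' s 0 i) t * wfield c' r t 0 j).
pose B i j t := (dz e (fun s => c' s 0 i) t - dz e (fun s => c s 0 i) t) *
    (G i j k (c t) * wfield c' r t 0 j).
pose E i j t := D j t * (G i j k (c t) * dz e (fun s => c s 0 i) t).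
have sA i j : smooth O (A i j).
  apply: (smoothM oO); first by apply: (smoothB oO); exact: sG'.
  by apply: (smoothM oO); [exact: sd|exact: sw].
have sB i j : smooth O (B i j).
  apply: (smoothM oO); first by apply: (smoothB oO); exact: sd.
  by apply: (smoothM oO); [exact: sG'|exact: sw].
have sE i j : smooth O (E i j).
  by apply: (smoothM oO) => //; apply: (smoothM oO); [exact: sG'|exact: sd].
have sABE i j : smooth O (fun t => A i j t + (B i j t + E i j t)).
  by apply: (smoothD oO) => //; exact: (smoothD oO).
apply: (@eq_jet_top _ O e oO O0 _ (fun t => dz e (fun t => D k t - y 0 k * monomial d.+1 t) t
  + \sum_i \sum_j (A i j t + (B i j t + E i j t)))).
- move=> t Ot.
  rewrite (dzB oO e Ot (sD k 1%N) (sm k d.+1 1%N)) (dzZ oO _ e Ot (smooth_monomial d.+1 oO 1%N)).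
  rewrite (dz_monomial d oO Ot) (dzB oO e Ot (sw c' r k inc' 1%N) (sw c r k inc 1%N)).
  rewrite [wfield c' r.+1 _]/= [wfield c r.+1 _]/= !mxE.
  have -> : \sum_i \sum_j (A i j t + (B i j t + E i j t)) =
     \sum_i \sum_j G i j k (c' t) * dz e (fun s => c' s 0 i) t * wfield c' r t 0 j -
     \sum_i \sum_j G i j k (c t) * dz e (fun s => c s 0 i) t * wfield c r t 0 j.
    rewrite -sumrB; apply: eq_bigr => i _; rewrite -sumrB; apply: eq_bigr => j _.
    exact: product_difference.
  move: (\sum_i _) (\sum_i _) (dz e _ t) (dz e _ t) (y 0 k * _) => a b a' b' z.
  by rewrite addrAC opprD addrACA.
- apply: (smoothD oO); first exact: (smooth_dz e oO).
  by apply: (smooth_sum oO) => i; apply: (smooth_sum oO) => j.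
apply: (@jet_topD _ O e oO O0).
- exact: (smooth_dz e oO).
- by apply: (smooth_sum oO) => i; apply: (smooth_sum oO) => j.
- exact: (@jet_top_dz _ O e oO O0).
apply: (@jet_top_sum _ O e oO O0) => i; first by apply: (smooth_sum oO).
apply: (@jet_top_sum _ O e oO O0) => j; first by [].
have dm : (d.+1 <= m)%N by rewrite md addSn ltnS leq_addl.
apply: (@jet_topD _ O e oO O0) => //; first exact: (smoothD oO).
  apply: (@jet_topM _ O e oO O0).
  - by apply: (smoothB oO); exact: sG'.
  - by apply: (smoothM oO); [exact: sd|exact: sw].
  apply: jet_topW; apply: (@jet_zero_le _ e _ m.+1) => //.
  apply: (@jet_zero_comp _ O e oO O0 _ O') => //; [exact: (proj1 inc')|exact: (proj1 inc)|].
  move=> j0; apply: (@eq_jet_zero _ O e oO O0 _ (fun t => y 0 j0 * monomial m.+1 t)).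
  - by move=> t Ot; rewrite cc' // [_ + _ * _]addrC addrK.
  - exact: sm.
  - by case: (jm j0 m.+1 m.+1 (leqnn _)).
apply: (@jet_topD _ O e oO O0) => //.
  apply: (@jet_topM _ O e oO O0).
  - by apply: (smoothB oO); exact: sd.
  - by apply: (smoothM oO); [exact: sG'|exact: sw].
  apply: (@eq_jet_top _ O e oO O0 _ (fun t => y 0 i * monomial m t)).
  - by move=> t Ot; rewrite dcc' // [_ + _ * _]addrC addrK.
  - exact: sm.
  - exact: jm.
apply: (@jet_topM _ O e oO O0) => //.
  by apply: (smoothM oO); [exact: sG'|exact: sd].
apply: (@eq_jet_top _ O e oO O0 _ (fun t => (D j t - y 0 j * monomial d.+1 t)
   + y 0 j * monomial d.+1 t)).
- by move=> t _; rewrite subrK.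
- exact: (smoothD oO).
apply: (@jet_topD _ O e oO O0) => //.
- exact: (jet_top_le (leqnSn _)).
- exact: jm.
Qed.

Lemma wfield_perturbation0 r d k : m = (r + d)%N ->
  wfield c' r 0 0 k = wfield c r 0 0 k + (d == 0%N)%:R * y 0 k.
Proof.
move=> md; have [[+ _ _] _] := wfield_perturbation k md.
move=> /eqP; rewrite subr_eq0 subr_eq => /eqP ->; rewrite addrC; congr (_ + _).
rewrite mulrC /monomial; case: d {md} => [|d]; first by rewrite fact0 expr0 invr1 mulr1.
by rewrite exprS mul0r mulr0.
Qed.

End Perturbation.
End WronskianFields.

Lemma holo_sub (R : realType) (V : normedModType R[i]) (O O' : set V) g :
  O' `<=` O -> holomorphic O g -> holomorphic O' g.
Proof.
move=> OO [sg dg]; split; first by move=> k; exact: Ck_sub OO (sg k).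
by move=> v p /OO; exact: dg.
Qed.

Section JetDeterminant.
Variables (R : realType) (O : set (Cplx R)) (e : Cplx R).
Hypotheses (oO : open O) (O0 : O 0) (e1 : e = 1).
Local Notation C := (Cplx R).

Lemma smooth_prod (I : Type) (r : seq I) (g : I -> C -> C) :
  (forall i, smooth O (g i)) -> smooth O (fun q => \prod_(i <- r) g i q).
Proof. by move=> sg k; exact: (Ck_prod r oO (fun i => sg i k)). Qed.

Lemma jet_top_prod m (I : Type) (r : seq I) (g h : I -> C -> C) :
  (forall i, smooth O (g i)) -> (forall i, smooth O (h i)) ->
  (forall i, jet_top e m (fun t => g i t - h i t)) ->
  jet_top e m (fun t => \prod_(i <- r) g i t - \prod_(i <- r) h i t).
Proof.
move=> sg sh J; elim: r => [|i r IH].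
  apply: (@eq_jet_top _ O e oO O0 _ (fun=> 0)).
  - by move=> q _; rewrite !big_nil subrr.
  - exact: smooth_cst.
  - exact: (jet_top_cst e oO O0 m).
have sP := smooth_prod r sg; have sQ := smooth_prod r sh.
have s1 : smooth O (fun t => g i t - h i t) by exact: (smoothB oO).
have s2 := smoothB oO sP sQ.
apply: (@eq_jet_top _ O e oO O0 _ (fun t => (g i t - h i t) * \prod_(i <- r) g i t +
   (\prod_(i <- r) g i t - \prod_(i <- r) h i t) * h i t)).
- by move=> q _; rewrite !big_cons telescope2 [h i q * _]mulrC; congr (_ - _); rewrite mulrC.
- by apply: (smoothD oO); exact: (smoothM oO).
- apply: (@jet_topD _ O e oO O0).
  + exact: (smoothM oO).
  + exact: (smoothM oO).
  + exact: (@jet_topM _ O e oO O0).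
  + exact: (@jet_topM _ O e oO O0).
Qed.

Lemma smooth_det n (A : C -> 'M[C]_n) :
  (forall i j, smooth O (fun t => A t i j)) -> smooth O (fun t => \det (A t)).
Proof. by move=> sA k; exact: (Ck_det oO (fun i j => sA i j k)). Qed.

Lemma jet_top_det m n (A B : C -> 'M[C]_n) :
  (forall i j, smooth O (fun t => A t i j)) -> (forall i j, smooth O (fun t => B t i j)) ->
  (forall i j, jet_top e m (fun t => A t i j - B t i j)) ->
  jet_top e m (fun t => \det (A t) - \det (B t)).
Proof.
move=> sA sB J; rewrite /determinant.
have sPA (s : 'S_n) : smooth O (fun t => \prod_i A t i (s i)) by apply: smooth_prod.
have sPB (s : 'S_n) : smooth O (fun t => \prod_i B t i (s i)) by apply: smooth_prod.
have sd (s : 'S_n) := smoothB oO (sPA s) (sPB s).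
apply: (@eq_jet_top _ O e oO O0 _ (fun t => \sum_(s : 'S_n)
  (\prod_i A t i (s i) - \prod_i B t i (s i)) * (-1) ^+ s)).
- by move=> q _; rewrite -sumrB; apply: eq_bigr => s _; rewrite mulrBl ![_ * (-1) ^+ _]mulrC.
- by apply: (smooth_sum oO) => s; apply: (smoothM oO (sd s)); exact: smooth_cst.
- apply: (@jet_top_sum _ O e oO O0) => s.
    by apply: (smoothM oO (sd s)); exact: smooth_cst.
  apply: (@jet_topM _ O e oO O0 _ _ _ (sd s)); first exact: smooth_cst.
  by apply: jet_top_prod.
Qed.

(** The purpose of [jet_top]: [jet_zero e 2 h] alone would leave the mixed derivative
    undetermined. *)
Lemma jet_top2_zero h : smooth O h -> jet_top e 2 h ->
  [/\ h 0 = 0, dz e h 0 = 0, dzbar e h 0 = 0 & dz e (dzbar e h) 0 = 0].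
Proof. by move=> sh [[h0 [d0 _ _] [b0 _ _]] [_ [db _ _] _]]. Qed.

End JetDeterminant.

(** * The Wronskian determinant of a perturbed curve *)

Section WronskianTest.
Variables (R : realType) (n : nat) (e : Cplx R).
Hypothesis e1 : e = 1.
Local Notation C := (Cplx R).
Local Notation Cn := (CVec R n).
Variables (G : 'I_n -> 'I_n -> 'I_n -> Cn -> C) (O' : set Cn) (p : Cn).
Hypotheses (oO' : open O') (O'p : O' p).
Hypothesis sG : forall i j k, smooth O' (G i j k).
Local Notation wfield := (wfield e G).

Definition entire_curve (c : C -> Cn) :=
  c 0 = p /\ forall k, holomorphic setT (fun t => c t 0 k).

Lemma open_curve (c : C -> Cn) : entire_curve c -> open (c @^-1` O').
Proof.
move=> [_ hc]; rewrite openE => t O't.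
have cc : {for t, continuous c}.
  by apply: continuous_row => k; exact: (Ck_continuous (holo_Ck 0 (hc k))).
exact: (cc _ (open_nbhs_nbhs (conj oO' O't))).
Qed.

Definition shift_curve (c : C -> Cn) (y : Cn) m : C -> Cn :=
  fun t => \row_k (c t 0 k + y 0 k * monomial m.+1 t).

Lemma entire_shift c y m : entire_curve c -> entire_curve (shift_curve c y m).
Proof.
move=> [c0 hc]; split.
  by apply/rowP => k; rewrite mxE c0 /monomial exprS mul0r !mulr0 addr0.
have oT : open (@setT C) by exact: openT.
move=> k; apply: (eq_holo oT (g := fun t => c t 0 k + y 0 k * monomial m.+1 t)).
  by move=> t _; rewrite mxE.
apply: (holoD oT (hc k)); apply: (holoM oT (holo_cst oT _)).
by apply: (holoM oT (holo_cst oT _)); exact: holo_pow.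
Qed.

Lemma entire_curve_in c (O : set C) : entire_curve c -> O `<=` c @^-1` O' ->
  curve_in O O' c.
Proof.
move=> [_ hc] OO; split; first by move=> t; exact: OO.
by move=> k; apply: holo_sub (hc k).
Qed.

Lemma wfield_shift c y m r d k : entire_curve c -> m = (r + d)%N ->
  exists O : set C, [/\ open O, O 0, curve_in O O' c, curve_in O O' (shift_curve c y m) &
   jet_top e d.+1 (fun t => wfield (shift_curve c y m) r t 0 k - wfield c r t 0 k
     - y 0 k * monomial d t)] /\
  wfield (shift_curve c y m) r 0 0 k = wfield c r 0 0 k + (d == 0%N)%:R * y 0 k.
Proof.
move=> ec md; have es := entire_shift y m ec.
pose O := (c @^-1` O') `&` (shift_curve c y m @^-1` O').
have oO : open O by apply: openI; exact: open_curve.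
have O0 : O 0 by split; rewrite /= ?(proj1 ec) ?(proj1 es).
have ic : curve_in O O' c by apply: entire_curve_in => // t [].
have ic' : curve_in O O' (shift_curve c y m) by apply: entire_curve_in => // t [].
have cc' t j : O t -> shift_curve c y m t 0 j = c t 0 j + y 0 j * monomial m.+1 t.
  by rewrite mxE.
exists O; split; first by split=> //; exact: (wfield_perturbation e1 oO O0 oO' sG ic ic' cc').
exact: (wfield_perturbation0 e1 oO O0 oO' sG ic ic' cc').
Qed.

(** Triangular system: adding [y] times the monomial of degree [N.+1] moves the field of index [N]
    at 0 by exactly [y] and fixes the earlier ones. Fields are indexed from 0, so index [N] involves
    [N.+1] derivatives of the curve. *)
Lemma realize_wfield N (v : nat -> Cn) :
  exists2 c, entire_curve c & forall r, (r < N)%N -> wfield c r 0 = v r.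
Proof.
elim: N => [|N [c ec cv]].
  exists (fun=> p) => //; split=> // k; apply: holo_cst; exact: openT.
exists (shift_curve c (v N - wfield c N 0) N); first exact: entire_shift.
move=> r; rewrite ltnS leq_eqVlt => /predU1P[->|rN]; apply/rowP => k.
  have [_ [_ ->]] := wfield_shift (v N - wfield c N 0) k ec (esym (addn0 N)).
  by rewrite eqxx mul1r !mxE addrCA subrr addr0.
have [_ [_ ->]] := wfield_shift (v N - wfield c N 0) k ec (esym (subnKC (ltnW rN))).
by rewrite subn_eq0 leqNgt rN mul0r addr0 cv.
Qed.

Variable lst : 'I_n.
Hypotheses (lstE : lst.+1 = n :> nat) (n2 : (1 < n)%N).

Definition wmatrix c (t : C) : 'M[C]_n := \matrix_(r < n, k < n) wfield c r t 0 k.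
Definition wdet c (t : C) : C := \det (wmatrix c t).
Definition wcof c k (t : C) : C := cofactor (wmatrix c t) lst k.

Lemma wdetE c t : wdet c t = \sum_k wfield c lst t 0 k * wcof c k t.
Proof.
rewrite /wdet (expand_det_row _ lst); apply: eq_bigr => k _; by rewrite mxE.
Qed.

(** The product of a matrix with its adjugate: pairing a row other than the last with the last
    cofactors is a determinant with a repeated row. *)
Lemma wcof_row c t (r : 'I_n) :
  \sum_k wfield c r t 0 k * wcof c k t = (r == lst)%:R * wdet c t.
Proof.
have := congr1 (fun A : 'M[C]_n => A r lst) (mul_mx_adj (wmatrix c t)).
rewrite !mxE => E; transitivity (wdet c t *+ (r == lst)); last by rewrite mulr_natl.
rewrite -[RHS]E; apply: eq_bigr => k _; by rewrite !mxE.
Qed.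

Lemma smooth_wcof (O : set C) c k : open O -> curve_in O O' c -> smooth O (wcof c k).
Proof.
move=> oO ic; rewrite /wcof /cofactor; apply: (smoothM oO); first exact: smooth_cst.
apply: (smooth_det oO) => i j.
apply: (eq_smooth oO (g := fun t => wfield c (lift lst i) t 0 (lift k j))).
  by move=> t _; rewrite !mxE.
exact: (smooth_wfield e oO oO' sG).
Qed.

Lemma smooth_wdet (O : set C) c : open O -> curve_in O O' c -> smooth O (wdet c).
Proof.
move=> oO ic; apply: (smooth_det oO) => i j.
apply: (eq_smooth oO (g := fun t => wfield c i t 0 j)); first by move=> t _; rewrite mxE.
exact: (smooth_wfield e oO oO' sG).
Qed.

Lemma wcof_identity (K : comPzRingType) (a' a u ma b' b : K) :
  (a' - a - u * ma) * b' + (b' - b) * (a + u * ma) = a' * b' - a * b - ma * (u * b).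
Proof. by ring. Qed.

(** The degree n + 1 is one more than would move the last row at 0: the last row changes by [y]
    times t at leading order, the others from order two on. Hence the determinant changes by t times
    the pairing of [y] with the cofactors, up to a [jet_top e 2] error. *)
Lemma wdet_shift c y : entire_curve c -> let c' := shift_curve c y n in
  [/\ wdet c' 0 = wdet c 0,
      dz e (wdet c') 0 = dz e (wdet c) 0 + \sum_k y 0 k * wcof c k 0,
      dzbar e (wdet c') 0 = dzbar e (wdet c) 0 &
      dz e (dzbar e (wdet c')) 0 = dz e (dzbar e (wdet c)) 0 +
        \sum_k y 0 k * dzbar e (wcof c k) 0].
Proof.
move=> ec c'; have es : entire_curve c' := entire_shift y n ec.
pose O := (c @^-1` O') `&` (c' @^-1` O').
have oO : open O by apply: openI; exact: open_curve.
have O0 : O 0 by split; rewrite /= ?(proj1 ec) ?(proj1 es).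
have ic : curve_in O O' c by apply: entire_curve_in => // t [].
have ic' : curve_in O O' c' by apply: entire_curve_in => // t [].
have cc' t j : O t -> c' t 0 j = c t 0 j + y 0 j * monomial n.+1 t by rewrite mxE.
have pert r d k : n = (r + d)%N -> jet_top e d.+1
    (fun t => wfield c' r t 0 k - wfield c r t 0 k - y 0 k * monomial d t).
  exact: (wfield_perturbation e1 oO O0 oO' sG ic ic' cc').
have sw c0 r k : curve_in O O' c0 -> smooth O (fun t => wfield c0 r t 0 k).
  by move=> ic0; exact: (smooth_wfield e oO oO' sG).
have sC k := smooth_wcof k oO ic; have sC' k := smooth_wcof k oO ic'.
have sW := smooth_wdet oO ic; have sW' := smooth_wdet oO ic'.
have sm d : smooth O (monomial d) := smooth_monomial d oO.
have sym k d : smooth O (fun t => y 0 k * monomial d t).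
  by apply: (smoothM oO (smooth_cst oO _)); exact: sm.
(* For these rows the leading change is [y] times a monomial of degree n - r, at least 2. *)
have jlow r k : (r.+1 < n)%N -> jet_top e 2 (fun t => wfield c' r t 0 k - wfield c r t 0 k).
  move=> rn; have rd : n = (r + (n - r))%N by rewrite subnKC // ltnW // ltnW.
  have d2 : (2 <= n - r)%N by rewrite ltn_subRL addn1.
  apply: (@eq_jet_top _ O e oO O0 _ (fun t => (wfield c' r t 0 k - wfield c r t 0 k
    - y 0 k * monomial (n - r) t) + monomial (n - r) t * y 0 k)).
  - by move=> t _; rewrite [monomial _ _ * _]mulrC subrK.
  - apply: (smoothD oO); last by apply: (smoothM oO); [exact: sm|exact: smooth_cst].
    by apply: (smoothB oO) => //; apply: (smoothB oO); exact: sw.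
  - apply: (@jet_topD _ O e oO O0).
    + by apply: (smoothB oO) => //; apply: (smoothB oO); exact: sw.
    + by apply: (smoothM oO); [exact: sm|exact: smooth_cst].
    + by apply: jet_top_le (pert _ _ k rd); rewrite ltnW // ltnS.
    + apply: (@jet_topM _ O e oO O0); [exact: sm|exact: smooth_cst|].
      exact: (jet_top_monomial e1 oO O0 d2).
(* The cofactors along the last row involve only the rows covered by [jlow]. *)
have jC k : jet_top e 2 (fun t => wcof c' k t - wcof c k t).
  have sr c0 i j : curve_in O O' c0 ->
      smooth O (fun t => row' lst (col' k (wmatrix c0 t)) i j).
    move=> ic0; apply: (eq_smooth oO (g := fun t => wfield c0 (lift lst i) t 0 (lift k j))).
      by move=> t _; rewrite !mxE.
    exact: sw.
  have sD c0 : curve_in O O' c0 -> smooth O (fun t => \det (row' lst (col' k (wmatrix c0 t)))).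
    by move=> ic0; apply: (smooth_det oO) => i j; exact: sr.
  apply: (@eq_jet_top _ O e oO O0 _ (fun t => (\det (row' lst (col' k (wmatrix c' t))) -
     \det (row' lst (col' k (wmatrix c t)))) * (-1) ^+ (lst + k))).
  - by move=> t _; rewrite /wcof /cofactor mulrBl ![_ * (-1) ^+ _]mulrC.
  - apply: (smoothM oO); last exact: smooth_cst.
    by apply: (smoothB oO); exact: sD.
  - apply: (@jet_topM _ O e oO O0); [|exact: smooth_cst|].
      by apply: (smoothB oO); exact: sD.
    apply: (jet_top_det oO O0) => [i j|i j|i j]; [exact: sr|exact: sr|].
    apply: (@eq_jet_top _ O e oO O0 _ (fun t => wfield c' (lift lst i) t 0 (lift k j)
       - wfield c (lift lst i) t 0 (lift k j))).
    + by move=> t _; rewrite !mxE.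
    + by apply: (smoothB oO); exact: sw.
    + apply: jlow.
      have lti : (lift lst i < lst.+1)%N by rewrite lstE ltn_ord.
      move: lti; rewrite ltnS leq_eqVlt => /predU1P[/val_inj E|lti].
        by have := neq_lift lst i; rewrite E eqxx.
      by rewrite -[X in (_ < X)%N]lstE.
pose kap t := \sum_k y 0 k * wcof c k t.
have skk k : smooth O (fun t => y 0 k * wcof c k t).
  by apply: (smoothM oO (smooth_cst oO _)); exact: sC.
have skap : smooth O kap by exact: (smooth_sum oO _ skk).
have smk : smooth O (fun t => monomial 1 t * kap t) by exact: (smoothM oO (sm 1%N) skap).
(* The remainder; its [jet_top e 2] property yields the four equations at once. *)
pose h t := wdet c' t - wdet c t - monomial 1 t * kap t.
have sh : smooth O h by exact: (smoothB oO (smoothB oO sW' sW) smk).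
have jh : jet_top e 2 h.
  have s1 k : smooth O (fun t => wfield c' lst t 0 k - wfield c lst t 0 k - y 0 k * monomial 1 t).
    by apply: (smoothB oO) => //; apply: (smoothB oO); exact: sw.
  have s2 k : smooth O (fun t => wcof c' k t - wcof c k t) by exact: (smoothB oO).
  have s3 k : smooth O (fun t => wfield c lst t 0 k + y 0 k * monomial 1 t).
    by apply: (smoothD oO) => //; exact: sw.
  have s4 k := smoothM oO (s1 k) (sC' k); have s5 k := smoothM oO (s2 k) (s3 k).
  have s6 k := smoothD oO (s4 k) (s5 k).
  apply: (@eq_jet_top _ O e oO O0 _ (fun t => \sum_k
    ((wfield c' lst t 0 k - wfield c lst t 0 k - y 0 k * monomial 1 t) * wcof c' k t +
     (wcof c' k t - wcof c k t) * (wfield c lst t 0 k + y 0 k * monomial 1 t)))).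
  - move=> t _; rewrite /h !wdetE /kap mulr_sumr -!sumrB; apply: eq_bigr => k _.
    exact: wcof_identity.
  - exact: (smooth_sum oO _ s6).
  - apply: (@jet_top_sum _ O e oO O0) => k; first exact: s6.
    apply: (@jet_topD _ O e oO O0); [exact: s4|exact: s5| |].
      apply: (@jet_topM _ O e oO O0); [exact: s1|exact: sC'|].
      by apply: pert; rewrite addn1 lstE.
    by apply: (@jet_topM _ O e oO O0); [exact: s2|exact: s3|exact: jC].
have [h0 hd hb hdb] := jet_top2_zero sh jh.
have m0 : monomial 1 0 = 0 :> C by rewrite /monomial expr1 mulr0.
have md : dz e (@monomial R 1) 0 = 1.
  by rewrite (dz_monomial e1 0 oO O0) /monomial fact0 expr0 invr1 mulr1.
have hm : holomorphic O (@monomial R 1).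
  by apply: (holoM oO (holo_cst oO _)); exact: holo_pow.
have sWW := smoothB oO sW' sW.
have dmk : dz e (fun t => monomial 1 t * kap t) 0 = kap 0.
  by rewrite (dzM e O0 (sm 1%N 1%N) (skap 1%N)) m0 md mul1r mul0r addr0.
have bmk t : O t -> dzbar e (fun t => monomial 1 t * kap t) t = monomial 1 t * dzbar e kap t.
  move=> Ot; rewrite (dzbarM e Ot (sm 1%N 1%N) (skap 1%N)).
  by rewrite (holo_dzbar e hm Ot) mul0r add0r.
have skb := smooth_dzbar e oO skap.
split.
- by apply/eqP; rewrite -subr_eq0; move: h0; rewrite /h m0 mul0r subr0 => ->.
- have E : dz e h 0 = dz e (wdet c') 0 - dz e (wdet c) 0 - kap 0.
    transitivity (dz e (fun t => wdet c' t - wdet c t) 0 -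
      dz e (fun t => monomial 1 t * kap t) 0).
      exact: (dzB oO e O0 (sWW 1%N) (smk 1%N)).
    by rewrite dmk; congr (_ - _); exact: (dzB oO e O0 (sW' 1%N) (sW 1%N)).
  by move: hd; rewrite E => /eqP; rewrite subr_eq0 subr_eq addrC => /eqP.
- have E : dzbar e h 0 = dzbar e (wdet c') 0 - dzbar e (wdet c) 0 - 0.
    transitivity (dzbar e (fun t => wdet c' t - wdet c t) 0 -
      dzbar e (fun t => monomial 1 t * kap t) 0).
      exact: (dzbarB oO e O0 (sWW 1%N) (smk 1%N)).
    rewrite (bmk 0 O0) m0 mul0r; congr (_ - _).
    exact: (dzbarB oO e O0 (sW' 1%N) (sW 1%N)).
  by move: hb; rewrite E subr0 => /eqP; rewrite subr_eq0 => /eqP.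
- have kE : \sum_k y 0 k * dzbar e (wcof c k) 0 = dzbar e kap 0.
    rewrite (dzbar_sum oO _ e O0 (fun k => skk k 1%N)).
    by apply: eq_bigr => k _; rewrite (dzbarZ oO _ e O0 (sC k 1%N)).
  have sb1 := smooth_dzbar e oO sW'; have sb2 := smooth_dzbar e oO sW.
  have sb3 := smoothM oO (sm 1%N) skb; have sb := smoothB oO sb1 sb2.
  have E t : O t -> (dzbar e (wdet c') t - dzbar e (wdet c) t) - monomial 1 t * dzbar e kap t
      = dzbar e h t.
    move=> Ot; symmetry.
    transitivity (dzbar e (fun t => wdet c' t - wdet c t) t -
      dzbar e (fun t => monomial 1 t * kap t) t).
      exact: (dzbarB oO e Ot (sWW 1%N) (smk 1%N)).
    by rewrite (bmk t Ot); congr (_ - _); exact: (dzbarB oO e Ot (sW' 1%N) (sW 1%N)).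
  have F : dz e (dzbar e h) 0 = dz e (dzbar e (wdet c')) 0 - dz e (dzbar e (wdet c)) 0
      - dzbar e kap 0.
    rewrite -(eq_dz oO e O0 (smoothB oO sb sb3 1%N) E).
    transitivity (dz e (fun t => dzbar e (wdet c') t - dzbar e (wdet c) t) 0 -
      dz e (fun t => monomial 1 t * dzbar e kap t) 0).
      exact: (dzB oO e O0 (sb 1%N) (sb3 1%N)).
    congr (_ - _); first exact: (dzB oO e O0 (sb1 1%N) (sb2 1%N)).
    transitivity (dz e (@monomial R 1) 0 * dzbar e kap 0 + monomial 1 0 * dz e (dzbar e kap) 0).
      exact: (dzM e O0 (sm 1%N 1%N) (skb 1%N)).
    by rewrite m0 md mul1r mul0r addr0.
  by rewrite kE; move: hdb; rewrite F => /eqP; rewrite subr_eq0 subr_eq addrC => /eqP.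
Qed.

End WronskianTest.

(** * The local criterion *)

(** A real affine function bounded below has no linear part. *)
Lemma complex_affine_ge0 (R : realType) (a d : Cplx R) :
  (forall l : Cplx R, 0 <= complex.Re (a + l * d)) -> d = 0.
Proof.
move=> H; apply/eqP/negPn/negP => d0.
have n0 := normc2_gt0 d0; rewrite normc2E /= in n0.
pose N := complex.Re d ^+ 2 + complex.Im d ^+ 2.
(* With [l] equal to [- T] times the conjugate of [d], the real part becomes exactly -1. *)
pose T : R := (complex.Re a + 1) / N.
have := H (- (T%:C)%C * conjc d).
rewrite mulNr mulNr -mulrA [conjc d * d]mulrC normc2E -rmorphM ReD ReN /= -/N.
by rewrite /T divfK ?gt_eqF // opprD addNKr oppr_ge0 ler10.
Qed.

Lemma shift_ratio_identity (K : comPzRingType) (x1 x2 x3 x4 x5 l u v : K) :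
  x3 * u - x4 * x5 * v + l * (x1 * u - x2 * x5 * v) =
  (x3 + l * x1) * u - (x4 + l * x2) * x5 * v.
Proof. by ring. Qed.

(** * Quadratic maps parallel to the identity have no trace-free part *)

Section TracefreePart.
Variables (F : numFieldType) (n : nat).
Variable B : 'I_n -> 'I_n -> 'I_n -> F.
Hypothesis Bsym : forall i j k, B i j k = B j i k.
Hypothesis Bpar : forall (v : 'I_n -> F) a b,
  v a * (\sum_i \sum_j B i j b * v i * v j) = v b * (\sum_i \sum_j B i j a * v i * v j).

(** Vectors with at most two nonzero coordinates already determine [B] from the parallelism
    hypothesis. *)
Lemma quad_two (v : 'I_n -> F) a b k : a != b -> (forall i, i != a -> i != b -> v i = 0) ->
  \sum_i \sum_j B i j k * v i * v j =
  B a a k * v a * v a + 2 * B a b k * v a * v b + B b b k * v b * v b.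
Proof.
move=> ab v0.
have S (f : 'I_n -> F) : (forall i, i != a -> i != b -> f i = 0) -> \sum_i f i = f a + f b.
  move=> f0; rewrite (bigD1 a) //= (bigD1 b) /=; last by rewrite eq_sym.
  by rewrite big1 ?addr0 // => i /andP[ia ib]; rewrite f0.
rewrite S; last by move=> i ia ib; rewrite big1 // => j _; rewrite v0 ?mulr0 ?mul0r.
rewrite S; last by move=> j ja jb; rewrite (v0 j) ?mulr0.
rewrite S; last by move=> j ja jb; rewrite (v0 j) ?mulr0.
by rewrite (Bsym b a); ring.
Qed.

Lemma diag_off a k : k != a -> B a a k = 0.
Proof.
move=> ka.
have ak : a != k by rewrite eq_sym.
have := Bpar (fun i => (i == a)%:R) a k.
rewrite !(quad_two _ ak); first last.
- by move=> i ia ik; rewrite (negPf ia).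
- by move=> i ia ik; rewrite (negPf ia).
by rewrite eqxx (negPf ka) !mulr0 !addr0 !mulr1 mul1r mul0r.
Qed.

(** Test vector e_a + e_b, whose k-th coordinate is 0; the diagonal terms are gone by [diag_off]. *)
Lemma cross_off a b k : a != b -> k != a -> k != b -> B a b k = 0.
Proof.
move=> ab ka kb.
have := Bpar (fun i => (i == a)%:R + (i == b)%:R) a k.
rewrite !(quad_two _ ab); first last.
- by move=> i ia ib; rewrite (negPf ia) (negPf ib) addr0.
- by move=> i ia ib; rewrite (negPf ia) (negPf ib) addr0.
rewrite !eqxx (negPf ka) (negPf kb) (negPf ab) [b == a]eq_sym (negPf ab).
rewrite !addr0 !add0r !mulr1 mul1r mul0r !diag_off // addr0 add0r.
by move=> /eqP; rewrite mulf_eq0 pnatr_eq0 /= => /eqP.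
Qed.

(** Test vectors e_a + e_b and e_a - e_b: subtracting the two conditions eliminates the terms B b b
    b and B a b a. *)
Lemma cross_diag a b : a != b -> B a b b = 2^-1 * B a a a.
Proof.
move=> ab; have ba : b != a by rewrite eq_sym.
pose v (s : F) i : F := (i == a)%:R + s * (i == b)%:R.
have v0 s i : i != a -> i != b -> v s i = 0.
  by move=> ia ib; rewrite /v (negPf ia) (negPf ib) mulr0 addr0.
have va s : v s a = 1 by rewrite /v eqxx (negPf ab) mulr0 addr0.
have vb s : v s b = s by rewrite /v eqxx (negPf ba) mulr1 add0r.
have E s := Bpar (v s) a b.
have := E 1; have := E (-1).
rewrite !(quad_two _ ab) ?va ?vb; try exact: v0.
rewrite !(diag_off ba) !(diag_off ab) => e1 e2.
have : 4 * B a b b = 2 * B a a a.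
  transitivity ((1 * (0 * 1 * 1 + 2 * B a b b * 1 * 1 + B b b b * 1 * 1)) -
    (1 * (0 * 1 * 1 + 2 * B a b b * 1 * -1 + B b b b * -1 * -1))); first by ring.
  by rewrite e1 e2; ring.
move=> E4; apply: (@mulfI _ 4); first by rewrite pnatr_eq0.
rewrite E4 mulrA; congr (_ * _).
by rewrite (_ : 4 = 2 * 2) ?mulfK ?pnatr_eq0 // -natrM.
Qed.

(** The preceding lemmas give B(v, v) = b(v) v for the linear form with coefficients [B a a a]. Such
    a [B] has traces (n + 1) b / 2, which the projective normalisation subtracts entirely. *)
Lemma tracefree_part_eq0 i j k : B i j k
  - (n.+1%:R)^-1 * ((k == i)%:R * (\sum_l B l j l) + (k == j)%:R * (\sum_l B l i l)) = 0.
Proof.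
pose b a := B a a a.
have BE i' j' k' : B i' j' k' = 2^-1 * ((k' == j')%:R * b i' + (k' == i')%:R * b j').
  have [<-|ij] := eqVneq i' j'.
    have [->|ki] := eqVneq k' i'; last by rewrite (diag_off ki) !mul0r addr0 mulr0.
    by rewrite ?eqxx !mul1r -mulr2n -[b i' *+ 2]mulr_natl mulrA mulVf ?mul1r // pnatr_eq0.
  have [->|kj] := eqVneq k' j'.
    by rewrite (cross_diag ij) mul1r eq_sym (negPf ij) mul0r addr0.
  have [->|ki] := eqVneq k' i'; last by rewrite (cross_off ij ki kj) !mul0r addr0 mulr0.
  by rewrite Bsym (cross_diag _) ?mul1r ?mul0r ?add0r // eq_sym.
have tr j' : \sum_l B l j' l = 2^-1 * (n.+1%:R * b j').
  transitivity (\sum_l 2^-1 * ((l == j')%:R * b l + b j')).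
    by apply: eq_bigr => l _; rewrite BE eqxx mul1r.
  rewrite -mulr_sumr big_split /= sumr_const card_ord; congr (_ * _).
  rewrite (bigD1 j') //= big1 ?eqxx ?mul1r ?addr0.
    by rewrite -[b j' *+ n]mulr_natl -natr1 mulrDl mul1r addrC.
  by move=> l lj; rewrite (negPf lj) mul0r.
have n0 : (n.+1%:R : F) != 0 by rewrite pnatr_eq0.
rewrite !tr BE; move: (b i) (b j) (k == i)%:R (k == j)%:R n0 => x y u w.
move: (n.+1%:R) => N N0; have h2 : (2 : F) != 0 by rewrite pnatr_eq0.
by field; rewrite N0.
Qed.

End TracefreePart.

Lemma det_mx2 (K : comNzRingType) (A : 'M[K]_2) :
  \det A = A 0 0 * A 1 1 - A 0 1 * A 1 0.
Proof.
rewrite (expand_det_row _ 0) !big_ord_recl big_ord0 addr0 /cofactor !det_mx11 !mxE /=.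
rewrite expr0 mul1r expr1 mulN1r mulrN.
congr (A _ _ * A _ _ - A _ _ * A _ _); exact: val_inj.
Qed.

Lemma sum_delta (K : pzRingType) n (l : 'I_n) (f : 'I_n -> K) :
  \sum_m (m == l)%:R * f m = f l.
Proof.
rewrite (bigD1 l) //= big1 ?addr0 => [|m ml]; last by rewrite (negPf ml) mul0r.
by rewrite eqxx mul1r.
Qed.

(** * Positivity forces the projective symbols to be holomorphic at a point *)

Section LocalConclusion.
Variables (R : realType) (n : nat) (e : Cplx R).
Hypothesis e1 : e = 1.
Local Notation C := (Cplx R).
Local Notation Cn := (CVec R n).
Variables (G : 'I_n -> 'I_n -> 'I_n -> Cn -> C) (O' : set Cn) (p : Cn).
Hypotheses (oO' : open O') (O'p : O' p).
Hypothesis sG : forall i j k, smooth O' (G i j k).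
Hypothesis symG : forall i j k z, O' z -> G i j k z = G j i k z.
Hypothesis n2 : (2 <= n)%N.
Local Notation wfield := (wfield e G).
Local Notation wdet := (wdet e G).

Hypothesis positive : forall c, entire_curve p c -> wdet c 0 != 0 ->
  0 <= complex.Re (dz e (dzbar e (wdet c)) 0 / wdet c 0
                   - dz e (wdet c) 0 * dzbar e (wdet c) 0 / wdet c 0 ^+ 2).

Let n_gt0 : (0 < n)%N. Proof. exact: ltnW. Qed.
Let lst : 'I_n := Ordinal (etrans (congr1 (leq^~ n) (prednK n_gt0)) (leqnn n)).
Let fst : 'I_n := Ordinal n_gt0.

Let lstE : lst.+1 = n :> nat. Proof. exact: prednK. Qed.

(* Adding [l *: basis_vec k] to the last Wronskian field at [0] keeps [wdet] and makes the
   Laplacian of its logarithm affine in [l]; positivity for all [l] kills the linear part. *)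
Lemma dzbar_wcof c k : entire_curve p c -> wdet c 0 != 0 ->
  dzbar e (wcof e G lst c k) 0 = wcof e G lst c k 0 * dzbar e (wdet c) 0 / wdet c 0.
Proof.
move=> ec w0.
pose a := dz e (dzbar e (wdet c)) 0 / wdet c 0
                   - dz e (wdet c) 0 * dzbar e (wdet c) 0 / wdet c 0 ^+ 2.
pose d := dzbar e (wcof e G lst c k) 0 / wdet c 0
  - wcof e G lst c k 0 * dzbar e (wdet c) 0 / wdet c 0 ^+ 2.
have d0 : d = 0.
  apply: (@complex_affine_ge0 R a) => l.
  pose y : Cn := l *: delta_mx 0 k.
  have yE (f : 'I_n -> C) : \sum_j y 0 j * f j = l * f k.
    rewrite (bigD1 k) //= big1 ?addr0 => [|j jk]; rewrite !mxE eqxx /=.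
      by rewrite eqxx mulr1.
    by rewrite (negPf jk) mulr0 mul0r.
  have [s0 sd sb sdb] := wdet_shift e1 oO' O'p sG lstE y ec.
  have := positive (entire_shift y n ec).
  rewrite s0 => /(_ w0); rewrite sd sb sdb !yE /a /d.
  move: (dz e (dzbar e (wdet c)) 0) (dz e (wdet c) 0) (dzbar e (wdet c) 0) (wdet c 0).
  move: (dzbar e (wcof e G lst c k) 0) (wcof e G lst c k 0).
  move=> x1 x2 x3 x4 x5 x6 H.
  have -> : x3 / x6 - x4 * x5 / x6 ^+ 2 + l * (x1 / x6 - x2 * x5 / x6 ^+ 2) =
    (x3 + l * x1) / x6 - (x4 + l * x2) * x5 / x6 ^+ 2; last exact: H.
  exact: shift_ratio_identity.
move: d0 => /eqP; rewrite subr_eq0 => /eqP d0.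
apply: (@mulIf _ (wdet c 0)^-1); first by rewrite invr_eq0.
by rewrite d0 expr2 invfM !mulrA.
Qed.

Definition dbar_quad (l k : 'I_n) (v : Cn) : C :=
  \sum_i \sum_j dzbar (basis_vec l) (G i j k) p * v 0 i * v 0 j.

(** The value of dbar F_2 at [p] along any curve with F_1 = [v]; see [dzbar_wfield1]. *)
Definition dbar_accel (v : Cn) : Cn :=
  \row_k \sum_l conjc (v 0 l) * dbar_quad l k v.

(** The velocity and its derivative are holomorphic, so dbar falls only on the coefficients [G]
    along the curve and brings out the conjugate velocity. *)
Lemma dzbar_wfield1 c k : entire_curve p c ->
  dzbar e (fun t => wfield c 1 t 0 k) 0 = dbar_accel (wfield c 0 0) 0 k.
Proof.
move=> ec; have [c0 hc] := ec.
pose O := c @^-1` O'; have oO : open O := open_curve oO' ec.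
have O0 : O 0 by rewrite /O /= c0.
have hO j : holomorphic O (fun t => c t 0 j) by apply: holo_sub (hc j).
have hd j := holo_dz oO e (hO j).
have sg i j : smooth O (fun t => G i j k (c t)).
  by apply: (smooth_comp oO oO' _ (sG i j k)) => // l; case: (hO l).
pose H i j t := G i j k (c t) * (dz e (fun s => c s 0 i) t * dz e (fun s => c s 0 j) t).
have hdd i j := holoM oO (hd i) (hd j).
have sH i j : smooth O (H i j) by exact: (smoothM oO (sg i j) (proj1 (hdd i j))).
have sHi i : smooth O (fun t => \sum_j H i j t) by exact: (smooth_sum oO _ (sH i)).
have sHH : smooth O (fun t => \sum_i \sum_j H i j t) by exact: (smooth_sum oO _ sHi).
have hdk := holo_dz oO e (hd k).
have E t : O t -> dz e (dz e (fun s => c s 0 k)) t + \sum_i \sum_j H i j t =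
    wfield c 1 t 0 k.
  move=> Ot; rewrite [wfield c 1]/= [RHS]mxE; congr (_ + _).
    by congr (dz e _ t); apply/funext => s; rewrite mxE.
  by apply: eq_bigr => i _; apply: eq_bigr => j _; rewrite /H !mxE mulrA.
rewrite -(eq_dzbar oO e O0 (smoothD oO (proj1 hdk) sHH 1%N) E).
rewrite (dzbarD e O0 (proj1 hdk 1%N) (sHH 1%N)) (holo_dzbar e hdk O0) add0r.
rewrite (dzbar_sum oO _ e O0 (fun i => sHi i 1%N)) mxE.
transitivity (\sum_i \sum_j \sum_l conjc (wfield c 0 0 0 l) *
  (dzbar (basis_vec l) (G i j k) p * wfield c 0 0 0 i * wfield c 0 0 0 j)).
  apply: eq_bigr => i _; rewrite (dzbar_sum oO _ e O0 (fun j => sH i j 1%N)).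
  apply: eq_bigr => j _.
  have EH := dzbarM e O0 (sg i j 1%N) (holo_Ck 1 (hdd i j)).
  rewrite (holo_dzbar e (hdd i j) O0) mulr0 addr0 in EH.
  rewrite EH.
  rewrite (dzbar_comp e oO' _ (sG i j k 1%N) O0 (fun l => holo_Ck 1 (hO l))) ?c0 //.
  rewrite mulr_suml; apply: eq_bigr => l _.
  by rewrite (holo_dzbar e (hO l) O0) mulr0 add0r /= !mxE mulrAC mulrC !mulrA.
rewrite (eq_bigr _ (fun i _ => exchange_big _ _ _ _ _ _)) exchange_big /=.
apply: eq_bigr => l _; rewrite mulr_sumr; apply: eq_bigr => i _.
by rewrite mulr_sumr.
Qed.

(* Otherwise some curve has first field [v] and last field [dbar_accel v]; expanding [dzbar]
   of a determinant with the row [wfield c 1] repeated (or of [wdet] itself when [n = 2])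
   along the last row then gives [wdet c 0 = 0]. *)
Lemma dbar_accel_parallel (v : Cn) a b :
  v 0 a * dbar_accel v 0 b = v 0 b * dbar_accel v 0 a.
Proof.
apply/eqP/negPn/negP => ab; set w := dbar_accel v in ab *.
have fl : lst != fst by rewrite -val_eqE /= -lt0n -ltnS prednK.
(* An invertible matrix with first row [v] and last row [w]. *)
pose U : 'M[C]_(2, n) := \matrix_(i < 2, j < n) ((if i == 0 then fst else lst) == j)%:R.
pose g : 'M[C]_n := \matrix_(i, j) (if i == fst then v 0 j else w 0 j).
have Ug (i : 'I_2) j (h : 'M[C]_n) : (U *m h) i j = h (if i == 0 then fst else lst) j.
  rewrite mxE (bigD1 (if i == 0 then fst else lst)) //= mxE eqxx mul1r big1 ?addr0 // => k kn.
  by rewrite mxE eq_sym (negPf kn) mul0r.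
have free : row_free (U *m g).
  pose N : 'M[C]_(n, 2) := \matrix_(j < n, i < 2) ((if i == 0 then a else b) == j)%:R.
  have UgN (i k : 'I_2) : (U *m g *m N) i k =
      (U *m g) i (if k == 0 then a else b).
    rewrite mxE (bigD1 (if k == 0 then a else b)) //= [X in _ * X]mxE eqxx mulr1 big1 ?addr0 // => j kn.
    by rewrite [X in _ * X]mxE eq_sym (negPf kn) mulr0.
  have uN : U *m g *m N \in unitmx.
    have gv j : g fst j = v 0 j by rewrite mxE eqxx.
    have gw j : g lst j = w 0 j by rewrite mxE (negPf fl).
    rewrite unitmxE unitfE det_mx2 !UgN !Ug [0 == 0]eqxx [1 == 0]/= !gv !gw.
    by rewrite subr_eq0.
  rewrite /row_free eqn_leq rank_leq_row /=.
  by rewrite -{1}(mxrank_unit uN) mxrankM_maxl.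
have rankU : \rank (U *m g) = \rank U.
  by apply/eqP; rewrite eqn_leq mxrankM_maxl (eqP free) rank_leq_row.
have [A uA UA] := complete_unitmx rankU.
have Af : row fst A = v.
  apply/rowP => j; have := congr1 (fun M : 'M[C]_(2, n) => M ord0 j) UA.
  rewrite !Ug eqxx => UAj.
  by rewrite [LHS]mxE -UAj mxE eqxx.
have Al : row lst A = w.
  apply/rowP => j; have := congr1 (fun M : 'M[C]_(2, n) => M (lift ord0 ord0) j) UA.
  rewrite !Ug [_ == 0]/= => UAj.
  by rewrite [LHS]mxE -UAj mxE (negPf fl).
have [c ec cE] := realize_wfield e1 oO' O'p sG n
  (fun r => if insub r is Some i then row i A else 0).
have rowE (i : 'I_n) : wfield c i 0 = row i A by rewrite cE // valK.
have w0 : wdet c 0 != 0.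
  have -> : wdet c 0 = \det A.
    by congr (\det _); apply/matrixP => i j; rewrite mxE rowE mxE.
  by move: uA; rewrite unitmxE unitfE.
have c0v : wfield c 0 0 = v by rewrite (rowE fst) Af.
have clw : wfield c lst 0 = w by rewrite (rowE lst) Al.
have : \sum_k w 0 k * wcof e G lst c k 0 = 0; last first.
  by rewrite -clw -wdetE => /eqP; rewrite (negPf w0).
pose O := c @^-1` O'; have oO : open O := open_curve oO' ec.
have O0 : O 0 by rewrite /O /= (proj1 ec).
have ic : curve_in O O' c by apply: (entire_curve_in ec).
have sC k := smooth_wcof e oO' sG lst k oO ic.
have sF k : smooth O (fun t => wfield c 1 t 0 k) := smooth_wfield e oO oO' sG 1 k ic.
have sW := smooth_wdet e oO' sG oO ic.
pose one : 'I_n := Ordinal n2.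
(* Differentiating by dbar at 0: by [dzbar_wcof] the terms with dbar of the cofactors sum to
   [(one == lst)%:R * dzbar e (wdet c) 0], which cancels the left side both for n = 2 and for n >
   2. *)
have E t : O t -> (one == lst)%:R * wdet c t = \sum_k wfield c 1 t 0 k * wcof e G lst c k t.
  by move=> _; rewrite -(wcof_row e G lst c t one).
have := eq_dzbar oO e O0 (CkZ _ oO (sW 1%N)) E.
rewrite (dzbarZ oO _ e O0 (sW 1%N)).
rewrite (dzbar_sum oO _ e O0 (fun k => smoothM oO (sF k) (sC k) 1%N)).
have -> : \sum_k dzbar e (fun t => wfield c 1 t 0 k * wcof e G lst c k t) 0 =
  \sum_k w 0 k * wcof e G lst c k 0 +
  (\sum_k wfield c 1 0 0 k * wcof e G lst c k 0) * (dzbar e (wdet c) 0 / wdet c 0).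
  rewrite mulr_suml -big_split; apply: eq_bigr => k _ /=.
  rewrite (dzbarM e O0 (sF k 1%N) (sC k 1%N)) (dzbar_wfield1 k ec) c0v -/w.
  by rewrite (dzbar_wcof k ec w0) !mulrA.
rewrite (wcof_row e G lst c 0 one) => /eqP.
rewrite -subr_eq0 opprD addrCA -mulrA [wdet c 0 * _]mulrC divfK // subrr addr0 oppr_eq0.
by move/eqP.
Qed.

(** Polarisation: along the complex line v + s e_l, the parallelism of [dbar_accel] is the sum over
    m of conj(u_m) q_m(s) = 0 with q_m holomorphic in s. Applying dbar in s leaves only q_l. *)
Lemma dbar_quad_parallel l (v : Cn) a b :
  v 0 a * dbar_quad l b v = v 0 b * dbar_quad l a v.
Proof.
have oT : open (@setT C) by exact: openT.
have [hid did] := holo_id oT.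
pose u (s : C) (i : 'I_n) : C := v 0 i + s * (i == l)%:R.
have hu i : holomorphic setT (fun s => u s i).
  by apply: (holoD oT (holo_cst oT _)); exact: (holoM oT hid (holo_cst oT _)).
have du i s : dz e (fun s => u s i) s = (i == l)%:R.
  have h1 : holomorphic setT (fun s : C => s * (i == l)%:R).
    exact: (holoM oT hid (holo_cst oT _)).
  transitivity (dz e (fun=> v 0 i) s + dz e (fun s : C => s * (i == l)%:R) s).
    exact: (dzD e I (Ck_cst 1 _ oT) (holo_Ck 1 h1)).
  transitivity (0 + (dz e id s * (i == l)%:R + s * dz e (fun _ : C => (i == l)%:R : C) s)).
    congr (_ + _); first exact: dz_cst.
    exact: (dzM e I (holo_Ck 1 hid) (Ck_cst 1 _ oT)).
  by rewrite did dz_cst e1 mulr0 addr0 add0r mul1r.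
pose V s : Cn := \row_i u s i.
pose Q m k s : C := \sum_i \sum_j dzbar (basis_vec m) (G i j k) p * u s i * u s j.
have QE m k s : dbar_quad m k (V s) = Q m k s.
  by apply: eq_bigr => i _; apply: eq_bigr => j _; rewrite !mxE.
have hQ m k : holomorphic setT (Q m k).
  apply: (holo_sum oT) => i; apply: (holo_sum oT) => j.
  by apply: (holoM oT _ (hu j)); exact: (holoM oT (holo_cst oT _) (hu i)).
pose q m s := u s a * Q m b s - u s b * Q m a s.
have hq m : holomorphic setT (q m).
  have h1 := holoM oT (hu a) (hQ m b); have h2 := holoM oT (hu b) (hQ m a).
  apply: (eq_holo oT (g := fun s => u s a * Q m b s + (-1) * (u s b * Q m a s))).
    by move=> s _; rewrite mulN1r.
  by apply: (holoD oT h1); exact: (holoM oT (holo_cst oT _) h2).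
pose P s := \sum_m conjc (u s m) * q m s.
have P0 s : P s = 0.
  have := dbar_accel_parallel (V s) a b; rewrite !mxE => E.
  have -> : P s = u s a * (\sum_m conjc (u s m) * Q m b s) -
      u s b * (\sum_m conjc (u s m) * Q m a s).
    rewrite !mulr_sumr -sumrB; apply: eq_bigr => m _; rewrite /q mulrBr.
    by congr (_ - _); rewrite mulrCA.
  apply/eqP; rewrite subr_eq0; apply/eqP.
  transitivity (u s a * (\sum_m conjc (V s 0 m) * dbar_quad m b (V s))).
    by congr (_ * _); apply: eq_bigr => m _; rewrite QE mxE.
  by rewrite E; congr (_ * _); apply: eq_bigr => m _; rewrite QE mxE.
have kc m := Ck_conj oT (holo_Ck 1 (hu m)).
have : dzbar e P 0 = 0.
  have -> : P = (fun=> 0) by apply/funext.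
  exact: dzbar_cst.
have -> : dzbar e P 0 = \sum_m (m == l)%:R * q m 0.
  rewrite (dzbar_sum oT _ e I (fun m => CkM oT (kc m) (holo_Ck 1 (hq m)))).
  apply: eq_bigr => m _.
  rewrite (dzbarM e I (kc m) (holo_Ck 1 (hq m))) (holo_dzbar e (hq m) I) mulr0 addr0.
  by rewrite (dzbar_conj e I (holo_Ck 1 (hu m))) du conjc_nat.
rewrite sum_delta /q => /eqP; rewrite subr_eq0 => /eqP.
have uE i : u 0 i = v 0 i by rewrite /u mul0r addr0.
have V0 : V 0 = v by apply/rowP => i; rewrite mxE uE.
by rewrite -!QE V0 !uE.
Qed.

Theorem local_projective_dbar i j k l :
  dzbar (basis_vec l) (fun z => G i j k z - (n.+1%:R)^-1 *
    ((k == i)%:R * (\sum_a G a j a z) + (k == j)%:R * (\sum_a G a i a z))) p = 0.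
Proof.
have sT j' : smooth O' (fun z => \sum_a G a j' a z).
  by move=> m; exact: (Ck_sum _ oO' (fun a => sG a j' a m)).
have k1 b j' : Ck 1 O' (fun z => b * (\sum_a G a j' a z)) := CkZ b oO' (sT j' 1%N).
have k2 := CkD oO' (k1 (k == i)%:R j) (k1 (k == j)%:R i).
rewrite (dzbarB oO' _ O'p (sG i j k 1%N) (CkZ _ oO' k2)) (dzbarZ oO' _ _ O'p k2).
rewrite (dzbarD _ O'p (k1 _ j) (k1 _ i)) !(dzbarZ oO' _ _ O'p (sT _ 1%N)).
rewrite !(dzbar_sum oO' _ _ O'p (fun a => sG _ _ _ 1%N)).
apply: (@tracefree_part_eq0 _ n (fun i j k => dzbar (basis_vec l) (G i j k) p)).
- move=> i' j' k'; apply: (eq_dzbar oO' _ O'p (sG i' j' k' 1%N)).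
  by move=> z; exact: symG.
- move=> v a b; have := dbar_quad_parallel l (\row_i v i) a b.
  rewrite /dbar_quad !mxE => E.
  transitivity (v a * (\sum_i \sum_j dzbar (basis_vec l) (G i j b) p * (\row_i v i) 0 i * (\row_i v i) 0 j)).
    by congr (_ * _); apply: eq_bigr => i' _; apply: eq_bigr => j' _; rewrite !mxE.
  by rewrite E; congr (_ * _); apply: eq_bigr => i' _; apply: eq_bigr => j' _; rewrite !mxE.
Qed.

End LocalConclusion.

(** * Bump functions *)

Section FlatFunctions.
Variable R : realType.
Implicit Types (x : R) (m : nat).

(** The factor of degree [m] in 1/x makes the span of this family stable under differentiation, as
    [Ck_real] demands. *)
Definition flat m x : R := if 0 < x then x^-1 ^+ m * expR (- x^-1) else 0.

Inductive flat_span : set (R -> R) :=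
| flat_span_gen m : flat_span (flat m)
| flat_span_comb (a b : R) f g : flat_span f -> flat_span g ->
    flat_span (fun x => a * f x + b * g x).

Lemma flat_ge0 m x : 0 <= flat m x.
Proof.
rewrite /flat; case: ifPn => // x0; apply: mulr_ge0; last exact: expR_ge0.
by rewrite exprn_ge0 // invr_ge0 ltW.
Qed.

Lemma flat0_gt0 x : 0 < x -> 0 < flat 0 x.
Proof. by move=> x0; rewrite /flat x0 expr0 mul1r expR_gt0. Qed.

Lemma flat0_eq0 x : x <= 0 -> flat 0 x = 0.
Proof. by rewrite /flat leNgt => /negPf ->. Qed.

(** One term of the series suffices: e^y is at least y^(m+2) / (m+2)!, at y = 1/x. The quadratic
    bound gives derivative 0 at the origin. *)
Lemma flat_le m x : flat m x <= m.+2`!%:R * x ^+ 2.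
Proof.
rewrite /flat; case: ifPn => [x0|_]; last first.
  by rewrite mulr_ge0 ?ler0n // sqr_ge0.
have y0 : 0 <= x^-1 by rewrite invr_ge0 ltW.
have f0 : 0 < (m.+2`!%:R : R) by rewrite ltr0n fact_gt0.
have h : x^-1 ^+ m * x^-1 ^+ 2 / m.+2`!%:R <= expR x^-1.
  rewrite -exprD addn2; apply: le_trans (expR_ge1Dxn m.+1 y0).
  by rewrite lerDr ler01.
rewrite expRN ler_pdivrMr ?expR_gt0 //.
move: h; rewrite ler_pdivrMr // => h.
have x20 : 0 < x ^+ 2 by rewrite exprn_gt0.
rewrite -(ler_pM2r (_ : 0 < x^-1 ^+ 2)) ?exprn_gt0 ?invr_gt0 //.
apply: le_trans h _; rewrite exprVn; have : x != 0 by rewrite gt_eqF.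
move: (expR _) (_`!%:R) => E f xn0.
by have -> : f * x ^+ 2 * E / x ^+ 2 = E * f by field.
Qed.

(** The coefficient 1 is written out so that the derivative has the shape of [flat_span_comb]. *)
Lemma is_derive_flat m x :
  is_derive x 1 (flat m) (- m%:R * flat m.+1 x + 1 * flat m.+2 x).
Proof.
have [x0|x0|->] := ltrgtP x 0; last first.
- have -> : - m%:R * flat m.+1 0 + 1 * flat m.+2 0 = 0 :> R.
    by rewrite /flat ltxx !mulr0 addr0.
  have lim : h^-1 *: (flat m (h + 0) - flat m 0) @[h --> (0:R)^'] --> (0 : R).
    have K0 : 0 <= m.+2`!%:R :> R by [].
    apply/cvgrPdist_le => eps eps0; near=> h.
    have h0 : h != 0 by near: h; exact: nbhs_dnbhs_neq.
    rewrite sub0r normrN addr0 [flat m 0]/flat ltxx subr0 normrM normfV.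
    rewrite ler_pdivrMl ?normr_gt0 // ger0_norm ?flat_ge0 //.
    apply: (le_trans (flat_le m h)).
    rewrite -real_normK ?num_real // expr2 mulrA [leRHS]mulrC ler_wpM2r //.
    near: h; apply: nbhs_dnbhs.
    have : `|h| @[h --> (0:R)] --> (0 : R) by rewrite -[X in _ --> X](normr0 R); exact: norm_continuous.
    move=> /(cvgM (cvg_cst (m.+2`!%:R : R))); rewrite mulr0 => /cvgrPdist_le /(_ _ eps0).
    apply: filterS => h; rewrite sub0r normrN; apply: le_trans; exact: ler_norm.
  apply: DeriveDef.
    apply/cvg_ex; exists 0; move: lim; apply: cvg_trans; apply: near_eq_cvg.
    by near=> h; rewrite /GRing.scale /= ?mulr1 ?addr0.
  rewrite /derive; apply: cvg_lim => //; move: lim; apply: cvg_trans; apply: near_eq_cvg.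
  by near=> h; rewrite /GRing.scale /= ?mulr1 ?addr0.
- apply: (@near_eq_is_derive R R^o R^o (fun y => y^-1 ^+ m * expR (- y^-1))).
    have : \forall y \near x, 0 < y by exact: lt_nbhsr.
    by apply: filterS => y y0; rewrite /flat y0.
  have xn0 : x != 0 by rewrite gt_eqF.
  have dV : is_derive x 1 (fun y : R => y^-1) (- x^-1 ^+ 2).
    apply: DeriveDef; first exact: derivableV.
    by rewrite deriveV // /GRing.scale /= derive_id mulr1 exprVn.
  have dN : is_derive (x^-1) 1 (fun y : R => expR (- y)) (- expR (- x^-1)).
    have d1 : is_derive (x^-1) 1 (fun y : R => - y) (-1).
      apply: (is_deriveN (is_derive_id (x^-1) (1 : R))).
    have := @is_derive1_comp _ expR (fun y => - y) (x^-1) _ _ (is_derive_expR _) d1.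
    by rewrite mulrN1.
  have dX : is_derive (x^-1) 1 (fun y : R => y ^+ m) (m%:R * x^-1 ^+ m.-1).
    apply: DeriveDef; first exact: exprn_derivable.
    by rewrite exp_derive /GRing.scale /= mulr1.
  have := @is_derive1_comp _ (fun y => y ^+ m * expR (- y)) (fun y => y^-1) x _ _
    (is_deriveM dX dN) dV.
  move=> d; apply: (is_derive_eq d).
  rewrite /flat x0 /GRing.scale /=; case: m {d dX} => [|m].
    by rewrite /= !mul0r mulr0 addr0 oppr0 mul0r add0r expr0 !mul1r mulrNN mulrC.
  rewrite /= !exprS.
  have E (a b c y : R) : (y * b * - c + c * (a * b)) * - (y * (y * 1)) =
    - a * (y * (y * b) * c) + 1 * (y * (y * (y * b)) * c) by ring.
  exact: E.
apply: (@near_eq_is_derive R R^o R^o (fun=> 0)).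
    have : \forall y \near x, y < 0 by exact: lt_nbhsl.
    by apply: filterS => y y0; rewrite /flat ltNge ltW.
  rewrite /flat ltNge ltW //= !mulr0 addr0; exact: is_derive_cst.
Unshelve. all: by end_near. Qed.

Lemma flat_span_derive f : flat_span f ->
  exists2 f', flat_span f' & forall x, setT x -> is_derive x 1 f (f' x).
Proof.
elim=> [m|a b g h _ [g' Pg dg] _ [h' Ph dh]].
  exists (fun x => - m%:R * flat m.+1 x + 1 * flat m.+2 x); last by move=> x _; exact: is_derive_flat.
  by apply: flat_span_comb; exact: flat_span_gen.
exists (fun x => a * g' x + b * h' x); first exact: flat_span_comb.
move=> x _; exact: (is_deriveD (is_deriveZ a (dg x I)) (is_deriveZ b (dh x I))).
Qed.

End FlatFunctions.

Section Plateau.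
Variables (R : realType) (n : nat) (p : CVec R n).
Local Notation C := (Cplx R).
Local Notation Cn := (CVec R n).

Definition sqdist (z : Cn) : C := \sum_k (z 0 k - p 0 k) * conjc (z 0 k - p 0 k).

Lemma smooth_sqdist : smooth setT sqdist.
Proof.
have oT : open (@setT Cn) by exact: openT.
apply: (smooth_sum oT) => k.
have s1 : smooth setT (fun z : Cn => z 0 k - p 0 k).
  exact: (smoothB oT (proj1 (proj1 (holo_coord k oT))) (smooth_cst oT _)).
exact: (smoothM oT s1 (smooth_conj oT s1)).
Qed.

Lemma Re_sqdist z : complex.Re (sqdist z) =
  \sum_k (complex.Re (z 0 k - p 0 k) ^+ 2 + complex.Im (z 0 k - p 0 k) ^+ 2).
Proof. by rewrite /sqdist Re_sum; apply: eq_bigr => k _; rewrite normc2E. Qed.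

Lemma sqdist_lt z (d : R) k : 0 < d -> complex.Re (sqdist z) < d ^+ 2 ->
  `|complex.Re (z 0 k - p 0 k)| <= d /\ `|complex.Im (z 0 k - p 0 k)| <= d.
Proof.
move=> d0; rewrite Re_sqdist (bigD1 k) //= => H.
have S0 : 0 <= \sum_(i < n | i != k) (complex.Re (z 0 i - p 0 i) ^+ 2 +
    complex.Im (z 0 i - p 0 i) ^+ 2).
  by apply: sumr_ge0 => i _; rewrite addr_ge0 ?sqr_ge0.
move: (complex.Re _) (complex.Im (z 0 k - p 0 k)) (\sum_(i < n | _) _) H S0 => a b S H S0.
have a0 := sqr_ge0 a; have b0 := sqr_ge0 b.
have hd : `|d| = d by rewrite gtr0_norm.
by split; rewrite -hd -ler_sqr ?nnegrE // !real_normK ?num_real //; lra.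
Qed.

(** [d] bounds the squared distance: the value is 1 below [d / 2] and 0 from [d] on. The two terms
    of the denominator never vanish together, since every real is below [d] or above [d / 2]. *)
Definition plateau (d : R) (z : Cn) : C :=
  ((flat 0 (d - complex.Re (sqdist z)))%:C)%C *
  (((flat 0 (d - complex.Re (sqdist z)))%:C)%C +
   ((flat 0 (complex.Re (sqdist z) - d / 2))%:C)%C)^-1.

Lemma smooth_flat (V : normedModType R[i]) (O : set V) (g : V -> C) :
  open O -> smooth O g -> smooth O (fun q => ((flat 0 (complex.Re (g q)))%:C)%C : C).
Proof.
move=> oO sg k; exact: (@Ck_real _ _ (flat_span (R := R)) setT k O g (flat 0) oO
  (@flat_span_derive R) (fun _ _ => I) (@flat_span_gen R 0) (sg k)).
Qed.

Lemma smooth_plateau d : 0 < d -> smooth setT (plateau d).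
Proof.
move=> d0; have oT : open (@setT Cn) by exact: openT.
have s1 : smooth setT (fun z => ((flat 0 (d - complex.Re (sqdist z)))%:C)%C : C).
  apply: (eq_smooth oT _ (smooth_flat oT (smoothB oT (smooth_cst oT ((d%:C)%C : C)) smooth_sqdist))).
  by move=> z _; rewrite ReD ReN.
have s2 : smooth setT (fun z => ((flat 0 (complex.Re (sqdist z) - d / 2))%:C)%C : C).
  apply: (eq_smooth oT _ (smooth_flat oT (smoothB oT smooth_sqdist (smooth_cst oT (((d / 2)%:C)%C : C))))).
  by move=> z _; rewrite ReD ReN.
have s3 := smoothD oT s1 s2.
apply: (smoothM oT s1) => k; apply: (Ck_inv oT _ (s3 k)) => z _.
rewrite -rmorphD /= fmorph_eq0 gt_eqF //.
have [h|h] := ltrP (complex.Re (sqdist z)) d.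
  by rewrite ltr_wpDr ?flat_ge0 ?flat0_gt0 // subr_gt0.
by rewrite ltr_wpDl ?flat_ge0 ?flat0_gt0 // subr_gt0; lra.
Qed.

Lemma plateau1 d z : 0 < d -> complex.Re (sqdist z) < d / 2 -> plateau d z = 1.
Proof.
move=> d0 h; rewrite /plateau [flat 0 (_ - d / 2)]flat0_eq0 ?rmorph0 ?addr0.
  by rewrite mulfV // fmorph_eq0 gt_eqF // flat0_gt0 // subr_gt0; lra.
by rewrite subr_le0 ltW.
Qed.

Lemma plateau0 d z : d <= complex.Re (sqdist z) -> plateau d z = 0.
Proof. by move=> h; rewrite /plateau flat0_eq0 ?rmorph0 ?mul0r // subr_le0. Qed.

End Plateau.

(** * Charts and connections *)

Lemma smooth_sub (R : realType) (V : normedModType R[i]) (O O' : set V) g :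
  O' `<=` O -> smooth O g -> smooth O' g.
Proof. by move=> OO sg k; exact: Ck_sub OO (sg k). Qed.

Lemma mul_eq1_neq0 (K : nzRingType) (x y : K) : x * y = 1 -> x != 0.
Proof. by move=> E; apply/eqP => x0; move/eqP: E; rewrite x0 mul0r eq_sym oner_eq0. Qed.

Section Charts.
Variables (R : realType) (n : nat) (X : topologicalType).
Variable M : complex_manifold R n X.
Local Notation C := (Cplx R).
Local Notation Cn := (CVec R n).
Local Notation chart := (chart R n X).
Implicit Types (c : chart) (p q : X) (a : X -> C) (A : set X).

Lemma open_cdom c : open (cdom c). Proof. exact: cdom_open. Qed.

Lemma open_cimg c : open (cimg c). Proof. exact: cimg_open. Qed.

Arguments open_cdom c : clear implicits.
Arguments open_cimg c : clear implicits.

Lemma chart_imageP c A z :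
  (cmap c @` (A `&` cdom c)) z <-> cimg c z /\ A (cinv c z).
Proof.
split=> [[p [Ap cp] <-]|[[p cp <-]]]; first by rewrite cmapK //; split=> //; exists p.
by rewrite cmapK // => Ap; exists p.
Qed.

Lemma cimg_cdom c z : cimg c z -> cdom c (cinv c z).
Proof. by move=> [p cp <-]; rewrite cmapK. Qed.

Lemma cinvK c z : cimg c z -> cmap c (cinv c z) = z.
Proof. by move=> [p cp <-]; rewrite cmapK. Qed.

Lemma cimg_cmap c p : cdom c p -> cimg c (cmap c p).
Proof. by move=> cp; exists p. Qed.

Lemma open_chart_image c A : open A -> open (cmap c @` (A `&` cdom c)).
Proof.
move=> oA; rewrite openE => z /chart_imageP[cz Az].
have h1 : \forall y \near z, A (cinv c y).
  exact: (cinv_continuous cz (open_nbhs_nbhs (conj oA Az))).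
have h2 : nbhs z (cimg c) by apply: open_nbhs_nbhs; split=> //; exact: open_cimg.
rewrite /interior; near=> y; apply/chart_imageP; split; [near: y; exact: h2|near: y; exact: h1].
Unshelve. all: by end_near. Qed.

Arguments open_chart_image c [A] _.

Lemma chart_imageT c : cmap c @` (setT `&` cdom c) = cimg c.
Proof. by rewrite setTI. Qed.

Lemma holo_transition_image c c' k : atlas M c -> atlas M c' ->
  holomorphic (cmap c @` (cdom c' `&` cdom c)) (fun z => cmap c' (cinv c z) 0 k).
Proof. by move=> ac ac'; rewrite setIC; exact: (atlas_holo ac ac' k). Qed.

Lemma chart_change_eq a c c' A z : (cmap c @` ((A `&` cdom c') `&` cdom c)) z ->
  a (cinv c' (cmap c' (cinv c z))) = a (cinv c z).
Proof. by move=> /chart_imageP[_ [_ c'z]]; rewrite cmapK. Qed.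

Lemma transition_image c c' A z : (cmap c @` ((A `&` cdom c') `&` cdom c)) z ->
  (cmap c' @` (A `&` cdom c')) (cmap c' (cinv c z)).
Proof.
by move=> /chart_imageP[_ [Az c'z]]; apply/chart_imageP; rewrite cmapK //; split=> //; exists (cinv c z).
Qed.

Section Change.
Variables (a : X -> C) (A : set X) (c c' : chart).
Hypotheses (oA : open A) (ac : atlas M c) (ac' : atlas M c').
Hypothesis sa : smooth (cmap c' @` (A `&` cdom c')) (a \o cinv c').
Let O := cmap c @` ((A `&` cdom c') `&` cdom c).

Let oO : open O.
Proof. by apply: open_chart_image; apply: openI => //; exact: open_cdom. Qed.

Let hT k : holomorphic O (fun z => cmap c' (cinv c z) 0 k).
Proof.
apply: holo_sub (holo_transition_image k ac ac').
by move=> z [p [[Ap c'p] cp] <-]; exists p.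
Qed.

Lemma smooth_chart_change : smooth O (a \o cinv c).
Proof.
apply: (eq_smooth oO (g := fun z => a (cinv c' (cmap c' (cinv c z))))).
  by move=> z Oz; exact: chart_change_eq Oz.
exact: (smooth_comp oO (open_chart_image c' oA) (fun z Oz => transition_image Oz) sa
  (fun j => proj1 (hT j))).
Qed.

(** No [dzbar] term appears because the transition map is holomorphic. *)
Lemma dz_chart_change p i : A p -> cdom c p -> cdom c' p ->
  dz (basis_vec i) (a \o cinv c) (cmap c p) =
  \sum_j jacobian c c' p i j * dz (basis_vec j) (a \o cinv c') (cmap c' p).
Proof.
move=> Ap cp c'p; have Op : O (cmap c p) by exists p => //; split=> //; split.
have sg := smooth_chart_change.
rewrite (eq_dz oO (basis_vec i) Op (sg 1%N) (fun z Oz => esym (chart_change_eq a Oz))).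
have := dz_comp_holo (basis_vec i) (open_chart_image c' oA) (transition_image Op) sa Op hT.
rewrite (cmapK cp) => E; rewrite E; apply: eq_bigr => j _.
by rewrite mxE mulrC.
Qed.

End Change.

Lemma holo_chart_change a A c c' : open A -> atlas M c -> atlas M c' ->
  holomorphic (cmap c' @` (A `&` cdom c')) (a \o cinv c') ->
  holomorphic (cmap c @` ((A `&` cdom c') `&` cdom c)) (a \o cinv c).
Proof.
move=> oA ac ac' ha.
have oO : open (cmap c @` ((A `&` cdom c') `&` cdom c)).
  by apply: open_chart_image; apply: openI => //; exact: open_cdom.
apply: (eq_holo oO (g := fun z => a (cinv c' (cmap c' (cinv c z))))).
  by move=> z Oz; exact: chart_change_eq Oz.
apply: (holo_comp oO (open_chart_image c' oA) (fun z Oz => transition_image Oz) ha) => j.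
apply: holo_sub (holo_transition_image j ac ac').
by move=> z [p [[Ap c'p] cp] <-]; exists p.
Qed.

Lemma jacobian_id c p : cdom c p -> jacobian c c p = 1%:M.
Proof.
move=> cp; apply/matrixP => i j; rewrite !mxE.
have [hj dj] := holo_coord j (open_cimg c).
rewrite -(eq_dz (open_cimg c) (basis_vec i) (cimg_cmap cp) (proj1 hj 1%N)).
  by rewrite dj mxE eqxx eq_sym.
by move=> z cz; rewrite cinvK.
Qed.

Lemma jacobian_chain c c' c'' p : atlas M c -> atlas M c' -> atlas M c'' ->
  cdom c p -> cdom c' p -> cdom c'' p ->
  jacobian c c'' p = jacobian c c' p *m jacobian c' c'' p.
Proof.
move=> ac ac' ac'' cp c'p c''p; apply/matrixP => i j; rewrite [LHS]mxE [RHS]mxE.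
transitivity (dz (basis_vec i) ((fun q => cmap c'' q 0 j) \o cinv c) (cmap c p)); first by [].
have sT := proj1 (holo_transition_image j ac' ac'').
rewrite (dz_chart_change (open_cdom c'') ac ac' sT) //.
by apply: eq_bigr => k _; congr (_ * _); rewrite mxE.
Qed.

Lemma jacobian_unit c c' p : atlas M c -> atlas M c' -> cdom c p -> cdom c' p ->
  \det (jacobian c c' p) != 0.
Proof.
move=> ac ac' cp c'p.
have E : \det (jacobian c c' p) * \det (jacobian c' c p) = 1.
  by rewrite -det_mulmx -(jacobian_chain ac ac' ac cp c'p cp) jacobian_id // det1.
exact: (mul_eq1_neq0 E).
Qed.

Lemma holo_jacobian c c' i j : atlas M c -> atlas M c' ->
  holomorphic (cmap c @` (cdom c' `&` cdom c)) (fun z => jacobian c c' (cinv c z) i j).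
Proof.
move=> ac ac'; have oO := open_chart_image c (open_cdom c').
apply: (eq_holo oO _ (holo_dz oO (basis_vec i) (holo_transition_image j ac ac'))).
by move=> z /chart_imageP[cz _]; rewrite mxE cinvK.
Qed.

End Charts.

Arguments open_cdom [R n X] c : rename.
Arguments open_cimg [R n X] c : rename.
Arguments open_chart_image [R n X] c [A] _ : rename.

(** * Bump functions on the manifold *)

Section Bump.
Variables (R : realType) (n : nat) (X : topologicalType).
Variable M : complex_manifold R n X.
Local Notation C := (Cplx R).
Local Notation Cn := (CVec R n).
Local Notation chart := (chart R n X).
Implicit Types (c : chart) (p q : X) (a g : X -> C) (A K N : set X).

(** The open sets [cdom c] and the complement of [K] cover the manifold; [g] is smooth on the first
    and zero on the second. *)
Lemma smooth_function_extend c g K : atlas M c -> closed K -> K `<=` cdom c ->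
  (forall q, ~ K q -> g q = 0) -> smooth (cimg c) (g \o cinv c) -> smooth_function M g.
Proof.
move=> ac cK Kc g0 sg c' ac'; apply: smooth_local => z c'z.
have sg' : smooth (cmap c @` (setT `&` cdom c)) (g \o cinv c) by rewrite chart_imageT.
have [cz|cz] := pselect (cdom c (cinv c' z)).
  exists (cmap c' @` ((setT `&` cdom c) `&` cdom c')); last exact: (smooth_chart_change openT ac' ac sg').
  by apply/chart_imageP; split=> //; split.
have oN := @open_chart_image _ _ _ c' (~` K) (closed_openC cK).
exists (cmap c' @` (~` K `&` cdom c')).
  by apply/chart_imageP; split=> // /Kc.
apply: (eq_smooth oN (g := fun=> 0)); last exact: (smooth_cst oN).
by move=> y /chart_imageP[_ Ky]; rewrite /= g0.
Qed.

Definition square (w : C) (d : R) : set C :=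
  [set x | `|complex.Re (x - w)| <= d /\ `|complex.Im (x - w)| <= d].

Lemma compact_square w d : compact (square w d).
Proof.
pose I := `[- d, d]%classic; pose f (x : R * R) : C := w + (x.1 +i* x.2)%C.
have cI : compact (I `*` I) by apply: compact_setX; exact: segment_compact.
have cf : continuous f.
  move=> x; apply: (@cvgD _ C _ (nbhs x)); first exact: cvg_cst.
  by apply: cvg_Cplx; [exact: cvg_fst|exact: cvg_snd].
have -> : square w d = f @` (I `*` I).
  rewrite eqEsubset; split=> x.
    move=> [h1 h2]; exists (complex.Re (x - w), complex.Im (x - w)).
      by rewrite /I /=; split; rewrite in_itv /= -ler_norml.
    rewrite /f /=; have -> : (complex.Re (x - w) +i* complex.Im (x - w))%C = x - w by case: (x - w).
    by rewrite addrC subrK.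
  move=> [[y1 y2]] [/= h1 h2] <-; rewrite /square /= /f addrC addKr /=.
  by split; rewrite ler_norml; [move: h1|move: h2]; rewrite /I /= in_itv.
by apply: continuous_compact => //; exact: continuous_subspaceT.
Qed.

Lemma square_in_open (O : set Cn) z : open O -> O z ->
  exists2 d : R, 0 < d & forall y : Cn, (forall k, square (z 0 k) d (y 0 k)) -> O y.
Proof.
move=> oO Oz; have /nbhs_ballP[e /= e0 eO] := open_nbhs_nbhs (conj oO Oz).
have [r r0 rE] := gt0_Cplx e0.
(* The modulus of a coordinate difference is at most |Re| + |Im|, hence at most 2r/3 < r. *)
exists (r / 3) => [|y yz]; first by rewrite divr_gt0.
apply: eO; split=> // i j; rewrite ord1 -ball_normE /= rE.
have [h1 h2] := yz j; move: (y 0 j - z 0 j) h1 h2 (distrC (y 0 j) (z 0 j)) => w h1 h2 <-.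
have -> : w = ((complex.Re w)%:C)%C + 'i%C * ((complex.Im w)%:C)%C :> C.
  exact: complexE.
apply: le_lt_trans (ler_normD _ _) _.
rewrite normrM (_ : `|'i%C : C| = 1); last by rewrite normc_def /= expr0n /= add0r expr1n sqrtr1.
rewrite mul1r !normR -rmorphD /= ltcR.
have r3 : 0 < r / 3 by rewrite divr_gt0.
move: (`|complex.Re w|) (`|complex.Im w|) h1 h2 r0 => x1 x2 h1 h2 r0; lra.
Qed.

(** A plateau function is carried over from a compact product of squares in the chart. Its support
    is compact in the manifold, hence closed because the manifold is Hausdorff, and extension by
    zero applies. *)
Lemma bump_exists c p N : atlas M c -> cdom c p -> open N -> N p ->
  exists chi K, [/\ smooth_function M chi, \forall q \near p, chi q = 1,
    closed K, K `<=` cdom c `&` N & forall q, ~ K q -> chi q = 0].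
Proof.
move=> ac cp oN Np; set O := cmap c @` (N `&` cdom c).
have Op : O (cmap c p) by exists p.
have [d d0 dO] := square_in_open (open_chart_image c oN) Op.
pose B : set Cn := [set y : Cn | forall k, square (cmap c p 0 k) d (y 0 k)].
have cB : compact B := rV_compact (fun k => @compact_square (cmap c p 0 k) d).
pose K := cinv c @` B.
have Kc : K `<=` cdom c `&` N.
  move=> q [y By <-]; have /chart_imageP[cy Ny] := dO _ By.
  by split=> //; exact: cimg_cdom.
have cK : closed K.
  apply: (compact_closed (cm_hausdorff M)); apply: continuous_compact => //.
  apply: continuous_in_subspaceT => y /set_mem By.
  by have /chart_imageP[cy _] := dO _ By; exact: cinv_continuous.
have d20 : 0 < d ^+ 2 by rewrite exprn_gt0.
(* Squared distance below [d ^+ 2] forces each real and imaginary part to be at most [d], so the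
   function vanishes outside [B]. *)
pose h := plateau (cmap c p) (d ^+ 2).
pose chi q : C := if `[< cdom c q >] then h (cmap c q) else 0.
have chiE q : cdom c q -> chi q = h (cmap c q) by move=> cq; rewrite /chi asboolT.
have chi0 q : ~ K q -> chi q = 0.
  move=> Kq; rewrite /chi; case: asboolP => // cq.
  rewrite /h; apply: plateau0; rewrite leNgt; apply/negP => lt.
  apply: Kq; exists (cmap c q); last by rewrite cmapK.
  by move=> k; exact: sqdist_lt lt.
exists chi, K; split=> //.
- apply: (smooth_function_extend ac cK) => //; first by move=> q /Kc[].
  apply: (eq_smooth (open_cimg c) (g := h)); last first.
    by apply: smooth_sub (smooth_plateau _ d20).
  by move=> y cy; rewrite /= chiE ?cinvK //; exact: cimg_cdom.
- have ccp : \forall q \near p, cdom c q by exact: (open_nbhs_nbhs (conj (open_cdom c) cp)).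
  have cs : {for p, continuous (fun q => complex.Re (sqdist (cmap c p) (cmap c q)))}.
    apply: (@continuous_comp _ _ _ (fun q => sqdist (cmap c p) (cmap c q)) (@complex.Re R)).
      apply: (@continuous_comp _ _ _ (cmap c) (sqdist (cmap c p))).
        exact: cmap_continuous.
      exact: (Ck_continuous (smooth_sqdist (cmap c p) 0%N)).
    exact: continuous_Re.
  have s0 : complex.Re (sqdist (cmap c p) (cmap c p)) < d ^+ 2 / 2.
    rewrite Re_sqdist big1 ?divr_gt0 // => k _.
    by rewrite subrr /= expr0n addr0.
  have := cs _ (lt_nbhsl s0).
  rewrite /nbhs /= => ns; near=> q.
  have cq : cdom c q by near: q.
  rewrite chiE // /h plateau1 //; near: q; exact: ns.
Unshelve. all: by end_near. Qed.

End Bump.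

(** * Locality of connections and their expression in a chart *)

Section Fields.
Variables (R : realType) (n : nat) (X : topologicalType).
Variable M : complex_manifold R n X.
Local Notation C := (Cplx R).
Local Notation Cn := (CVec R n).
Local Notation chart := (chart R n X).
Local Notation field := (field R n X).
Implicit Types (c : chart) (p q : X) (a chi : X -> C) (A K N : set X) (U V : field).

Definition chart_field c chi (G : X -> Cn) : field := fun c' q =>
  if `[< chart_at M c' q /\ cdom c q >] then chi q *: (G q *m jacobian c c' q) else 0.

Lemma smooth_chart_field c chi K (G : X -> Cn) : atlas M c -> smooth_function M chi ->
  closed K -> K `<=` cdom c -> (forall q, ~ K q -> chi q = 0) ->
  (forall k, smooth (cimg c) (fun z => G (cinv c z) 0 k)) ->
  smooth_field M (chart_field c chi G).
Proof.
move=> ac schi cK Kc chi0 sG; split=> [c' p c'p|c' c'' p [ac' c'p] [ac'' c''p]|c' k ac'].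
- by rewrite /chart_field asboolF // => -[].
- rewrite /chart_field; have [cp|cp] := pselect (cdom c p).
    by rewrite !asboolT // -scalemxAl -mulmxA -(jacobian_chain ac ac' ac'').
  by rewrite !asboolF ?mul0mx // => -[].
apply: smooth_local => z c'z.
have [cz|cz] := pselect (cdom c (cinv c' z)).
  pose N := cmap c' @` ((cdom c' `&` cdom c) `&` cdom c').
  have oN : open N.
    by apply: open_chart_image; apply: openI; exact: open_cdom.
  have c'z' := cimg_cdom c'z.
  exists N; first by apply/chart_imageP; split=> //; split.
  apply: (eq_smooth oN (g := fun y => chi (cinv c' y) *
      \sum_j G (cinv c' y) 0 j * jacobian c c' (cinv c' y) j k)).
    move=> y /chart_imageP[c'y [c'y' cy]]; rewrite /chart_field asboolT; last by split.
    by rewrite !mxE.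
  have Nc : N `<=` cimg c' by move=> y /chart_imageP[].
  apply: (smoothM oN (smooth_sub Nc (schi c' ac'))).
  apply: (smooth_sum oN) => j; apply: (smoothM oN).
    have sG' : smooth (cmap c @` (setT `&` cdom c)) ((fun q => G q 0 j) \o cinv c).
      by rewrite chart_imageT; exact: sG.
    apply: smooth_sub (smooth_chart_change openT ac' ac sG').
    by move=> y [q [[c'q cq] _] <-]; exists q.
  exact: (smooth_chart_change (a := fun q => jacobian c c' q j k) (open_cdom c') ac' ac (proj1 (holo_jacobian j k ac ac'))).
have oN := @open_chart_image _ _ _ c' (~` K) (closed_openC cK).
exists (cmap c' @` (~` K `&` cdom c')).
  by apply/chart_imageP; split=> // /Kc.
apply: (eq_smooth oN (g := fun=> 0)); last exact: (smooth_cst oN).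
move=> y /chart_imageP[_ Ky]; rewrite /chart_field; case: asboolP => _; last by rewrite mxE.
by rewrite chi0 // scale0r mxE.
Qed.

Lemma chart_fieldE c chi (G : X -> Cn) q : chart_at M c q -> chi q = 1 -> chart_field c chi G c q = G q.
Proof.
move=> cq chi1; rewrite /chart_field asboolT; last by split=> //; case: cq.
by rewrite chi1 scale1r jacobian_id ?mulmx1 //; case: cq.
Qed.

Lemma near_chart c p : chart_at M c p -> \forall q \near p, chart_at M c q.
Proof.
move=> [ac cp]; apply: filterS (open_nbhs_nbhs (conj (open_cdom c) cp)) => q cq.
by split.
Qed.

(** A bump function gives one field with the required properties, so [xget] does not fall back on
    its default value. *)
Lemma coord_fieldP c i p : chart_at M c p -> smooth_field M (coord_field M c i p) /\
  \forall q \near p, coord_field M c i p c q = basis_vec i.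
Proof.
move=> [ac cp]; have [chi [K [schi chi1 cK Kc chi0]]] := bump_exists ac cp openT I.
have Kc' : K `<=` cdom c by move=> q /Kc[].
rewrite /coord_field; case: xgetP => [U -> //|] /(_ (chart_field c chi (fun=> basis_vec i))).
case; split.
  apply: (smooth_chart_field ac schi cK Kc' chi0) => k.
  exact: (smooth_cst (open_cimg c)).
near=> q; apply: chart_fieldE; last by near: q.
by near: q; apply: near_chart.
Unshelve. all: by end_near. Qed.

Definition zerof : field := fun _ _ => 0.

Lemma smooth_zerof : smooth_field M zerof.
Proof.
split=> [//|c c' p _ _|c k ac]; first by rewrite /zerof mul0mx.
apply: (eq_smooth (open_cimg c) (g := fun=> 0)); last exact: (smooth_cst (open_cimg c)).
by move=> z _; rewrite mxE.
Qed.

Lemma smooth_addf U V : smooth_field M U -> smooth_field M V -> smooth_field M (addf U V).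
Proof.
move=> [U0 UJ sU] [V0 VJ sV]; split=> [c p cp|c c' p cp c'p|c k ac].
- by rewrite /addf U0 // V0 // addr0.
- by rewrite /addf mulmxDl (UJ c c') // (VJ c c').
apply: (eq_smooth (open_cimg c) (g := fun z => U c (cinv c z) 0 k + V c (cinv c z) 0 k)).
  by move=> z _; rewrite mxE.
exact: (smoothD (open_cimg c) (sU c k ac) (sV c k ac)).
Qed.

Lemma smooth_scalef a U : smooth_function M a -> smooth_field M U -> smooth_field M (scalef a U).
Proof.
move=> sa [U0 UJ sU]; split=> [c p cp|c c' p cp c'p|c k ac].
- by rewrite /scalef U0 // scaler0.
- by rewrite /scalef -scalemxAl (UJ c c').
apply: (eq_smooth (open_cimg c) (g := fun z => a (cinv c z) * U c (cinv c z) 0 k)).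
  by move=> z _; rewrite mxE.
exact: (smoothM (open_cimg c) (sa c ac) (sU c k ac)).
Qed.

Lemma smooth_function_cst (b : C) : smooth_function M (fun=> b).
Proof. by move=> c ac; exact: (smooth_cst (open_cimg c)). Qed.

Definition comb (u : 'I_n -> X -> C) (E : 'I_n -> field) r : field :=
  fun c p => \sum_(i <- r) u i p *: E i c p.

Lemma comb_nil u E : comb u E [::] = zerof.
Proof. by apply/funext => c; apply/funext => p; rewrite /comb big_nil. Qed.

Lemma comb_cons u E i r : comb u E (i :: r) = addf (scalef (u i) (E i)) (comb u E r).
Proof. by apply/funext => c; apply/funext => p; rewrite /comb big_cons. Qed.

Lemma smooth_comb u E r : (forall i, smooth_function M (u i)) ->
  (forall i, smooth_field M (E i)) -> smooth_field M (comb u E r).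
Proof.
move=> su sE; elim: r => [|i r IH]; first by rewrite comb_nil; exact: smooth_zerof.
by rewrite comb_cons; apply: smooth_addf => //; exact: smooth_scalef.
Qed.

Variable D : connection M.

Lemma cov_zerol V : smooth_field M V -> D zerof V = zerof.
Proof.
move=> sV; have E W : scalef (fun=> 0) W = zerof.
  by apply/funext => c; apply/funext => p; rewrite /scalef scale0r.
by rewrite -[X in D X _](E zerof) (cov_scalel _ (smooth_function_cst 0) smooth_zerof sV) E.
Qed.

Lemma cov_zeror U : smooth_field M U -> D U zerof = zerof.
Proof.
move=> sU; have E W : scalef (fun=> 0) W = zerof.
  by apply/funext => c; apply/funext => p; rewrite /scalef scale0r.
by rewrite -[X in D _ X](E zerof) (cov_constr _ _ sU smooth_zerof) E.
Qed.

Lemma cov_combl u E r V : (forall i, smooth_function M (u i)) ->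
  (forall i, smooth_field M (E i)) -> smooth_field M V ->
  D (comb u E r) V = comb u (fun i => D (E i) V) r.
Proof.
move=> su sE sV; elim: r => [|i r IH]; first by rewrite !comb_nil cov_zerol.
have s1 := smooth_scalef (su i) (sE i).
by rewrite !comb_cons (cov_addl _ s1 (smooth_comb r su sE) sV) IH cov_scalel.
Qed.

Lemma cov_combr u E r U c p : (forall i, smooth_function M (u i)) ->
  (forall i, smooth_field M (E i)) -> smooth_field M U -> chart_at M c p ->
  D U (comb u E r) c p =
  \sum_(i <- r) (lie_derive c U (u i) p *: E i c p + u i p *: D U (E i) c p).
Proof.
move=> su sE sU cp; elim: r => [|i r IH]; first by rewrite comb_nil cov_zeror // big_nil.
have s1 := smooth_scalef (su i) (sE i).
rewrite comb_cons (cov_addr _ sU s1 (smooth_comb r su sE)) big_cons -IH /addf.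
by rewrite (cov_leibniz D (su i) sU (sE i) cp).
Qed.

(** Turns local vanishing into a global equation: a multiple of [V] by a function equal to 1 at [p]
    is the zero section, to which linearity and the Leibniz rule apply. *)
Lemma bump_scale_zerof c p V : chart_at M c p -> smooth_field M V ->
  (\forall q \near p, V c q = 0) ->
  exists chi, [/\ smooth_function M chi, chi p = 1 & scalef chi V = zerof].
Proof.
move=> [ac cp] [V0 VJ _]; rewrite /prop_near1 nbhsE => -[N [oN Np] NV].
have [chi [K [schi chi1 cK Kc chi0]]] := bump_exists ac cp oN Np.
exists chi; split=> //; first exact: (nbhs_singleton chi1).
apply/funext => c'; apply/funext => q; rewrite /scalef /zerof.
have [Kq|Kq] := pselect (K q); last by rewrite chi0 // scale0r.
have [cq Nq] := Kc _ Kq; have [c'q|c'q] := pselect (chart_at M c' q).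
  by rewrite (VJ c c') // NV // mul0mx scaler0.
by rewrite V0 // scaler0.
Qed.

Lemma cov_local0l c p U V : chart_at M c p -> smooth_field M U -> smooth_field M V ->
  (\forall q \near p, U c q = 0) -> D U V c p = 0.
Proof.
move=> cp sU sV /(bump_scale_zerof cp sU)[chi [schi chi1 chiU]].
have := cov_scalel D schi sU sV; rewrite chiU cov_zerol //.
by move=> /(congr1 (fun F : field => F c p)); rewrite /scalef chi1 scale1r.
Qed.

Lemma cov_local0r c p U V : chart_at M c p -> smooth_field M U -> smooth_field M V ->
  (\forall q \near p, V c q = 0) -> D U V c p = 0.
Proof.
move=> cp sU sV V0; have [chi [schi chi1 chiV]] := bump_scale_zerof cp sV V0.
have := cov_leibniz D schi sU sV cp; rewrite chiV cov_zeror // /zerof.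
by rewrite (nbhs_singleton V0) scaler0 add0r chi1 scale1r.
Qed.

Let opf V : field := scalef (fun=> -1) V.

Let smooth_opf V : smooth_field M V -> smooth_field M (opf V).
Proof. by move=> sV; apply: smooth_scalef => //; exact: smooth_function_cst. Qed.

Let near_sub c p V V' : (\forall q \near p, V c q = V' c q) ->
  \forall q \near p, addf V (opf V') c q = 0.
Proof. by apply: filterS => q VV; rewrite /addf /opf /scalef scaleN1r VV subrr. Qed.

Lemma eq_covl c p U U' V : chart_at M c p -> smooth_field M U -> smooth_field M U' ->
  smooth_field M V -> (\forall q \near p, U c q = U' c q) -> D U V c p = D U' V c p.
Proof.
move=> cp sU sU' sV UU.
have := cov_local0l cp (smooth_addf sU (smooth_opf sU')) sV (near_sub UU).
rewrite (cov_addl _ sU (smooth_opf sU') sV) /addf.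
rewrite (cov_scalel _ (smooth_function_cst (-1)) sU' sV) /scalef scaleN1r => /eqP.
by rewrite subr_eq0 => /eqP.
Qed.

Lemma eq_covr c p U V V' : chart_at M c p -> smooth_field M U -> smooth_field M V ->
  smooth_field M V' -> (\forall q \near p, V c q = V' c q) -> D U V c p = D U V' c p.
Proof.
move=> cp sU sV sV' VV.
have := cov_local0r cp sU (smooth_addf sV (smooth_opf sV')) (near_sub VV).
rewrite (cov_addr _ sU sV (smooth_opf sV')) /addf.
rewrite (cov_constr _ _ sU sV') /scalef scaleN1r => /eqP.
by rewrite subr_eq0 => /eqP.
Qed.

Lemma eq_dz_chart c p A (a b : X -> C) v : open A -> A p -> cdom c p ->
  smooth (cmap c @` (A `&` cdom c)) (a \o cinv c) -> (\forall q \near p, a q = b q) ->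
  dz v (a \o cinv c) (cmap c p) = dz v (b \o cinv c) (cmap c p).
Proof.
move=> oA Ap cp sa; rewrite /prop_near1 nbhsE => -[N [oN Np] Nab].
have oO := open_chart_image c (openI oN oA).
have Op : (cmap c @` ((N `&` A) `&` cdom c)) (cmap c p) by exists p.
apply: (eq_dz oO v Op (g := a \o cinv c)).
  by apply: Ck_sub (sa 1%N) => z [q [[Nq Aq] cq] <-]; exists q.
by move=> z /chart_imageP[_ [/Nab]].
Qed.

(** Near [p] both fields agree with global combinations of coordinate fields whose coefficients are
    cut off by a bump; locality allows the replacement, and the axioms then compute it. *)
Lemma cov_formula U V c p k : smooth_field M U -> smooth_field M V -> chart_at M c p ->
  D U V c p 0 k = \sum_i U c p 0 i * dz (basis_vec i) (fun z => V c (cinv c z) 0 k) (cmap c p)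
    + \sum_i \sum_j christoffel D c i j k p * U c p 0 i * V c p 0 j.
Proof.
move=> sU sV cp; have [ac cp'] := cp.
have [chi [K [schi chi1 cK Kc chi0]]] := bump_exists ac cp' openT I.
have Kc' : K `<=` cdom c by move=> q /Kc[].
pose E i := coord_field M c i p.
have sE i : smooth_field M (E i) := proj1 (coord_fieldP i cp).
have nE i : \forall q \near p, E i c q = basis_vec i := proj2 (coord_fieldP i cp).
have nEall : \forall q \near p, forall i, E i c q = basis_vec i.
  by apply: filter_forall => i; exact: nE.
pose cut (W : field) (i : 'I_n) q : C := chi q * W c q 0 i.
have scut W i : smooth_field M W -> smooth_function M (cut W i).
  move=> [_ _ sW]; apply: (smooth_function_extend ac cK Kc').
    by move=> q Kq; rewrite /cut chi0 // mul0r.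
  exact: (smoothM (open_cimg c) (schi c ac) (sW c i ac)).
have ncut W : \forall q \near p, W c q = comb (cut W) E (index_enum 'I_n) c q.
  near=> q; have q1 : chi q = 1 by near: q.
  have Eq : forall i, E i c q = basis_vec i by near: q.
  rewrite /comb [LHS]row_sum_delta; apply: eq_bigr => i _.
  by rewrite Eq /cut q1 mul1r.
have sUc := scut U ^~ sU; have sVc := scut V ^~ sV.
have sUE := smooth_comb (index_enum 'I_n) sUc sE.
have sVE := smooth_comb (index_enum 'I_n) sVc sE.
rewrite (eq_covl cp sU sUE sV (ncut U)) (cov_combl _ sUc sE sV) /comb summxE.
have cutp W i : cut W i p = W c p 0 i by rewrite /cut (nbhs_singleton chi1) mul1r.
have Ep i : E i c p = basis_vec i := nbhs_singleton (nE i).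
rewrite -big_split; apply: eq_bigr => i _ /=.
rewrite mxE cutp (eq_covr cp (sE i) sV sVE (ncut V)) (cov_combr _ sVc sE (sE i) cp).
have lieE j : lie_derive c (E i) (cut V j) p =
    dz (basis_vec i) (fun z => V c (cinv c z) 0 j) (cmap c p).
  rewrite /lie_derive (bigD1 i) //= big1 ?addr0 => [|m mi]; last first.
    by rewrite Ep mxE eqxx (negPf mi) mul0r.
  have nj : \forall q \near p, cut V j q = V c q 0 j.
    by apply: filterS chi1 => q q1; rewrite /cut q1 mul1r.
  rewrite Ep mxE !eqxx mul1r.
  have sc : smooth (cmap c @` (setT `&` cdom c)) (cut V j \o cinv c).
    by rewrite chart_imageT; exact: scut.
  exact: (eq_dz_chart (basis_vec i) openT I cp' sc nj).
transitivity (U c p 0 i * \sum_j ((j == k)%:R *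
    dz (basis_vec i) (fun z => V c (cinv c z) 0 j) (cmap c p) + V c p 0 j * D (E i) (E j) c p 0 k)).
  rewrite summxE; congr (_ * _); apply: eq_bigr => j _.
  by rewrite [LHS]mxE [X in X + _]mxE [X in _ + X]mxE lieE Ep cutp mxE eqxx mulrC eq_sym.
rewrite big_split /= sum_delta mulrDr; congr (_ + _).
rewrite mulr_sumr; apply: eq_bigr => j _.
by rewrite /christoffel mulrA mulrC mulrA.
Unshelve. all: by end_near. Qed.

End Fields.

Section ChristoffelSymbols.
Variables (R : realType) (n : nat) (X : topologicalType).
Variables (M : complex_manifold R n X) (D : connection M).
Local Notation C := (Cplx R).
Local Notation Cn := (CVec R n).
Local Notation chart := (chart R n X).
Implicit Types (c : chart) (p q : X).

Lemma near_coord_field c p : chart_at M c p -> exists2 N : set X, open N /\ N p &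
  forall q, N q -> chart_at M c q /\ forall i, coord_field M c i p c q = basis_vec i.
Proof.
move=> cp; have : \forall q \near p, chart_at M c q /\
    forall i, coord_field M c i p c q = basis_vec i.
  apply: filterI; first exact: near_chart.
  by apply: filter_forall => i; exact: (proj2 (coord_fieldP i cp)).
by rewrite /prop_near1 nbhsE => -[N [oN Np] NP]; exists N.
Qed.

Lemma dz_coord_field c p (N : set X) j k i q : chart_at M c p -> open N -> N q ->
  (forall q, N q -> chart_at M c q /\ forall i, coord_field M c i p c q = basis_vec i) ->
  dz (basis_vec i) (fun z => coord_field M c j p c (cinv c z) 0 k) (cmap c q) = 0.
Proof.
move=> cp oN Nq NP; have [_ _ sE] := proj1 (coord_fieldP j cp).
have [[ac cq] _] := NP _ Nq.
have oO := open_chart_image c oN.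
have Oq : (cmap c @` (N `&` cdom c)) (cmap c q) by exists q.
have s1 : Ck 1 (cmap c @` (N `&` cdom c)) (fun z => coord_field M c j p c (cinv c z) 0 k).
  by apply: Ck_sub (sE c k ac 1%N) => z /chart_imageP[].
rewrite (eq_dz oO (basis_vec i) Oq s1 (h := fun=> (basis_vec j : Cn) 0 k)).
  exact: dz_cst.
by move=> z /chart_imageP[_ /NP[_ ->]].
Qed.

Lemma sum2_delta (K : pzRingType) (F : 'I_n -> 'I_n -> K) i j :
  \sum_a \sum_b F a b * (basis_vec i : 'rV[K]_n) 0 a * (basis_vec j : 'rV[K]_n) 0 b = F i j.
Proof.
rewrite (bigD1 i) //= (bigD1 j) //= !mxE !eqxx !mulr1 !big1 ?addr0 //.
  by move=> a ai; rewrite big1 // => b _; rewrite !mxE (negPf ai) !mulr0 mul0r.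
by move=> b bj; rewrite !mxE (negPf bj) andbF mulr0.
Qed.

(** [christoffel] chooses its coordinate fields anew at every point. Near [p], [cov_formula] shows
    that the fields chosen at [p] give the same values, and these come from a single smooth
    section. *)
Lemma smooth_christoffel c i j k : atlas M c ->
  smooth (cimg c) (fun z => christoffel D c i j k (cinv c z)).
Proof.
move=> ac; apply: smooth_local => z cz; have cq := cimg_cdom cz.
set p := cinv c z in cq; have cp : chart_at M c p by split.
have [N [oN Np] NP] := near_coord_field cp.
have [sEi sEj] := (proj1 (coord_fieldP i cp), proj1 (coord_fieldP j cp)).
have [_ _ sD] := cov_smooth D sEi sEj.
exists (cmap c @` (N `&` cdom c)); first by apply/chart_imageP.
have oO := open_chart_image c oN.
apply: (eq_smooth oO (g := fun z => D (coord_field M c i p) (coord_field M c j p) c (cinv c z) 0 k)).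
  move=> y /chart_imageP[cy Ny]; have [cy' Ey] := NP _ Ny.
  rewrite (cov_formula D k sEi sEj cy') big1 ?add0r.
    by rewrite !Ey; exact: (sum2_delta (fun a b => christoffel D c a b k (cinv c y))).
  by move=> a _; rewrite (dz_coord_field j k a cp oN Ny NP) mulr0.
by apply: smooth_sub (sD c k ac) => y /chart_imageP[].
Qed.

(** Coordinate fields have constant components near [p], so their bracket vanishes there and the
    torsion is the difference of the two sides. *)
Lemma christoffel_sym c i j k p : torsion_free D -> chart_at M c p ->
  christoffel D c i j k p = christoffel D c j i k p.
Proof.
move=> tf cp; have [N [oN Np] NP] := near_coord_field cp.
have [sEi sEj] := (proj1 (coord_fieldP i cp), proj1 (coord_fieldP j cp)).
have := tf _ _ sEi sEj c p cp => /(congr1 (fun v : Cn => v 0 k)).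
have lie0 U a b : lie_derive c U (fun q => coord_field M c a p c q 0 b) p = 0.
  rewrite /lie_derive big1 // => l _.
  by rewrite [dz _ _ _](dz_coord_field a b l cp oN Np NP) mulr0.
rewrite /torsion /bracket !mxE !lie0 !subr0 => /eqP; rewrite subr_eq0 => /eqP.
by [].
Qed.

(** The covariant derivative of two coordinate fields of [c], read in [c'], is computed in two ways:
    by transporting its components in [c], and by [cov_formula] in [c'], where these fields are rows
    of the Jacobian. *)
Lemma christoffel_change c c' a b k p : chart_at M c p -> chart_at M c' p ->
  \sum_m christoffel D c a b m p * jacobian c c' p m k =
  dz (basis_vec a) (fun z => jacobian c c' (cinv c z) b k) (cmap c p) +
  \sum_i \sum_j christoffel D c' i j k p * jacobian c c' p a i * jacobian c c' p b j.
Proof.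
move=> cp c'p; have [N [oN Np] NP] := near_coord_field cp.
have [ac cp'] := cp; have [ac' c'p'] := c'p.
have [sEa sEb] := (proj1 (coord_fieldP a cp), proj1 (coord_fieldP b cp)).
have [_ DJ _] := cov_smooth D sEa sEb.
have EJ i q l : N q -> chart_at M c' q -> coord_field M c i p c' q 0 l = jacobian c c' q i l.
  move=> Nq c'q; have [cq Eq] := NP _ Nq.
  have [_ VJ _] := proj1 (coord_fieldP i cp).
  by rewrite (VJ c c') // Eq -rowE mxE.
transitivity (D (coord_field M c a p) (coord_field M c b p) c' p 0 k).
  by rewrite (DJ c c') // mxE.
rewrite (cov_formula D k sEa sEb c'p); congr (_ + _); last first.
  by apply: eq_bigr => i _; apply: eq_bigr => j _; rewrite !EJ.
pose h q := coord_field M c b p c' q 0 k.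
have sh : smooth (cmap c' @` (setT `&` cdom c')) (h \o cinv c').
  by rewrite chart_imageT; case: sEb => _ _; exact.
transitivity (dz (basis_vec a) (h \o cinv c) (cmap c p)).
  rewrite (dz_chart_change openT ac ac' sh) //.
  by apply: eq_bigr => i _; rewrite EJ.
have sh' := smooth_chart_change openT ac ac' sh.
apply: (@eq_dz_chart _ _ _ c p (setT `&` cdom c') h (fun q => jacobian c c' q b k)) => //.
  by apply: openI; [exact: openT|exact: open_cdom].
near=> q; rewrite /h EJ //; near: q.
  exact: (open_nbhs_nbhs (conj oN Np)).
exact: near_chart.
Unshelve. all: by end_near. Qed.

End ChristoffelSymbols.

Section SumRearrangement.
Variables (K : comPzRingType) (n : nat).

Lemma sum_regroup (g x y v w : K) : g * (v * x) * (w * y) = g * x * y * (v * w).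
Proof. by ring. Qed.

Lemma sum_regroup2 (g x v w : K) : g * x * (v * w) = g * v * w * x.
Proof. by ring. Qed.

Lemma sum4_exchange (F : 'I_n -> 'I_n -> 'I_n -> 'I_n -> K) :
  \sum_i \sum_j \sum_a \sum_b F i j a b = \sum_a \sum_b \sum_i \sum_j F i j a b.
Proof.
under eq_bigr => i _ do rewrite exchange_big /=.
rewrite exchange_big /=; apply: eq_bigr => a _.
under eq_bigr => i _ do rewrite exchange_big /=.
by rewrite exchange_big.
Qed.

Lemma sum3_rotate (F : 'I_n -> 'I_n -> 'I_n -> K) :
  \sum_a \sum_b \sum_m F a b m = \sum_m \sum_a \sum_b F a b m.
Proof.
under eq_bigr => a _ do rewrite exchange_big /=.
by rewrite exchange_big.
Qed.

End SumRearrangement.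

(** * Wronskians under change of chart *)

Section CurveInCharts.
Variables (R : realType) (n : nat) (X : topologicalType).
Variables (M : complex_manifold R n X) (D : connection M).
Local Notation C := (Cplx R).
Local Notation Cn := (CVec R n).
Local Notation chart := (chart R n X).
Variables (e : C) (f : C -> X) (O : set C).
Hypotheses (e1 : e = 1) (oO : open O).
Implicit Types (c : chart) (p q : X).

Let dtE (g : C -> C) s : dt g s = dz e g s. Proof. by rewrite e1. Qed.

Definition curve_in_chart c := [/\ atlas M c, forall t, O t -> cdom c (f t) &
  forall k, holomorphic O (fun t => cmap c (f t) 0 k)].

Definition local_christoffel c i j k z := christoffel D c i j k (cinv c z).

Lemma wronskian_fieldS c r t k : wronskian_field D f c r.+1 t 0 k =
  dt (fun s => wronskian_field D f c r s 0 k) t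
  + \sum_i \sum_j christoffel D c i j k (f t)
      * dt (fun s => cmap c (f s) 0 i) t * wronskian_field D f c r t 0 j.
Proof. exact: mxE. Qed.

Lemma wfieldS (G : 'I_n -> 'I_n -> 'I_n -> Cn -> C) (g : C -> Cn) r t k :
  wfield e G g r.+1 t 0 k = dz e (fun s => wfield e G g r s 0 k) t
  + \sum_i \sum_j G i j k (g t) * dz e (fun s => g s 0 i) t * wfield e G g r t 0 j.
Proof. exact: mxE. Qed.

Lemma curve_in_chart_in c : curve_in_chart c -> curve_in O (cimg c) (fun t => cmap c (f t)).
Proof. by move=> [ac fc hf]; split=> // t Ot; apply: cimg_cmap; exact: fc. Qed.

Lemma wronskian_fieldE c r t : curve_in_chart c -> O t ->
  wronskian_field D f c r t = wfield e (local_christoffel c) (fun s => cmap c (f s)) r t.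
Proof.
move=> fc; have [ac cf hf] := fc; have ic := curve_in_chart_in fc.
have sG i j k := smooth_christoffel D i j k ac.
elim: r t => [|r IH] t Ot; first by apply/rowP => k; rewrite /= !mxE dtE.
apply/rowP => k; rewrite wronskian_fieldS wfieldS; congr (_ + _).
  rewrite dtE; apply/esym/(eq_dz oO e Ot (smooth_wfield e oO (open_cimg c) sG r k ic 1%N)).
  by move=> s Os; rewrite IH.
apply: eq_bigr => i _; apply: eq_bigr => j _.
by rewrite dtE IH // /local_christoffel cmapK //; exact: cf.
Qed.

Lemma smooth_wronskian_field c r k : curve_in_chart c ->
  smooth O (fun t => wronskian_field D f c r t 0 k).
Proof.
move=> fc; have [ac _ _] := fc.
apply: (eq_smooth oO _ (smooth_wfield e oO (open_cimg c) (fun i j k => smooth_christoffel D i j k ac)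
  r k (curve_in_chart_in fc))).
by move=> t Ot; rewrite wronskian_fieldE.
Qed.

Lemma dz_along_curve c (A : set X) h t : curve_in_chart c -> open A ->
  (forall s, O s -> A (f s)) -> smooth (cmap c @` (A `&` cdom c)) (h \o cinv c) -> O t ->
  dz e (fun s => h (f s)) t = \sum_a dz (basis_vec a) (h \o cinv c) (cmap c (f t)) *
    dz e (fun s => cmap c (f s) 0 a) t.
Proof.
move=> [ac cf hf] oA fA sh Ot; have oW := open_chart_image c oA.
have fO s : O s -> (cmap c @` (A `&` cdom c)) (cmap c (f s)).
  by move=> Os; exists (f s) => //; split; [exact: fA|exact: cf].
have sf s : O s -> (h \o cinv c) (cmap c (f s)) = h (f s).
  by move=> Os; rewrite /= cmapK //; exact: cf.
have sc := smooth_comp oO oW fO sh (fun j => proj1 (hf j)).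
by rewrite -(eq_dz oO e Ot (sc 1%N) sf) (dz_comp_holo e oW (fO _ Ot) sh Ot hf).
Qed.

Lemma smooth_along_curve c (A : set X) h : curve_in_chart c -> open A ->
  (forall s, O s -> A (f s)) -> smooth (cmap c @` (A `&` cdom c)) (h \o cinv c) ->
  smooth O (fun s => h (f s)).
Proof.
move=> [ac cf hf] oA fA sh; have oW := open_chart_image c oA.
have fO s : O s -> (cmap c @` (A `&` cdom c)) (cmap c (f s)).
  by move=> Os; exists (f s) => //; split; [exact: fA|exact: cf].
apply: (eq_smooth oO _ (smooth_comp oO oW fO sh (fun j => proj1 (hf j)))).
by move=> s Os; rewrite /= cmapK //; exact: cf.
Qed.

(** The fields are genuine tangent vectors along the curve. In the induction, the derivative of the
    Jacobian along the curve is absorbed by the inhomogeneous term of [christoffel_change]. *)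
Lemma wronskian_field_change c c' r t k : curve_in_chart c -> curve_in_chart c' -> O t ->
  wronskian_field D f c' r t 0 k =
  \sum_b wronskian_field D f c r t 0 b * jacobian c c' (f t) b k.
Proof.
move=> fc fc'; have [ac cf hf] := fc; have [ac' cf' hf'] := fc'.
have velocity s l : O s -> dz e (fun s => cmap c' (f s) 0 l) s =
    \sum_a dz e (fun s => cmap c (f s) 0 a) s * jacobian c c' (f s) a l.
  move=> Os; have sT := proj1 (holo_transition_image l ac ac').
  rewrite (@dz_along_curve c (cdom c') (fun q => cmap c' q 0 l)) //; last exact: open_cdom.
  by apply: eq_bigr => a _; rewrite mulrC; congr (_ * _); rewrite mxE.
elim: r t k => [|r IH] t k Ot.
  rewrite /= mxE dtE velocity //; apply: eq_bigr => a _; congr (_ * _).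
  by rewrite mxE dtE.
pose F b s := wronskian_field D f c r s 0 b.
pose J b l s := jacobian c c' (f s) b l.
have sF b : smooth O (F b) := smooth_wronskian_field r b fc.
have sJ0 b l := proj1 (holo_jacobian b l ac ac').
have sJ b l : smooth O (J b l).
  exact: (smooth_along_curve (h := fun q => jacobian c c' q b l) fc (open_cdom c') cf' (sJ0 b l)).
have sFJ b : smooth O (fun s => F b s * J b k s) by exact: (smoothM oO (sF b) (sJ b k)).
pose dJ a b := dz (basis_vec a) (fun z => jacobian c c' (cinv c z) b k) (cmap c (f t)).
pose v a := dz e (fun s => cmap c (f s) 0 a) t.
have dzJ b : dz e (J b k) t = \sum_a dJ a b * v a.
  exact: (dz_along_curve (h := fun q => jacobian c c' q b k) fc (open_cdom c') cf' (sJ0 b k) Ot).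
have EF s : O s -> \sum_b F b s * J b k s = wronskian_field D f c' r s 0 k.
  by move=> Os; rewrite IH.
have sS : smooth O (fun s => \sum_b F b s * J b k s) by exact: (smooth_sum oO _ sFJ).
have dF : dz e (fun s => wronskian_field D f c' r s 0 k) t =
    \sum_b dz e (F b) t * J b k t + \sum_a \sum_b dJ a b * v a * F b t.
  rewrite -(eq_dz oO e Ot (sS 1%N) EF) (dz_sum oO _ e Ot (fun b => sFJ b 1%N)).
  rewrite [X in _ + X]exchange_big -big_split; apply: eq_bigr => b _ /=.
  rewrite (dzM e Ot (sF b 1%N) (sJ b k 1%N)) dzJ; congr (_ + _).
  by rewrite mulrC mulr_suml.
have cft : chart_at M c (f t) by split=> //; exact: cf.
have cft' : chart_at M c' (f t) by split=> //; exact: cf'.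
pose S := \sum_i \sum_j christoffel D c' i j k (f t) *
  dz e (fun s => cmap c' (f s) 0 i) t * wronskian_field D f c' r t 0 j.
transitivity (dz e (fun s => wronskian_field D f c' r s 0 k) t + S).
  by rewrite wronskian_fieldS dtE; congr (_ + _); apply: eq_bigr => i _; apply: eq_bigr => j _; rewrite dtE.
have -> : S =
  \sum_a \sum_b (\sum_i \sum_j christoffel D c' i j k (f t) * J a i t * J b j t) * (v a * F b t).
  transitivity (\sum_i \sum_j \sum_a \sum_b christoffel D c' i j k (f t) * J a i t * J b j t * (v a * F b t)).
    apply: eq_bigr => i _; apply: eq_bigr => j _; rewrite velocity // IH //.
    rewrite [X in X * _]mulr_sumr.
    rewrite mulr_suml; apply: eq_bigr => a _; rewrite mulr_sumr; apply: eq_bigr => b _.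
    exact: sum_regroup.
  rewrite sum4_exchange; apply: eq_bigr => a _; apply: eq_bigr => b _.
  by rewrite mulr_suml; apply: eq_bigr => i _; rewrite mulr_suml.
rewrite dF -addrA -big_split /=.
have -> : \sum_a (\sum_b dJ a b * v a * F b t + \sum_b (\sum_i \sum_j
     christoffel D c' i j k (f t) * J a i t * J b j t) * (v a * F b t)) =
  \sum_a \sum_b \sum_m christoffel D c a b m (f t) * J m k t * (v a * F b t).
  apply: eq_bigr => a _; rewrite -big_split; apply: eq_bigr => b _ /=.
  rewrite -mulr_suml (christoffel_change D a b k cft cft') mulrDl; congr (_ + _).
  by rewrite mulrA.
rewrite sum3_rotate -big_split; apply: eq_bigr => m _ /=.
rewrite wronskian_fieldS mulrDl; congr (_ + _); first by rewrite dtE.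
rewrite mulr_suml; apply: eq_bigr => a _; rewrite mulr_suml; apply: eq_bigr => b _.
rewrite dtE; exact: sum_regroup2.
Qed.

Lemma wronskian_change c c' t : curve_in_chart c -> curve_in_chart c' -> O t ->
  wronskian D f c' t = wronskian D f c t * \det (jacobian c c' (f t)).
Proof.
move=> fc fc' Ot; rewrite /wronskian -det_mulmx; congr (\det _); apply/matrixP => r k.
rewrite [LHS]mxE [RHS]mxE (wronskian_field_change r k fc fc' Ot).
by apply: eq_bigr => b _; congr (_ * _); rewrite [RHS]mxE.
Qed.

End CurveInCharts.

(** * The two implications *)

Section ProjectiveInvariance.
Variables (R : realType) (n : nat) (X : topologicalType).
Variables (M : complex_manifold R n X).
Local Notation C := (Cplx R).
Local Notation Cn := (CVec R n).
Local Notation chart := (chart R n X).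
Implicit Types (c : chart) (D : connection M).

Lemma pairing_basis (al : Cn) i : pairing al (basis_vec i) = al 0 i.
Proof.
rewrite /pairing (bigD1 i) //= big1 ?addr0 ?mxE ?eqxx ?mulr1 // => k ki.
by rewrite mxE (negPf ki) mulr0.
Qed.

Lemma projective_part_shift (N x y z u v s t : C) : N != 0 ->
  x + u * t + v * s - N^-1 * (s * (y + N * v) + t * (z + N * u)) =
  x - N^-1 * (s * y + t * z).
Proof. by move=> N0; field. Qed.

(** The one-form changes each trace by n + 1 times its coefficient, and the factor 1/(n+1) turns
    this into the very terms added to the symbols. *)
Lemma proj_christoffel_equiv D D' c i j k p : proj_equiv D D' -> chart_at M c p ->
  proj_christoffel D' c i j k p = proj_christoffel D c i j k p.
Proof.
move=> /(_ p)[N [al [oN Np _ E]]] cp; have [ac cp'] := cp.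
pose a := al c p 0.
have GE i' j' k' : christoffel D' c i' j' k' p =
    christoffel D c i' j' k' p + a i' * (k' == j')%:R + a j' * (k' == i')%:R.
  have [sEi nEi] := coord_fieldP i' cp; have [sEj nEj] := coord_fieldP j' cp.
  rewrite /christoffel (E _ _ sEi sEj c p Np cp) (nbhs_singleton nEi) (nbhs_singleton nEj).
  by rewrite !pairing_basis !mxE eqxx /=.
have tr j' : \sum_l christoffel D' c l j' l p =
    \sum_l christoffel D c l j' l p + n.+1%:R * a j'.
  transitivity (\sum_l (christoffel D c l j' l p + ((l == j')%:R * a l + a j'))).
    by apply: eq_bigr => l _; rewrite GE eqxx mulr1 mulrC -addrA.
  by rewrite !big_split /= sumr_const card_ord sum_delta -nat1r mulrDl mul1r mulr_natl.
rewrite /proj_christoffel GE !tr; apply: projective_part_shift.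
by rewrite pnatr_eq0.
Qed.

Lemma projective_class_refl D : torsion_free D -> projective_class D D.
Proof.
move=> tf; split=> // p; exists setT, (fun _ _ => 0); split=> //.
- exact: openT.
- split=> [c c' q _ _ _|c k ac]; first by rewrite mul0mx.
  have oO := open_chart_image c (@openT X).
  apply: (eq_smooth oO (g := fun=> 0)); last exact: (smooth_cst oO).
  by move=> z _; rewrite mxE.
- move=> U V _ _ c q _ _; rewrite /pairing !big1 ?scale0r ?addr0 //.
    by move=> l _; rewrite mxE mul0r.
  by move=> k _; rewrite mxE mul0r.
Qed.

End ProjectiveInvariance.

Lemma det_mulmxC (K : comNzRingType) n (A B : 'M[K]_n) :
  \det (A *m B) = \det B * \det A.
Proof. by rewrite det_mulmx mulrC. Qed.

Section PositivityTest.
Variables (R : realType) (n : nat) (X : topologicalType).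
Variables (M : complex_manifold R n X) (D : connection M).
Local Notation C := (Cplx R).
Local Notation Cn := (CVec R n).
Local Notation chart := (chart R n X).
Variables (e : C) (c : chart).
Hypotheses (e1 : e = 1) (ac : atlas M c).

Lemma eq_wfield (G : 'I_n -> 'I_n -> 'I_n -> Cn -> C) (O : set C) (O' : set Cn) g g' r t :
  open O -> open O' -> (forall i j k, smooth O' (G i j k)) -> curve_in O O' g ->
  (forall s, O s -> g s = g' s) -> O t -> wfield e G g r t = wfield e G g' r t.
Proof.
move=> oO oO' sG ig gg Ot; have [_ hg] := ig.
have dgg k s : O s -> dz e (fun s => g s 0 k) s = dz e (fun s => g' s 0 k) s.
  move=> Os; apply: (eq_dz oO e Os (holo_Ck 1 (hg k))).
  by move=> q Oq; rewrite gg.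
elim: r t Ot => [|r IH] t Ot; first by apply/rowP => k; rewrite [LHS]mxE [RHS]mxE dgg.
apply/rowP => k; rewrite (wfieldS e G g r t k) (wfieldS e G g' r t k); congr (_ + _).
  apply: (eq_dz oO e Ot (smooth_wfield e oO oO' sG r k ig 1%N)).
  by move=> q Oq; rewrite IH.
by apply: eq_bigr => i _; apply: eq_bigr => j _; rewrite gg // dgg // IH.
Qed.

(** The coordinate frame of [c], seen in the chart [c']. Relative to it the coefficient w_f is the
    coordinate determinant [wdet]. *)
Definition jacobian_frame c' q : C := \det (jacobian c c' q).

Lemma holo_jacobian_frame : holo_frame M (cdom c) jacobian_frame.
Proof.
split=> [c' p cp [ac' c'p]|c' c'' p cp [ac' c'p] [ac'' c''p]|c' ac'].
- exact: (jacobian_unit ac ac' cp c'p).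
- rewrite /jacobian_frame (jacobian_chain ac ac' ac'' cp c'p c''p); exact: det_mulmxC.
have oO := open_chart_image c' (open_cdom c).
apply: (holo_det oO) => i j.
apply: holo_sub (holo_chart_change (a := fun q => jacobian c c' q i j) (open_cdom c') ac' ac
  (holo_jacobian i j ac ac')).
by move=> z [p [cp c'p] <-]; exists p.
Qed.

Variables (p : Cn) (g : C -> Cn).
Hypotheses (cp : cimg c p) (eg : entire_curve p g).
Let G := local_christoffel D c.
Let f := cinv c \o g.

Let sG i j k : smooth (cimg c) (G i j k).
Proof. exact: smooth_christoffel. Qed.

Let cg t : {for t, continuous g}.
Proof.
by apply: continuous_row => k; exact: (Ck_continuous (holo_Ck 0 (proj2 eg k))).
Qed.

Lemma disk_in_chart : exists2 r : R, 0 < r &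
  forall t, ball (0 : C) (r%:C)%C t -> cimg c (g t).
Proof.
have oU := open_curve (open_cimg c) eg.
have U0 : (g @^-1` cimg c) 0 by rewrite /= (proj1 eg).
have /nbhs_ballP[r' /= r'0 rU] := open_nbhs_nbhs (conj oU U0).
by have [r r0 rE] := gt0_Cplx r'0; exists r => // t; rewrite -rE => /rU.
Qed.

Variable B : set C.
Hypotheses (oB : open B) (Bc : forall t, B t -> cimg c (g t)).

Lemma curve_in_charts c' : atlas M c' -> open (B `&` f @^-1` cdom c') /\
  curve_in_chart M f (B `&` f @^-1` cdom c') c'.
Proof.
move=> ac'; set O := B `&` _.
have OE : O = B `&` g @^-1` (cmap c @` (cdom c' `&` cdom c)).
  rewrite eqEsubset; split=> t [Bt ft]; split=> //.
    by apply/chart_imageP; split=> //; exact: Bc.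
  by move: ft => /chart_imageP[].
have oO : open O.
  rewrite OE; apply: openI => //.
  by apply: open_comp; [move=> t _; exact: cg|exact/open_chart_image/open_cdom].
split=> //; split=> // [t []|k] //.
have oW := open_chart_image c (open_cdom c').
apply: (holo_comp oO oW _ (holo_transition_image k ac ac')) => [t|j].
  by rewrite OE => -[].
by apply: holo_sub (proj2 eg j).
Qed.

Lemma holo_curve_entire : holo_curve M B f.
Proof.
split=> [t Bt|c' k ac']; last by case: (curve_in_charts ac') => _ [].
by apply: continuous_comp; [exact: cg|exact/cinv_continuous/Bc].
Qed.

Lemma wronskian_wdet c' t : B t -> chart_at M c' (f t) ->
  wronskian D f c' t = wdet e G g t * jacobian_frame c' (f t).
Proof.
move=> Bt [ac' c't]; have [oO fc'] := curve_in_charts ac'.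
set O := B `&` _ in oO fc'; have Ot : O t by [].
have ig : curve_in O (cimg c) g.
  by split=> [s [/Bc]|k] //; apply: holo_sub (proj2 eg k).
have fg s : O s -> g s = cmap c (f s) by move=> [Bs _]; rewrite cinvK //; exact: Bc.
have fc : curve_in_chart M f O c.
  split=> // [s [Bs _]|k]; first exact/cimg_cdom/Bc.
  by apply: (eq_holo oO _ (proj2 ig k)) => s Os; rewrite fg.
rewrite (wronskian_change D e1 oO fc fc' Ot); congr (_ * _).
congr (\det _); apply/matrixP => r k; rewrite [LHS]mxE [RHS]mxE.
rewrite (wronskian_fieldE D e1 oO r fc Ot).
by rewrite (eq_wfield r oO (open_cimg c) sG ig fg Ot).
Qed.

End PositivityTest.

(** * Positivity implies a holomorphic projective class *)

Section Necessity.
Variables (R : realType) (n : nat) (X : topologicalType).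
Variables (M : complex_manifold R n X) (D : connection M).
Hypotheses (n2 : (2 <= n)%N) (tf : torsion_free D) (pos : wronskian_positive D).

(** Supplies the positivity hypothesis of the local criterion: an entire coordinate curve is
    restricted to a disk on which it stays in the chart, and the frame of that chart is used. *)
Lemma positive_laplace (e : Cplx R) c p g W : e = 1 -> atlas M c -> cimg c p ->
  entire_curve p g -> W = wdet e (local_christoffel D c) g -> W 0 != 0 ->
  0 <= complex.Re (dz e (dzbar e W) 0 / W 0 - dz e W 0 * dzbar e W 0 / W 0 ^+ 2).
Proof.
move=> e1 ac cp eg WW W0; have [r r0 rc] := disk_in_chart cp eg.
set B := ball _ _ in rc; have rC : 0 < (r%:C)%C :> R[i] by rewrite ltcR.
have oB : open B by exact: ball_open.
have B0 : B 0 by exact: ballxx.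
pose f := cinv c \o g.
have WE := wronskian_wdet D e1 ac eg oB rc; rewrite -WW in WE.
have c0 : chart_at M c (f 0) by split=> //; exact: cimg_cdom (rc _ B0).
have sW : smooth B W.
  rewrite WW; apply: (smooth_wdet e (open_cimg c) (fun i j k => smooth_christoffel D i j k ac) oB).
  by apply: entire_curve_in eg _ => t /rc.
apply: (subharmonic_log_laplace e1 oB B0 (sW 2%N) W0).
apply: (pos r0 (holo_curve_entire ac eg oB rc) _ r0 (@subset_refl _ _)
  (open_cdom c) (holo_jacobian_frame ac)) => //.
- exists 0, c; split=> //; rewrite WE //.
  by rewrite /jacobian_frame jacobian_id ?det1 ?mulr1 //; case: c0.
- by move=> _ [t Bt <-]; exact: cimg_cdom (rc _ Bt).
- by move=> t c' Bt ct; exact: WE.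
Qed.

Lemma positive_holomorphic_class : holomorphic_class (projective_class D).
Proof.
move=> D' [tf' DD'] c i j k l ac z cz; have oc := open_cimg c.
have sG i' j' k' : smooth (cimg c) (local_christoffel D c i' j' k').
  exact: smooth_christoffel.
have symG i' j' k' y : cimg c y -> local_christoffel D c i' j' k' y =
    local_christoffel D c j' i' k' y.
  by move=> cy; apply: christoffel_sym => //; split=> //; exact: cimg_cdom.
have sT j' : Ck 1 (cimg c) (fun y => \sum_a local_christoffel D c a j' a y).
  exact: (Ck_sum _ oc (fun a => sG a j' a 1%N)).
have k1 b j' := CkZ b oc (sT j').
have kP := CkB oc (sG i j k 1%N) (CkZ ((n.+1%:R)^-1) oc (CkD oc (k1 (k == i)%:R j) (k1 (k == j)%:R i))).
rewrite -(eq_dzbar oc (basis_vec l) cz kP).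
  apply: (@local_projective_dbar R n 1 erefl _ (cimg c) z oc cz sG symG n2).
  by move=> g eg W0; exact: (positive_laplace erefl ac cz eg erefl W0).
by move=> y cy; rewrite /= (proj_christoffel_equiv _ _ _ DD') //; split=> //; exact: cimg_cdom.
Qed.

End Necessity.

Lemma holo_local (R : realType) (V : normedModType R[i]) (O : set V) g :
  (forall p, O p -> exists2 N : set V, N p & holomorphic N g) -> holomorphic O g.
Proof.
move=> H; split; first by apply: smooth_local => p /H[N Np [sg _]]; exists N.
by move=> v p /H[N Np hg]; exact: holo_dzbar hg Np.
Qed.

Section Regroup.
Variables (K : comPzRingType) (n : nat).

Lemma regroup (p v f a b x y : K) :
  (p + (x * a + y * b)) * v * f = p * v * f + (x * (v * (a * f)) + y * (b * v * f)).
Proof. by ring. Qed.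

Lemma regroup3 (dc c b x dx q : K) :
  dc * x + c * dx + c * q + b * (c * x) = (dc + b * c) * x + c * (dx + q).
Proof. by ring. Qed.

Lemma regroup4 (a b c d : K) : a + b + c + d = a + d + (b + c).
Proof. by ring. Qed.

Lemma big_split_sum2 (f g h : 'I_n -> 'I_n -> K) :
  \sum_i \sum_j f i j + (\sum_i \sum_j g i j + \sum_i \sum_j h i j) =
  \sum_i \sum_j (f i j + (g i j + h i j)).
Proof.
rewrite -!big_split; apply: eq_bigr => i _ /=.
by rewrite -!big_split.
Qed.

End Regroup.

(** * Removing the trace part from the Wronskian *)

Section HolomorphicFrame.
Variables (R : realType) (n : nat) (e : Cplx R).
Local Notation C := (Cplx R).
Local Notation Cn := (CVec R n).
Variables (P : 'I_n -> 'I_n -> 'I_n -> Cn -> C) (O : set C) (O' : set Cn) (g : C -> Cn).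
Hypotheses (oO : open O) (oO' : open O').
Hypothesis hP : forall i j k, holomorphic O' (P i j k).
Hypothesis ig : curve_in O O' g.

Lemma holo_wfield r k : holomorphic O (fun t => wfield e P g r t 0 k).
Proof.
have [gO hg] := ig; elim: r k => [|r IH] k.
  apply: (eq_holo oO (g := dz e (fun s => g s 0 k))); first by move=> q _; rewrite mxE.
  exact: holo_dz.
apply: (eq_holo oO (g := fun t => dz e (fun s => wfield e P g r s 0 k) t
      + \sum_i \sum_j P i j k (g t) * dz e (fun s => g s 0 i) t * wfield e P g r t 0 j)).
  by move=> q _; rewrite wfieldS.
apply: (holoD oO (holo_dz oO e (IH k))).
apply: (holo_sum oO) => i; apply: (holo_sum oO) => j; apply: (holoM oO _ (IH j)).
exact: (holoM oO (holo_comp oO oO' gO (hP i j k) hg) (holo_dz oO e (hg i))).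
Qed.

Variables (G : 'I_n -> 'I_n -> 'I_n -> Cn -> C) (A : 'I_n -> Cn -> C).
Hypothesis sA : forall i, smooth O' (A i).
Hypothesis GE : forall i j k z, O' z ->
  G i j k z = P i j k z + ((k == i)%:R * A j z + (k == j)%:R * A i z).

Let v i t := dz e (fun s => g s 0 i) t.
Let F r k t := wfield e G g r t 0 k.
Let E r k t := wfield e P g r t 0 k.

Let sG i j k : smooth O' (G i j k).
Proof.
apply: (eq_smooth oO' (g := fun z => P i j k z + ((k == i)%:R * A j z + (k == j)%:R * A i z))).
  by move=> z Oz; rewrite GE.
apply: (smoothD oO' (proj1 (hP i j k))).
by apply: (smoothD oO'); apply: (smoothM oO' (smooth_cst oO' _)).
Qed.

Let sF r k : smooth O (F r k). Proof. exact: (smooth_wfield e oO oO' sG r k ig). Qed.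
Let sE r k : smooth O (E r k). Proof. exact: proj1 (holo_wfield r k). Qed.
Let sv i : smooth O (v i). Proof. exact: proj1 (holo_dz oO e (proj2 ig i)). Qed.
Let sAg i : smooth O (fun t => A i (g t)).
Proof. by have [gO hg] := ig; exact: (smooth_comp oO oO' gO (sA i) (fun j => proj1 (hg j))). Qed.

Let alpha r t := \sum_j A j (g t) * F r j t.
Let beta t := \sum_i A i (g t) * v i t.

Lemma quadratic_split r k t : O t ->
  \sum_i \sum_j G i j k (g t) * v i t * F r j t =
  \sum_i \sum_j P i j k (g t) * v i t * F r j t + (alpha r t * v k t + beta t * F r k t).
Proof.
move=> Ot; have Ogt := proj1 ig t Ot.
transitivity (\sum_i \sum_j (P i j k (g t) * v i t * F r j t +
   ((i == k)%:R * (v i t * (A j (g t) * F r j t)) + (j == k)%:R * (A i (g t) * v i t * F r j t)))).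
  apply: eq_bigr => i _; apply: eq_bigr => j _.
  by rewrite (GE _ _ _ Ogt) ![_ == k]eq_sym; exact: regroup.
rewrite -big_split_sum2; congr (_ + _); congr (_ + _).
  under eq_bigr => i _ do rewrite -mulr_sumr -mulr_sumr.
  by rewrite sum_delta mulrC.
under eq_bigr => i _ do rewrite sum_delta.
by rewrite -mulr_suml.
Qed.

(* The trace part of [G] only adds multiples of the first and of the current field, so it
   does not change the flag spanned by the fields. *)
Lemma wfield_unitriangular r : exists c : nat -> C -> C,
  [/\ forall s, smooth O (c s), forall t, c r t = 1 &
    forall t k, O t -> F r k t = \sum_(0 <= s < r.+1) c s t * E s k t].
Proof.
elim: r => [|r [c [sc cr FE]]].
  exists (fun _ _ => 1); split=> // [s|t k Ot]; first exact: smooth_cst.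
  by rewrite big_nat1 mul1r /F /E !mxE.
pose d s t := dz e (c s) t + beta t * c s t.
have sbeta : smooth O beta by apply: (smooth_sum oO) => i; exact: (smoothM oO (sAg i) (sv i)).
have salpha : smooth O (alpha r) by apply: (smooth_sum oO) => j; exact: (smoothM oO (sAg j) (sF r j)).
have sd s : smooth O (d s).
  exact: (smoothD oO (smooth_dz e oO (sc s)) (smoothM oO sbeta (sc s))).
(* [alpha r] goes to index 0 because the velocity is [E 0]. The factor [(s' < r)%:R] removes [d]
   beyond index [r], so the coefficient of index [r.+1] is [c r], that is 1. *)
exists (fun s t => if s is s'.+1 then (s' < r)%:R * d s t + c s' t else d 0 t + alpha r t).
split=> [[|s]|t|t k Ot].
- exact: (smoothD oO (sd 0) salpha).
- exact: (smoothD oO (smoothM oO (smooth_cst oO _) (sd s.+1)) (sc s)).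
- by rewrite ltnn mul0r add0r cr.
have scE s k' : smooth O (fun t => c s t * E s k' t) by exact: (smoothM oO (sc s) (sE s k')).
have dF : dz e (F r k) t = \sum_(0 <= s < r.+1) (dz e (c s) t * E s k t + c s t * dz e (E s k) t).
  have sS : smooth O (fun t => \sum_(0 <= s < r.+1) c s t * E s k t).
    exact: (smooth_sum oO _ (fun s => scE s k)).
  rewrite -(eq_dz oO e Ot (sS 1%N) (fun q Oq => esym (FE q k Oq))).
  rewrite (dz_sum oO _ e Ot (fun s => scE s k 1%N)); apply: eq_bigr => s _.
  by rewrite (dzM e Ot (sc s 1%N) (sE s k 1%N)).
transitivity (dz e (F r k) t + \sum_i \sum_j G i j k (g t) * v i t * F r j t).
  exact: wfieldS.
have PF : \sum_i \sum_j P i j k (g t) * v i t * F r j t =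
    \sum_(0 <= s < r.+1) c s t * (\sum_i \sum_j P i j k (g t) * v i t * E s j t).
  transitivity (\sum_i \sum_j \sum_(0 <= s < r.+1) c s t * (P i j k (g t) * v i t * E s j t)).
    apply: eq_bigr => i _; apply: eq_bigr => j _; rewrite (FE t j Ot) mulr_sumr.
    by apply: eq_bigr => s _; rewrite mulrCA.
  under eq_bigr => i _ do rewrite exchange_big /=.
  rewrite exchange_big; apply: eq_bigr => s _ /=; rewrite mulr_sumr.
  by apply: eq_bigr => i _; rewrite mulr_sumr.
have ES s : E s.+1 k t = dz e (E s k) t + \sum_i \sum_j P i j k (g t) * v i t * E s j t.
  exact: wfieldS.
have vE : v k t = E 0 k t by rewrite /E mxE.
rewrite (quadratic_split r k Ot) dF PF vE (FE t k Ot).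
have -> : \sum_(0 <= s < r.+1) (dz e (c s) t * E s k t + c s t * dz e (E s k) t) +
    (\sum_(0 <= s < r.+1) c s t * (\sum_i \sum_j P i j k (g t) * v i t * E s j t) +
     (alpha r t * E 0 k t + beta t * \sum_(0 <= s < r.+1) c s t * E s k t)) =
    \sum_(0 <= s < r.+1) d s t * E s k t + \sum_(0 <= s < r.+1) c s t * E s.+1 k t +
    alpha r t * E 0 k t.
  rewrite mulr_sumr -[alpha r t * _ + _]addrC !addrA; congr (_ + _).
  rewrite -!big_split; apply: eq_bigr => s _ /=; rewrite ES /d; exact: regroup3.
rewrite [RHS]big_nat_recl // mulrDl [X in X + _ + _]big_nat_recl //.
have -> : \sum_(0 <= s < r.+1) ((s < r)%:R * d s.+1 t + c s t) * E s.+1 k t =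
    \sum_(0 <= s < r) d s.+1 t * E s.+1 k t + \sum_(0 <= s < r.+1) c s t * E s.+1 k t.
  have -> : \sum_(0 <= s < r) d s.+1 t * E s.+1 k t =
      \sum_(0 <= s < r.+1) (s < r)%:R * (d s.+1 t * E s.+1 k t).
    rewrite [RHS]big_nat_recr //= ltnn mul0r addr0.
    by apply: eq_big_nat => s /andP[_ ->]; rewrite mul1r.
  by rewrite -big_split; apply: eq_bigr => s _ /=; rewrite mulrDl mulrA.
exact: regroup4.
Qed.

(** The two matrices of fields differ by a lower triangular factor with unit diagonal. *)
Lemma wdet_holomorphic_frame t : O t -> wdet e G g t = wdet e P g t.
Proof.
move=> Ot; have /choice[c cP] := wfield_unitriangular.
pose L : 'M[C]_n := \matrix_(r, s) if (s <= r)%N then c r s t else 0.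
have dL : \det L = 1.
  rewrite det_trig; last by apply/is_trig_mxP => i j ij; rewrite mxE leqNgt ij.
  by rewrite big1 // => i _; rewrite mxE leqnn; have [_ -> _] := cP i.
rewrite /wdet -[RHS]mul1r -dL -det_mulmx; congr (\det _); apply/matrixP => r k.
rewrite [LHS]mxE [RHS]mxE; have [_ _ FE] := cP r; rewrite [LHS](FE t k Ot).
rewrite (big_nat_widen _ _ n) ?ltn_ord // big_mkcond big_mkord; apply: eq_bigr => s _.
rewrite !mxE ltnS /=; case: ifP => // _; by rewrite mul0r.
Qed.

Lemma holo_wdet : holomorphic O (wdet e G g).
Proof.
apply: (eq_holo oO (g := wdet e P g)).
  by move=> t Ot; rewrite wdet_holomorphic_frame.
by apply: (holo_det oO) => r k; apply: (eq_holo oO _ (holo_wfield r k)) => t _; rewrite mxE.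
Qed.

End HolomorphicFrame.

(** * A holomorphic projective class implies positivity *)

Section Sufficiency.
Variables (R : realType) (n : nat) (X : topologicalType).
Variables (M : complex_manifold R n X) (D : connection M).
Local Notation C := (Cplx R).
Hypotheses (tf : torsion_free D) (holo : holomorphic_class (projective_class D)).
Implicit Types (c : chart R n X).

Lemma projective_decomposition (K : comPzRingType) (N x s t y z : K) :
  x = x - N * (s * y + t * z) + (s * (N * y) + t * (N * z)).
Proof. by ring. Qed.

Lemma holo_proj_christoffel c i j k : atlas M c ->
  holomorphic (cimg c) (fun z => proj_christoffel D c i j k (cinv c z)).
Proof.
move=> ac; have oc := open_cimg c.
have sG i' j' k' := smooth_christoffel D i' j' k' ac.
have sT j' : smooth (cimg c) (fun z => \sum_l christoffel D c l j' l (cinv c z)).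
  exact: (smooth_sum oc _ (fun l => sG l j' l)).
have sP : smooth (cimg c) (fun z => proj_christoffel D c i j k (cinv c z)).
  apply: (smoothB oc (sG i j k)); apply: (smoothM oc (smooth_cst oc _)).
  exact: (smoothD oc (smoothM oc (smooth_cst oc _) (sT j)) (smoothM oc (smooth_cst oc _) (sT i))).
split=> // v z cz; rewrite (dzbar_lin_comb v oc cz (sP 1%N)) big1 // => l _.
by rewrite (holo (projective_class_refl tf) i j k l ac cz) mulr0.
Qed.

Lemma holo_wronskian (e : C) (f : C -> X) (N : set C) c : e = 1 -> open N ->
  curve_in_chart M f N c -> holomorphic N (fun t => wronskian D f c t).
Proof.
move=> e1 oN fc; have [ac cf hf] := fc; have oc := open_cimg c.
pose P i j k z := proj_christoffel D c i j k (cinv c z).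
(* The trace part, merely smooth: exactly what [proj_christoffel] subtracts. *)
pose A i z : C := (n.+1%:R)^-1 * \sum_l christoffel D c l i l (cinv c z).
have sA i : smooth (cimg c) (A i).
  apply: (smoothM oc (smooth_cst oc _)).
  exact: (smooth_sum oc _ (fun l => smooth_christoffel D l i l ac)).
have GE i j k z : cimg c z -> local_christoffel D c i j k z =
    P i j k z + ((k == i)%:R * A j z + (k == j)%:R * A i z).
  by move=> _; exact: projective_decomposition.
have ig := curve_in_chart_in fc.
apply: (eq_holo oN _ (holo_wdet e oN oc (fun i j k => holo_proj_christoffel i j k ac) ig sA GE)).
move=> t Nt; congr (\det _); apply/matrixP => r k; rewrite [LHS]mxE [RHS]mxE.
by rewrite (wronskian_fieldE D e1 oN r fc Nt).
Qed.

(** The disk may leave any single chart, so holomorphy of [w] is proved near each point, where it is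
    the quotient of the Wronskian by the coefficient of the frame in a chart. *)
Lemma holomorphic_class_positive : wronskian_positive D.
Proof.
move=> f a r r0 [cf hf] _ b s s0 Bsub O ef oO [e0 _ he] fO w wE.
set B := ball b _ in Bsub fO wE *; have oB : open B by exact: ball_open.
apply: (subharmonic_log_holo oB); apply: holo_local => t0 Bt0.
have [c ac ct0] := atlas_cover M (f t0).
pose N := B `&` f @^-1` cdom c.
have oN : open N.
  rewrite openE => t [Bt ct]; apply: filterI; first exact: (open_nbhs_nbhs (conj oB Bt)).
  exact: (cf t (Bsub _ Bt) _ (open_nbhs_nbhs (conj (open_cdom c) ct))).
exists N; first by [].
have fc : curve_in_chart M f N c.
  by split=> // [t []|k] //; apply: holo_sub (hf c k ac) => t [Bt ct]; split=> //; exact: Bsub.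
have cN t : N t -> chart_at M c (f t) by move=> [].
have ON t : N t -> O (f t) by move=> [Bt _]; apply: fO; exists t.
have hef : holomorphic N (fun t => ef c (f t)).
  have oW := open_chart_image c oO; have [_ _ hg] := fc.
  have fW t : N t -> (cmap c @` (O `&` cdom c)) (cmap c (f t)).
    by move=> Nt; exists (f t) => //; split; [exact: ON|case: (cN t Nt)].
  apply: (eq_holo oN _ (holo_comp oN oW fW (he c ac) hg)) => t Nt.
  by rewrite /= cmapK //; case: (cN t Nt).
have ef0 t : N t -> ef c (f t) != 0 by move=> Nt; apply: e0; [exact: ON|exact: cN].
apply: (eq_holo oN _ (holoM oN (holo_wronskian erefl oN fc) (holo_inv oN ef0 hef))) => t Nt.
by rewrite (wE t c (proj1 Nt) (cN t Nt)) mulfK //; exact: ef0.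
Qed.

End Sufficiency.

Theorem theorem1p4 (R : realType) (n : nat) (X : topologicalType)
    (M : complex_manifold R n X) (D : connection M) :
  (2 <= n)%N -> torsion_free D ->
  wronskian_positive D <-> holomorphic_class (projective_class D).
Proof.
move=> n2 tf; split=> [pos|holo]; first exact: (positive_holomorphic_class n2 tf pos).
exact: (holomorphic_class_positive tf holo).
Qed.
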